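(* Assume: (A1) $\overline X$ has finite expectation, $\hat F(t,x)>0$ a.s. for all $(t,x)\in\mathbb R^+\times\mathbb R^+$, and there is a constant $L_{\hat F}\ge 0$ with $\operatorname{ess\,sup}_{\omega\in\Omega}|\hat F(t,x)-\hat F(t,\bar x)|\le L_{\hat F}|x-\bar x|$ for all $t,x,\bar x\in\mathbb R^+$. (A2) There exist an $\mathscr F_\infty\otimes\mathcal B(\mathbb R^+)$-measurable function $\overline F:\Omega\times\mathbb R^+\to(0,\infty)$ and a constant $L_{\overline F}\ge0$ such that $$\lim_{t\to\infty}\mathbb E\Big[\sup_{x\in\mathbb R^+}|\hat F(t,x)-\overline F(x)|\Big]=0,\qquad |\overline F(x)-\overline F(y)|\le L_{\overline F}|x-y|\quad\text{for all }x,y\in\mathbb R^+.$$ Let $$\tilde V(t,x)=\operatorname*{ess\,sup}_{\alpha\in\mathcal A}\mathbb E\Big[\int_t^\infty \hat F(s,X_s^{t,x;\alpha})\,e^{-rs}\alpha_s(1-\alpha_s)\,ds\,\Big|\,\mathscr F_t\Big].$$ Then, for every $x\in\mathbb R^+$, $$e^{rt}\tilde V(t,x)\longrightarrow\hat V(x)\quad\text{in }L^1(\Omega)\text{ as }t\to\infty,$$ where, for almost every $\omega$, $\hat V(\omega,\cdot)$ is the unique classical solution of $$r\hat V(x)=\frac{\big|\big(\partial_x\hat V(x)+\overline F(x)\big)^+\big|^2}{4\overline F(x)},\quad x\in\mathbb R^+,\qquad \lim_{x\to\infty}\hat V(x)=0$$ (with $\overline F(x)=\overline F(\omega,x)$)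.
   Context: $\mathbb R^+=[0,\infty)$ and $r>0$ is fixed. $(\Omega,\mathscr F,(\mathscr F_t)_{t\ge0},\mathbb P)$ is a filtered probability space satisfying the usual conditions, with $(\mathscr F_t)$ generated by a Wiener process $W$ (augmented), and $\mathscr F_\infty=\bigvee_{t\ge0}\mathscr F_t\subseteq\mathscr F$. $\overline X$ is an $\mathscr F$-measurable nonnegative random variable with atomless law and unbounded support. $\hat F(t,x):=\mathbb P(\overline X>x\mid\mathscr F_t)$, understood as an adapted random field. $\mathcal A$ is the set of $(\mathscr F_t)$-progressively measurable $[0,1]$-valued processes, and $X_s^{t,x;\alpha}=x+\int_t^s\alpha_u\,du$ for $s\ge t$. A classical solution of the stationary equation is a $C^1$ function on $\mathbb R^+$ satisfying it pointwise together with the limit condition. *)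

(* Defs.v *)
From HB Require Import structures.
From mathcomp Require Import all_boot all_order all_algebra.
From mathcomp Require Import all_classical all_reals all_analysis.
From mathcomp Require Import measurable_realfun ess_sup_inf.

Set Implicit Arguments.
Unset Strict Implicit.
Unset Printing Implicit Defensive.

Import Order.TTheory GRing.Theory Num.Theory.
Import numFieldNormedType.Exports.

Local Open Scope classical_set_scope.
Local Open Scope ring_scope.

(* Time and space both live in R+ = [0, +oo[ but are typed in R: only the
   values at nonnegative arguments are ever constrained or used. A
   sub-sigma-algebra is a set of events G; since <<s G>> = G when G is a
   sigma-algebra, measurability with respect to G is measurability from
   g_sigma_algebraType G. *)

Section filtered_probability_space.
Context (d : measure_display) (T : measurableType d) (R : realType).
Variable P : probability T R.
Implicit Types (Fil : R -> set (set T)) (G : set (set T)).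

Definition filtration Fil : Prop :=
  [/\ forall t : R, 0 <= t -> sigma_algebra setT (Fil t),
      forall t : R, 0 <= t -> Fil t `<=` d.-measurable &
      forall s t : R, 0 <= s -> s <= t -> Fil s `<=` Fil t].

Definition usual_conditions Fil : Prop :=
  [/\ measure_is_complete P,
      [set N | P.-negligible N] `<=` Fil 0 &
      forall t : R, 0 <= t -> Fil t = \bigcap_(s in `]t, +oo[) Fil s].

Definition natural_filtration (W : R -> T -> R) (t : R) : set (set T) :=
  <<s [set A | exists (s : R) (B : set R), [/\ 0 <= s <= t, measurable B & A = W s @^-1` B] ]>>.

Definition augmented_filtration (W : R -> T -> R) (t : R) : set (set T) :=
  <<s natural_filtration W t `|` [set N | P.-negligible N] >>.

Definition filtration_infty Fil : set (set T) :=
  <<s \bigcup_(t in `[0, +oo[) Fil t >>.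

Definition wiener_process (W : R -> T -> R) : Prop :=
  [/\ forall t : R, 0 <= t -> measurable_fun setT (W t),
      \forall w \ae P, W 0 w = 0,
      \forall w \ae P, {within `[0, +oo[, continuous (fun t => W t w)},
      forall (s t : R) (B : set R), 0 <= s -> s < t -> measurable B ->
        P ((W t \- W s) @^-1` B) = normal_prob 0 (Num.sqrt (t - s)) B &
      forall (s t : R) (A : set T) (B : set R), 0 <= s -> s < t ->
        natural_filtration W s A -> measurable B ->
        P (A `&` (W t \- W s) @^-1` B) =
          (P A * P ((W t \- W s)%R @^-1` B))%E].

Definition progressively_measurable Fil (a : R -> T -> R) : Prop :=
  forall t : R, 0 <= t ->
    measurable_fun (`[0, t] `*` setT : set (R * g_sigma_algebraType (Fil t)))
      (fun p => a p.1 p.2).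

(* Y is a version of E[X | G] *)
Definition cond_expectation G (X Y : T -> R) : Prop :=
  [/\ P.-integrable setT (EFin \o X),
      P.-integrable setT (EFin \o Y),
      measurable_fun setT (Y : g_sigma_algebraType G -> R) &
      forall A, G A ->
        (\int[P]_(w in A) (Y w)%:E = \int[P]_(w in A) (X w)%:E)%E].

(* V is (a version of) the essential supremum of a family S of random
   variables: the least almost sure upper bound of S *)
Definition is_esssup (S : set (T -> R)) (V : T -> R) : Prop :=
  [/\ measurable_fun setT V,
      forall Y, S Y -> \forall w \ae P, Y w <= V w &
      forall Z : T -> \bar R, measurable_fun setT Z ->
        (forall Y, S Y -> \forall w \ae P, ((Y w)%:E <= Z w)%E) ->
        \forall w \ae P, ((V w)%:E <= Z w)%E].

Definition cvg_L1 (f : R -> T -> R) (g : T -> R) : Prop :=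
  [/\ forall t : R, 0 <= t -> P.-integrable setT (EFin \o f t),
      P.-integrable setT (EFin \o g) &
      (\int[P]_w `|f t w - g w|%:E)%E @[t --> +oo] --> 0%E].

End filtered_probability_space.

Definition support_law (R : realType) (mu : set R -> \bar R) : set R :=
  [set x | forall U : set R, open U -> U x -> (0 < mu U)%E].

Section control_problem.
Context (d : measure_display) (T : measurableType d) (R : realType).
Variable P : probability T R.
Implicit Types (Fil : R -> set (set T)) (Fhat : R -> R -> T -> R).

(* Fhat is a version of the random field (t, x) |-> P(X > x | Fil t).
   Conditional probabilities are only defined up to a null set for each
   (t, x), whereas Fhat is evaluated below along random paths and under a
   supremum over x. Hence the version is taken progressively measurable in
   (t, w), and [0,1]-valued and right-continuous in x, as the survival function
   of a regular conditional law of X is. *)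
Definition cond_survival_field Fil (X : T -> R) Fhat : Prop :=
  [/\ forall t x : R, 0 <= t -> 0 <= x ->
        cond_expectation P (Fil t) (\1_[set w | x < X w]) (Fhat t x),
      forall x : R, 0 <= x -> progressively_measurable Fil (fun t => Fhat t x),
      forall (t x : R) w, 0 <= t -> 0 <= x -> 0 <= Fhat t x w <= 1 &
      forall (t x : R) w, 0 <= t -> 0 <= x ->
        Fhat t y w @[y --> x^'+] --> Fhat t x w].

Definition admissible Fil : set (R -> T -> R) :=
  [set a | progressively_measurable Fil a /\
           forall (t : R) w, 0 <= t -> 0 <= a t w <= 1].

Definition controlled_state (a : R -> T -> R) (t x s : R) (w : T) : R :=
  x + \int[lebesgue_measure]_(u in `[t, s]) a u w.

Definition reward (r : R) Fhat (a : R -> T -> R) (t x : R) (w : T) : R :=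
  \int[lebesgue_measure]_(s in `[t, +oo[)
    (Fhat s (controlled_state a t x s w) w * expR (- (r * s)) *
     (a s w * (1 - a s w))).

Definition value (r : R) Fil Fhat (t x : R) (V : T -> R) : Prop :=
  is_esssup P
    [set Y | exists2 a, admissible Fil a &
                        cond_expectation P (Fil t) (reward r Fhat a t x) Y] V.

End control_problem.

Section stationary_equation.
Context (R : realType).
Implicit Types f g F V : R -> R.

(* g is the derivative of f on [0, +oo[, one-sided at 0 *)
Definition derivative_on_Rplus f g : Prop :=
  forall x : R, 0 <= x ->
    (f y - f x) / (y - x) @[y --> within `[0, +oo[ x^'] --> g x.

Definition classical_solution (r : R) F V : Prop :=
  exists dV : R -> R,
    [/\ derivative_on_Rplus V dV,
        {within `[0, +oo[, continuous dV},
        forall x : R, 0 <= x ->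
          r * V x = (Num.max (dV x + F x) 0) ^+ 2 / (4 * F x) &
        V x @[x --> +oo] --> 0].

Definition unique_classical_solution (r : R) F V : Prop :=
  classical_solution r F V /\
  forall U, classical_solution r F U -> forall x : R, 0 <= x -> U x = V x.

End stationary_equation.

(* Main.v *)
(** Let F be positive, nonincreasing, Lipschitz and vanishing at infinity, and let
    U x be the supremum of the payoffs of stepwise constant controls with rational
    rates and durations. The two dynamic programming inequalities over one short
    step show that the right Dini slopes of U are 2 sqrt (r F U) - F; this is
    continuous, so U is C^1, and it solves the stationary equation. Any solution V
    satisfies V' = 2 sqrt (r F V) - F where V > 0, with a right-hand side
    increasing in V, so that a positive difference of two solutions can only grow,
    against the condition at infinity. Along any measurable control the Hamiltonian
    inequality makes e^{-rs} U (X_s) plus the payoff up to time s nonincreasing, so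
    no control does better than U.

    At time t compare the value with U[Fhat t] x. For a deterministic control the
    tower property gives the conditional expectation of the reward exactly, by
    freezing the field at t; countably many such controls give
    U[Fhat t] x <= e^{rt} Vtilde t x. Conversely, with
    D s = sup_x |Fhat s x - Fbar x|, the discounted reward of any control is
    pathwise at most U[Fbar] x plus the discounted integral of D over [t, oo[, and
    |U[Fhat t] x - U[Fbar] x| <= D t / (4 r). Hence the distance in L^1 from
    e^{rt} Vtilde t x to U[Fbar] x is at most (2 / r) sup_{s >= t} E[D s]. *)

Require Import Defs.
From HB Require Import structures.
From mathcomp Require Import all_boot all_order all_algebra.
From mathcomp Require Import all_classical all_reals all_analysis.
From mathcomp Require Import measurable_realfun ess_sup_inf.
From mathcomp Require Import ring lra.

Set Implicit Arguments.
Unset Strict Implicit.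
Unset Printing Implicit Defensive.

Import Order.TTheory GRing.Theory Num.Theory.
Import numFieldNormedType.Exports.

Local Open Scope classical_set_scope.
Local Open Scope ring_scope.

(** * The deterministic problem *)

(** The equation solved for the derivative, V' = 2 sqrt (r F V) - F, has a square root that is not
    Lipschitz at 0, and its only boundary condition sits at infinity, so no standard initial value
    problem is at hand; the solution is built as the value of a control problem instead. Rational
    rates and durations make the controls a countable type: the value is then measurable in a random
    field, and almost sure bounds hold for all these controls off one null set. Evaluating F at the
    end of each step keeps integrals out of the recursion. The factor 1/4 is the maximum of a (1 -
    a), and 1 / (4 r) its discounted total.

    The two bounds on the random value are not symmetric. A deterministic control sees the later
    field only through its conditional means, so freezing the field at t costs it nothing. An
    adapted control can exploit the evolution of Fhat after t, so from above the field is compared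
    with Fbar, which does not move in time; for a fixed outcome the control is then a mere
    measurable function of time, to which verification applies. *)

Section stepwise_control.
Context (R : realType).
Variable r : R.
Hypothesis r_gt0 : 0 < r.
Implicit Types (F G : R -> R) (l : seq (rat * rat)).

Definition control_list l := all (fun c => (0 <= c.1 <= 1) && (0 <= c.2)) l.

(* Payoff from state x of the control that uses rate c.1 during c.2 for the
   successive c in l, each running payoff being replaced by its infimum over the
   step (F is nonincreasing in the application). *)
Fixpoint lower_payoff F (x : R) l : R :=
  if l is c :: l' then
    let a := ratr c.1 in let h := ratr c.2 in
    expR (- (r * h)) *
    (h * F (x + a * h) * (a * (1 - a)) + lower_payoff F (x + a * h) l')
  else 0.

Definition stationary_value F (x : R) : R :=
  sup [set lower_payoff F x l | l in control_list].

Lemma control_list_cons c l : control_list (c :: l) ->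
  [/\ 0 <= ratr c.1 :> R, ratr c.1 <= 1 :> R, 0 <= ratr c.2 :> R
    & control_list l].
Proof.
move=> /= /andP[/andP[/andP[a0 a1] h0] vl]; split=> //.
- by rewrite ler0q.
- by rewrite -(rmorph1 (@ratr R)) ler_rat.
- by rewrite ler0q.
Qed.

(** This closes the inductions over steps: if a step earns at most [r * h * C] and leaves at most
    [C], the discounted total is again at most [C]. *)
Lemma expRN_1D (x : R) : expR (- x) * (1 + x) <= 1.
Proof.
rewrite expRN mulrC ler_pdivrMr ?expR_gt0// mul1r; exact: expR_ge1Dx.
Qed.

Lemma expRN_le1 (x : R) : 0 <= x -> expR (- x) <= 1.
Proof. by move=> x0; rewrite -expR0 ler_expR oppr_le0. Qed.

Lemma onem_bound (a : R) : 0 <= a -> a <= 1 -> 0 <= a * (1 - a) <= 4^-1.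
Proof. move=> a0 a1; apply/andP; split; first by rewrite mulr_ge0// subr_ge0.
by have := sqr_ge0 (a - 2^-1); nra. Qed.

(** The constant is preserved by a step: the running payoffs differ by at most [h * e / 4], that is
    [r * h * (e / (4 * r))]. Two starting points are allowed so that the Lipschitz bound in x and
    the stability in F are both instances. *)
Lemma lower_payoff_stable F G (x y e : R) l :
  (forall z : R, 0 <= z -> `|F (x + z) - G (y + z)| <= e) -> control_list l ->
  `|lower_payoff F x l - lower_payoff G y l| <= e / (4 * r).
Proof.
move=> FG; have e0 : 0 <= e by exact: le_trans (FG 0 (lexx _)).
elim: l x y FG => [|c l IH] x y FG /=.
  by rewrite subrr normr0 divr_ge0// mulr_ge0// ltW.
move=> /control_list_cons[a0 a1 h0 vl].
set a := ratr c.1 in a0 a1 *; set h := ratr c.2 in h0 *.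
have ah0 : 0 <= a * h by exact: mulr_ge0.
have /andP[b0 b1] := onem_bound a0 a1.
have {}IH : `|lower_payoff F (x + a * h) l - lower_payoff G (y + a * h) l|
            <= e / (4 * r).
  apply: IH => // z z0; rewrite -!addrA; apply: FG; exact: addr_ge0.
have {FG}/= FG := FG _ ah0.
rewrite -mulrBr normrM (gtr0_norm (expR_gt0 _)).
set p := lower_payoff F _ l in IH *; set q := lower_payoff G _ l in IH *.
set f := F _ in FG *; set g := G _ in FG *.
have -> : h * f * (a * (1 - a)) + p - (h * g * (a * (1 - a)) + q)
   = h * (f - g) * (a * (1 - a)) + (p - q) by ring.
apply: (@le_trans _ _ (expR (- (r * h)) * ((1 + r * h) * (e / (4 * r))))); last first.
  rewrite mulrA ler_piMl//; last exact: expRN_1D.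
  by rewrite divr_ge0// mulr_ge0// ltW.
rewrite ler_pM2l ?expR_gt0//.
apply: (le_trans (ler_normD _ _)).
have -> : (1 + r * h) * (e / (4 * r)) = h * e * 4^-1 + e / (4 * r).
  by field; rewrite gt_eqF.
apply: lerD => //.
rewrite normrM (normrM h) (ger0_norm h0) (ger0_norm b0).
by apply: ler_pM => //; [exact: mulr_ge0|exact: ler_wpM2l].
Qed.

Lemma lower_payoff0 (x : R) l : lower_payoff (fun=> 0) x l = 0.
Proof. by elim: l x => //= c l IH x; rewrite IH mulr0 mul0r addr0 mulr0. Qed.

(** This is stability against the zero field, all of whose payoffs vanish. *)
Lemma lower_payoff_le F (x m : R) l : (forall z : R, 0 <= z -> 0 <= F (x + z) <= m) ->
  control_list l -> lower_payoff F x l <= m / (4 * r).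
Proof.
move=> Fm vl; have := @lower_payoff_stable F (fun=> 0) x x m l _ vl.
rewrite lower_payoff0 subr0 => /(_ _)/(le_trans (ler_norm _)); apply.
by move=> z /Fm /andP[F0 ?]; rewrite subr0 ger0_norm.
Qed.

Section sup.
Variable F : R -> R.
Hypothesis F01 : forall y : R, 0 <= y -> 0 <= F y <= 1.

Lemma has_sup_lower_payoff (x : R) : 0 <= x ->
  has_sup [set lower_payoff F x l | l in control_list].
Proof.
move=> x0; split; first by exists 0, [::].
exists (1 / (4 * r)) => _ [l vl <-]; apply: lower_payoff_le => // z z0.
by apply: F01; exact: addr_ge0.
Qed.

Lemma lower_payoff_le_value (x : R) l : 0 <= x -> control_list l ->
  lower_payoff F x l <= stationary_value F x.
Proof.
move=> x0 vl; apply: sup_ubound; last by exists l.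
by have [] := has_sup_lower_payoff x0.
Qed.

Lemma stationary_value_ge0 (x : R) : 0 <= x -> 0 <= stationary_value F x.
Proof. by move=> x0; exact: (@lower_payoff_le_value x [::]). Qed.

End sup.

Lemma stationary_value_le F (x c : R) :
  (forall l, control_list l -> lower_payoff F x l <= c) ->
  stationary_value F x <= c.
Proof.
move=> H; apply: ge_sup; first by exists 0, [::].
by move=> _ [l vl <-]; exact: H.
Qed.

Lemma stationary_value_le_stable F G (x y e : R) :
  (forall y : R, 0 <= y -> 0 <= G y <= 1) -> 0 <= y ->
  (forall z : R, 0 <= z -> `|F (x + z) - G (y + z)| <= e) ->
  stationary_value F x <= stationary_value G y + e / (4 * r).
Proof.
move=> G01 y0 FG; apply: stationary_value_le => l vl.
have := lower_payoff_stable FG vl; rewrite ler_norml => /andP[_].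
rewrite lerBlDl => /le_trans; apply; rewrite lerD2r.
exact: lower_payoff_le_value.
Qed.

Lemma stationary_value_stable F G (x y e : R) :
  (forall y : R, 0 <= y -> 0 <= F y <= 1) -> (forall y : R, 0 <= y -> 0 <= G y <= 1) ->
  0 <= x -> 0 <= y ->
  (forall z : R, 0 <= z -> `|F (x + z) - G (y + z)| <= e) ->
  `|stationary_value F x - stationary_value G y| <= e / (4 * r).
Proof.
move=> F01 G01 x0 y0 FG; rewrite ler_norml; apply/andP; split.
  rewrite lerBrDl lerBlDr; apply: stationary_value_le_stable => // z z0.
  by rewrite distrC FG.
by rewrite lerBlDl; apply: stationary_value_le_stable.
Qed.

End stepwise_control.

(* A Dini argument: only left upper semicontinuity is used, and the points y may
   be chosen anywhere to the right of x. *)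
Lemma ge0_propagation (R : realType) (a b : R) (g : R -> R) :
  a <= b -> 0 <= g a ->
  (forall x, a < x <= b -> g x < 0 ->
     exists2 d, 0 < d & forall y, a <= y -> x - d < y < x -> g y < 0) ->
  (forall x, a <= x < b -> 0 <= g x -> exists y, x < y <= b /\ 0 <= g y) ->
  0 <= g b.
Proof.
move=> ab ga left_cont step.
pose S := [set x | a <= x <= b /\ 0 <= g x].
have Sa : S a by split=> //; rewrite lexx.
have hS : has_sup S.
  by split; [exists a|exists b => x [/andP[]]].
have [_ uS] := hS.
have aS : a <= sup S by exact: (sup_ubound uS).
have Sb : sup S <= b by apply: ge_sup; [exists a|move=> x [/andP[]]].
have gS : 0 <= g (sup S).
  rewrite leNgt; apply/negP => gS0.
  have aS' : a < sup S.
    by rewrite lt_neqAle aS andbT; apply/eqP => E; rewrite -E ltNge ga in gS0.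
  have [d d0 dP] : exists2 d, 0 < d &
      forall y, a <= y -> sup S - d < y < sup S -> g y < 0.
    by apply: left_cont => //; rewrite aS' Sb.
  have [y [/andP[ay yb] gy] Sy] := sup_adherent d0 hS.
  have : y <= sup S by apply: (sup_ubound uS); split=> //; rewrite ay.
  rewrite le_eqVlt => /predU1P[E|yS]; first by rewrite -E ltNge gy in gS0.
  by have := dP _ ay; rewrite Sy yS => /(_ isT); rewrite ltNge gy.
move: Sb; rewrite le_eqVlt => /predU1P[<-//|Sb].
have [y [/andP[Sy yb] gy]] := step (sup S) (introT andP (conj aS Sb)) gS.
have : y <= sup S.
  by apply: (sup_ubound uS); split=> //; rewrite yb andbT (le_trans aS)// ltW.
by rewrite leNgt Sy.
Qed.

(** * Dynamic programming over one short step *)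

Section one_step_bounds.
Context (R : realType).
Variable r : R.
Hypothesis r_gt0 : 0 < r.
Variables (F : R -> R) (L : R).
Hypothesis F_gt0 : forall x : R, 0 <= x -> 0 < F x.
Hypothesis F_le1 : forall x : R, 0 <= x -> F x <= 1.
Hypothesis F_nincr : forall x y : R, 0 <= x -> x <= y -> F y <= F x.
Hypothesis L_ge0 : 0 <= L.
Hypothesis F_lip : forall x y : R, 0 <= x -> 0 <= y -> `|F x - F y| <= L * `|x - y|.

Local Notation U := (stationary_value r F).
Local Notation K := (lower_payoff r F).

Let F01 (y : R) : 0 <= y -> 0 <= F y <= 1.
Proof. by move=> y0; rewrite (ltW (F_gt0 y0)) F_le1. Qed.

(** Sharper than a uniform bound: it keeps the maximizer sqrt (r U / F) below 1/2, inside the range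
    of the controls, and makes U vanish at infinity along with F. *)
Lemma stationary_value_le_quarter (x : R) : 0 <= x -> U x <= F x / (4 * r).
Proof.
move=> x0; apply: stationary_value_le => l vl; apply: lower_payoff_le => //.
by move=> z z0; rewrite (ltW (F_gt0 _)) ?addr_ge0//= F_nincr// lerDl.
Qed.

Lemma stationary_value_gt0 (x : R) : 0 <= x -> 0 < U x.
Proof.
move=> x0; pose l : seq (rat * rat) := [:: (2^-1, 1)%R].
have vl : control_list l by [].
apply: lt_le_trans (lower_payoff_le_value r_gt0 F01 x0 vl).
rewrite /= addr0 rmorph1 fmorphV mul1r mulr1 /= ratr_nat.
apply: mulr_gt0; first exact: expR_gt0.
apply: mulr_gt0; first by rewrite F_gt0// addr_ge0.
by lra.
Qed.

Lemma stationary_value_lip (x y : R) : 0 <= x -> 0 <= y ->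
  `|U x - U y| <= L / (4 * r) * `|x - y|.
Proof.
move=> x0 y0; rewrite mulrAC; apply: stationary_value_stable => // z z0.
rewrite (le_trans (F_lip _ _)) ?addr_ge0//.
by rewrite opprD addrACA subrr addr0.
Qed.

(** The easy half of dynamic programming: a step prepended to any control is again a control. *)
Lemma stationary_value_step c (x : R) : 0 <= x -> control_list [:: c] ->
  expR (- (r * ratr c.2)) *
    (ratr c.2 * F (x + ratr c.1 * ratr c.2) * (ratr c.1 * (1 - ratr c.1))
     + U (x + ratr c.1 * ratr c.2)) <= U x.
Proof.
move=> x0 vc; have [a0 a1 h0 _] := control_list_cons R vc.
set a := ratr c.1 in a0 a1 *; set h := ratr c.2 in h0 *.
rewrite -ler_pdivlMl ?expR_gt0// -lerBrDl; apply: stationary_value_le => l vl.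
rewrite lerBrDl ler_pdivlMl ?expR_gt0//.
apply: (@lower_payoff_le_value _ _ r_gt0 _ F01 x (c :: l) x0).
by move: vc; rewrite /= andbT => ->.
Qed.

(** The stationary equation solved for the derivative, on the branch where the positive part is
    active. *)
Definition stationary_slope (x : R) := 2 * Num.sqrt (r * F x * U x) - F x.

(* The maximizer s = sqrt (r U x / F x) of the Hamiltonian. *)
Lemma hamiltonian_maximizer (x : R) : 0 <= x -> exists s : R,
  [/\ 0 < s <= 2^-1, r * U x = F x * s ^+ 2 &
      stationary_slope x = 2 * F x * s - F x].
Proof.
move=> x0; have Fx := F_gt0 x0; have Ux := stationary_value_gt0 x0.
exists (Num.sqrt (r * U x / F x)).
have q0 : 0 < r * U x / F x by rewrite divr_gt0// mulr_gt0.
have sq := sqr_sqrtr (ltW q0).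
split.
- rewrite sqrtr_gt0 q0/= -(ler_pXn2r (n := 2))// ?nnegrE ?sqrtr_ge0//.
  rewrite sq ler_pdivrMr//.
  have := stationary_value_le_quarter x0; rewrite ler_pdivlMr ?mulr_gt0//.
  by move=> H; rewrite exprVn -natrX; move: H; lra.
- by rewrite sq; field; rewrite gt_eqF.
- rewrite /stationary_slope -[2 * F x * _]mulrA; congr (_ - _); congr (2 * _).
  have -> : r * F x * U x = F x ^+ 2 * (r * U x / F x).
    by field; rewrite gt_eqF.
  by rewrite sqrtrM ?sqr_ge0// sqrtr_sqr gtr0_norm.
Qed.

Lemma expR_le_quad (z : R) : 0 <= z <= 2^-1 -> expR z <= 1 + z + 2 * z ^+ 2.
Proof.
move=> /andP[z0 z1]; have H := expR_ge1Dx (- z).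
have zp : 0 < 1 - z by lra.
rewrite -[expR z]invrK -expRN; apply: (@le_trans _ _ (1 - z)^-1).
  by rewrite lef_pV2 ?posrE ?expR_gt0.
by rewrite -[leLHS]mul1r ler_pdivrMr//; nra.
Qed.

(** A slope p above [stationary_slope] makes p a + F a (1 - a) exceed r U at the maximizer, hence at
    a nearby rational rate a. For a short step h at that rate, dynamic programming leaves at most U
    x + p a h for the next state. *)
Lemma stationary_value_step_le (x p eta : R) : 0 <= x -> stationary_slope x < p ->
  0 < eta -> exists y, x < y < x + eta /\ U y <= U x + p * (y - x).
Proof.
move=> x0 xp eta0; have Fx := F_gt0 x0; have Ux := stationary_value_gt0 x0.
have [s [/andP[s0 s1] sU sE]] := hamiltonian_maximizer x0.
pose phi (a : R) := p * a - r * U x + F x * (a * (1 - a)).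
have phis : 0 < phi s.
  rewrite /phi sU; have -> : p * s - F x * s ^+ 2 + F x * (s * (1 - s))
    = s * (p - (2 * F x * s - F x)) by ring.
  by rewrite -sE mulr_gt0// subr_gt0.
have [a [a0 a1 pa]] : exists a : rat, [/\ 0 < ratr a :> R, ratr a < 1 :> R
    & 0 < phi (ratr a)].
  pose C := `|p| + 2 * F x.
  have C0 : 0 < C by rewrite ltr_wpDl// mulr_gt0.
  (* Moving the rate from s up to b lowers [phi] by at most [(b - s) * C]; since s is at most 1/2,
     the bound 1/2 keeps b below 1. *)
  pose e := Num.min 2^-1 (phi s / C).
  have e0 : 0 < e by rewrite lt_min divr_gt0// invr_gt0 ltr0n.
  have [a] : exists a, ratr a \in `]s, (s + e)[ by apply: rat_in_itvoo; rewrite ltrDl.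
  rewrite in_itv/= => /andP[sa ae]; exists a.
  have e1 : e <= 2^-1 by rewrite /e ge_min lexx.
  have e2 : e * C <= phi s by rewrite -ler_pdivlMr// /e ge_min lexx orbT.
  set b : R := ratr a in sa ae *.
  have b1 : b < 1 by lra.
  split=> //; first exact: lt_trans sa.
  have pp : - `|p| <= p by rewrite lerNl; have := ler_norm (- p); rewrite normrN.
  have : (b - s) * C < e * C by rewrite ltr_pM2r//; lra.
  have -> : phi b = phi s + (b - s) * (p + F x - F x * (b + s)).
    by rewrite /phi; ring.
  have : (b - s) * - C <= (b - s) * (p + F x - F x * (b + s)).
    apply: ler_wpM2l; first by rewrite subr_ge0 ltW.
    by rewrite /C; nra.
  by lra.
(* [M] dominates the second order terms: the first summand comes from the exponential, [L] from the
   variation of F over the step. *)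
pose M := 2 * r ^+ 2 * U x + L + 1.
have M0 : 0 < M by rewrite /M ltr_wpDl// addr_ge0// mulr_ge0 ?(ltW Ux)// mulr_ge0// sqr_ge0.
pose e := Num.min eta (Num.min (2 * r)^-1 (phi (ratr a) / M)).
have e0 : 0 < e by rewrite !lt_min eta0 divr_gt0// invr_gt0 mulr_gt0.
have [h] : exists h, ratr h \in `](0 : R), e[ by exact: rat_in_itvoo.
rewrite in_itv/= => /andP[h0]; rewrite !lt_min => /and3P[h1 h2 h3].
exists (x + ratr a * ratr h).
set b : R := ratr a in a0 a1 pa h3 *; set k : R := ratr h in h0 h1 h2 h3 *.
have bk : 0 < b * k by rewrite mulr_gt0.
have bkk : b * k < k by rewrite gtr_pMl.
split; first by apply/andP; split; [rewrite ltrDl|rewrite ltrD2l (lt_trans bkk)].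
have vc : control_list [:: (a, h)].
  by rewrite /= -!(ler_rat R) raddf0 rmorph1 !ltW.
have := stationary_value_step x0 vc; rewrite /= -/b -/k.
rewrite expRN mulrC ler_pdivrMr ?expR_gt0// => H.
have rk : 0 <= r * k <= 2^-1.
  have : k * (2 * r) < 1 by rewrite -ltr_pdivlMr ?mulr_gt0// mul1r.
  have : 0 <= r * k by rewrite mulr_ge0 ?ltW.
  lra.
have {rk} E := expR_le_quad rk.
have FL : F x - L * k <= F (x + b * k).
  have := F_lip x0 (addr_ge0 x0 (ltW bk)).
  rewrite opprD addNKr normrN (gtr0_norm bk) ler_norml => /andP[_].
  have : L * (b * k) <= L * k by rewrite ler_wpM2l// ltW.
  by lra.
move: h3; rewrite ltr_pdivlMr// => h3.
have HU : U x * expR (r * k) <= U x * (1 + r * k + 2 * (r * k) ^+ 2).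
  by rewrite ler_pM2l.
have bb : 0 <= b * (1 - b) <= 4^-1 by exact: onem_bound (ltW a0) (ltW a1).
have HF : k * (F x - L * k) * (b * (1 - b)) <= k * F (x + b * k) * (b * (1 - b)).
  by apply: ler_wpM2r; [by case/andP: bb|rewrite ler_pM2l].
have HLk : k * (L * k) * (b * (1 - b)) <= k * (L * k).
  have k0 : 0 <= k * (L * k) by apply: mulr_ge0; [exact: ltW|apply: mulr_ge0 => //; exact: ltW].
  by apply: ler_piMr => //; case/andP: bb; lra.
have Hk : k * (k * M) <= k * phi b by rewrite ler_pM2l// ltW.
rewrite addrAC subrr add0r.
have : 0 <= k * k by rewrite mulr_ge0 ?ltW.
move: H HU HF HLk Hk; rewrite /phi /M; set X := U (x + b * k).
set Y := U x; set e1 := expR _; set Z := F (x + b * k).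
lra.
Qed.


(** After the cut the first piece is evaluated at an earlier state, where F is larger, and is
    discounted less. Upper bounds may therefore cut any control at a prescribed time. *)
Lemma lower_payoff_split (a h t : rat) (y : R) l : 0 <= y ->
  0 <= t <= h -> control_list [:: (a, h)] ->
  K y ((a, h) :: l) <= K y [:: (a, t), (a, h - t) & l].
Proof.
move=> y0 /andP[t0 th] vc; have [/= a0 a1 h0 _] := control_list_cons R vc.
have {}t0 : 0 <= ratr t :> R by rewrite ler0q.
have {}th : ratr t <= ratr h :> R by rewrite ler_rat.
rewrite /= rmorphB/= -!addrA.
set A := ratr a in a0 a1 *; set H := ratr h in h0 th *; set T := ratr t in t0 th *.
have -> : A * T + A * (H - T) = A * H by ring.
have -> : expR (- (r * H)) = expR (- (r * T)) * expR (- (r * (H - T))).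
  by rewrite -expRD; congr expR; ring.
rewrite -mulrA ler_pM2l ?expR_gt0//.
have /andP[b0 _] := onem_bound a0 a1.
have Fm : F (y + A * H) <= F (y + A * T).
  by apply: F_nincr; [rewrite addr_ge0// mulr_ge0|rewrite lerD2l ler_wpM2l].
have E1 : expR (- (r * (H - T))) <= 1.
  by apply: expRN_le1; rewrite mulr_ge0 ?subr_ge0// ltW.
set E := expR _ in E1 *; set B := A * (1 - A) in b0 *; set k := K _ l.
have : E * (T * F (y + A * H) * B) <= T * F (y + A * T) * B.
  have f0 : 0 <= F (y + A * H) by rewrite ltW// F_gt0// addr_ge0// mulr_ge0.
  apply: (@le_trans _ _ (T * F (y + A * H) * B)).
    by apply: ler_piMl => //; rewrite mulr_ge0// mulr_ge0.
  by apply: ler_wpM2r => //; apply: ler_wpM2l.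
lra.
Qed.

(** Otherwise U lies below the affine function [q] just to the right of x. As p is below the slope,
    [q] is a strict supersolution there: over a short time every control loses an amount that does
    not depend on its rates, so the supremum U x would be smaller than itself. *)
Lemma stationary_value_step_ge (x p eta : R) : 0 <= x -> p < stationary_slope x ->
  0 < eta -> exists y, x < y < x + eta /\ U x + p * (y - x) <= U y.
Proof.
move=> x0 px eta0; have Fx := F_gt0 x0; have Ux := stationary_value_gt0 x0.
have [s [/andP[s0 s1] sU sE]] := hamiltonian_maximizer x0.
apply: contrapT => nex.
have Uq y : x < y < x + eta -> U y < U x + p * (y - x).
  move=> xy; rewrite ltNge; apply/negP => H; apply: nex; exists y.
  by split.
(* The Hamiltonian at slope p misses r U by [F x * (s - a) ^+ 2 + d * a]. If a is at least s / 2 the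
   second term is bounded below, otherwise the first one is. *)
have [c c0 hc] : exists2 c, 0 < c & forall a, 0 <= a -> a <= 1 ->
    a * p + F x * (a * (1 - a)) + 2 * c <= r * U x.
  pose d := 2 * F x * s - (p + F x).
  have d0 : 0 < d by rewrite /d; move: px; rewrite sE; lra.
  pose m := Num.min (d * (s / 2)) (F x * (s / 2) ^+ 2).
  exists (2^-1 * m).
    rewrite mulr_gt0// lt_min; apply/andP; split; apply: mulr_gt0 => //.
      by rewrite divr_gt0.
    by rewrite exprn_gt0// divr_gt0.
  move=> a a0 a1; rewrite sU.
  have -> : a * p + F x * (a * (1 - a)) = F x * s ^+ 2 - F x * (s - a) ^+ 2 - d * a.
    by rewrite /d; ring.
  suff : m <= F x * (s - a) ^+ 2 + d * a by lra.
  rewrite ge_min; have [sa|sa] := leP (s / 2) a.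
    apply/orP; left; rewrite ler_wpDl ?ler_pM2l//.
    by rewrite mulr_ge0 ?sqr_ge0// ltW.
  apply/orP; right; rewrite ler_wpDr//; first by rewrite mulr_ge0// ltW.
  by rewrite ler_pM2l// ler_pXn2r ?nnegrE//; lra.
pose q y := U x + p * (y - x).
(* Within distance e of x, [r * q y] drops below [r * U x] by at most c, half of the gap 2 c. *)
pose e := Num.min (eta / 2) (c / (r * `|p| + 1)).
have rp : 0 < r * `|p| + 1 by rewrite ltr_wpDl// mulr_ge0// ltW.
have e0 : 0 < e by rewrite lt_min !divr_gt0.
have e1 : e < eta.
  by rewrite /e gt_min; apply/orP; left; rewrite ltr_pdivrMr//; lra.
have e2 : e * (r * `|p| + 1) <= c.
  by rewrite -ler_pdivlMr// /e ge_min lexx orbT.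
have rq y : x <= y -> y <= x + e -> r * U x - c <= r * q y.
  move=> xy ye; have : `|p * (y - x)| <= `|p| * e.
    rewrite normrM ler_wpM2l// ger0_norm ?subr_ge0//; lra.
  rewrite ler_norml => /andP[H _]; rewrite /q mulrDr.
  have : r * (- (`|p| * e)) <= r * (p * (y - x)) by rewrite ler_pM2l.
  lra.
have UQ y : x <= y -> y <= x + e -> U y <= q y.
  rewrite le_eqVlt => /predU1P[<- _|xy ye].
    by rewrite /q subrr mulr0 addr0.
  by apply/ltW/Uq; rewrite xy/=; lra.
(* One step of duration h under the supposed slope p loses at least c h. *)
have step y a h t X : x <= y -> 0 <= a -> a <= 1 -> 0 <= h -> 0 <= t ->
    y + a * h <= x + e -> X <= q (y + a * h) - c * t * expR (- (r * t)) ->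
    expR (- (r * h)) * (h * F (y + a * h) * (a * (1 - a)) + X)
    <= q y - c * (h + t) * expR (- (r * (h + t))).
  move=> xy a0 a1 h0 t0 yh HX.
  have ah : 0 <= a * h by rewrite mulr_ge0.
  have /andP[b0 _] := onem_bound a0 a1.
  have Fm : F (y + a * h) <= F x by apply: F_nincr => //; lra.
  have H1 : h * F (y + a * h) * (a * (1 - a)) <= h * F x * (a * (1 - a)).
    by apply: ler_wpM2r => //; apply: ler_wpM2l.
  have H2 := hc _ a0 a1.
  have ye : y <= x + e by lra.
  have H3 := rq y xy ye.
  have H4 : h * (a * p + F x * (a * (1 - a)) + c) <= h * (r * q y).
    by apply: ler_wpM2l => //; lra.
  have q0 : 0 <= q y by rewrite (le_trans _ (UQ _ xy ye))// stationary_value_ge0// (le_trans x0).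
  have H5 : q (y + a * h) = q y + p * (a * h) by rewrite /q; ring.
  have -> : expR (- (r * (h + t))) = expR (- (r * h)) * expR (- (r * t)).
    by rewrite -expRD; congr expR; ring.
  set E := expR (- (r * h)); set Et := expR (- (r * t)) in HX *.
  have E0 : 0 < E by exact: expR_gt0.
  have Et1 : Et <= 1 by apply: expRN_le1; rewrite mulr_ge0// ltW.
  have H6 : h * F (y + a * h) * (a * (1 - a)) + X
     <= (1 + r * h) * q y - c * h - c * t * Et by lra.
  apply: (@le_trans _ _ (E * ((1 + r * h) * q y - c * h - c * t * Et))).
    by rewrite ler_pM2l.
  have H7 : E * (1 + r * h) * q y <= q y by rewrite ler_piMl// expRN_1D.
  have H8 : (E * c * h) * Et <= (E * c * h).
    by apply: ler_piMr => //; rewrite mulr_ge0// ltW// mulr_gt0.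
  lra.
(* Rates are at most 1, so the state stays in the window up to time t. A step that would outlast t
   is cut there, and U <= q bounds what follows. *)
have claim l : control_list l -> forall y (t : rat), x <= y -> 0 <= t ->
    y + ratr t <= x + e ->
    K y l <= q y - c * ratr t * expR (- (r * ratr t)).
  elim: l => [|[a h] l IH] vl y t xy t0 yt.
    have {}t0 : 0 <= ratr t :> R by rewrite ler0q.
    (* A control that ends before t earns nothing more; rate 0 in [hc] gives q y >= c / r, which
       covers the loss still claimed. *)
    rewrite /= subr_ge0; have H : r * q y >= c.
      have := hc 0 (lexx _) ler01; have := rq y xy; lra.
    rewrite -(ler_pM2l r_gt0) (le_trans _ H)//.
    have := expRN_1D (r * ratr t); set E := expR _.
    have E0 : 0 < E by exact: expR_gt0.
    move=> H1; have : c * (E * (1 + r * ratr t)) <= c by rewrite ler_piMr// ltW.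
    have : 0 < c * E by rewrite mulr_gt0.
    lra.
  have [/= a0 a1 h0 vl'] := control_list_cons R vl.
  have vc : control_list [:: (a, h)] by move: vl; rewrite /= andbT => /andP[].
  have y0 : 0 <= y by exact: le_trans xy.
  have {}t0' : 0 <= ratr t :> R by rewrite ler0q.
  have [th|ht] := leP t h; last first.
    have ht' : ratr h <= ratr t :> R by rewrite ler_rat ltW.
    have ah : 0 <= ratr a * ratr h :> R by rewrite mulr_ge0.
    have ah' : ratr a * ratr h <= ratr h :> R by rewrite ler_piMl.
    have -> : ratr t = ratr h + ratr (t - h) :> R by rewrite rmorphB/= addrC subrK.
    apply: step => //; first by rewrite ler0q subr_ge0 ltW.
      by lra.
    apply: IH => //; first by lra.
      by rewrite subr_ge0 ltW.
    by rewrite rmorphB/=; lra.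
  have tht : 0 <= t <= h by rewrite t0 th.
  apply: (le_trans (lower_payoff_split l y0 tht vc)).
  have at0 : 0 <= ratr a * ratr t :> R by rewrite mulr_ge0.
  have at1 : ratr a * ratr t <= ratr t :> R by rewrite ler_piMl.
  have -> : ratr t = ratr t + 0 :> R by rewrite addr0.
  rewrite [in K _ _]/lower_payoff -/(lower_payoff r F).
  rewrite addr0.
  have := @step y (ratr a) (ratr t) 0 (K (y + ratr a * ratr t) ((a, h - t) :: l)) xy a0 a1 t0' (lexx _).
  rewrite addr0; apply; first by lra.
  rewrite mulr0 mul0r subr0.
  apply: (le_trans _ (UQ _ _ _)); [|by lra|by lra].
  apply: lower_payoff_le_value => //; first by lra.
  by move: vl; rewrite /= subr_ge0 th => /andP[/andP[->]].
have [t] : exists t, ratr t \in `](0 : R), e[ by exact: rat_in_itvoo.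
rewrite in_itv/= => /andP[t0 te].
have : U x <= q x - c * ratr t * expR (- (r * ratr t)).
  apply: stationary_value_le => l vl; apply: claim => //.
    by rewrite -(ler0q R) ltW.
  by rewrite lerD2l ltW.
rewrite /q subrr mulr0 addr0 lerBrDl gerDr leNgt => /negP; apply.
by apply: mulr_gt0; [exact: mulr_gt0|exact: expR_gt0].
Qed.

End one_step_bounds.

Lemma ge0_propagation_lip (R : realType) (a b M : R) (g : R -> R) :
  a <= b -> 0 <= g a ->
  (forall x y, a <= x -> x <= y -> y <= b -> `|g y - g x| <= M * (y - x)) ->
  (forall x, a <= x < b -> 0 <= g x -> exists y, x < y <= b /\ 0 <= g y) ->
  0 <= g b.
Proof.
move=> ab ga lipg; apply: ge0_propagation => // x /andP[ax xb] gx.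
have M1 : 0 < `|M| + 1 by rewrite ltr_wpDl.
exists (- g x / (`|M| + 1)); first by rewrite divr_gt0// oppr_gt0.
move=> y ay /andP[]; rewrite ltrBlDr -ltrBlDl ltr_pdivlMr// => yx xy.
have := lipg _ _ ay (ltW xy) xb; rewrite ler_norml => /andP[].
have : M * (x - y) <= `|M| * (x - y).
  by rewrite ler_wpM2r ?ler_norm// subr_ge0 ltW.
lra.
Qed.

Lemma cvg_within_Rplus_lip (R : realType) (f : R -> R) (M : R) :
  (forall x y : R, 0 <= x -> 0 <= y -> `|f x - f y| <= M * `|x - y|) ->
  forall x : R, 0 <= x -> f y @[y --> within `[0, +oo[ (nbhs x)] --> f x.
Proof.
move=> lipf x x0; apply/cvgrPdist_le => e e0.
have M1 : 0 < `|M| + 1 by rewrite ltr_wpDl.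
apply/nbhs_ballP; exists (e / (`|M| + 1)) => /=; first exact: divr_gt0.
move=> y /=; rewrite /ball/= in_itv/= andbT => + y0.
rewrite /ball/= ltr_pdivlMr// => xy; apply: (le_trans (lipf _ _ x0 y0)).
have : M * `|x - y| <= `|M| * `|x - y|.
  by rewrite ler_wpM2r ?ler_norm.
have := normr_ge0 (x - y).
lra.
Qed.

(** * The value of the deterministic problem as a classical solution *)

Section stationary_solution.
Context (R : realType).
Variable r : R.
Hypothesis r_gt0 : 0 < r.
Variables (F : R -> R) (L : R).
Hypothesis F_gt0 : forall x : R, 0 <= x -> 0 < F x.
Hypothesis F_le1 : forall x : R, 0 <= x -> F x <= 1.
Hypothesis F_nincr : forall x y : R, 0 <= x -> x <= y -> F y <= F x.
Hypothesis L_ge0 : 0 <= L.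
Hypothesis F_lip : forall x y : R, 0 <= x -> 0 <= y -> `|F x - F y| <= L * `|x - y|.

Local Notation U := (stationary_value r F).
Local Notation slope := (stationary_slope r F).

(** A mean value inequality obtained by propagation. The one-step bound only supplies some point
    arbitrarily close on the right, and that is all the propagation asks for. *)
Lemma stationary_value_le_slope (a b p : R) : 0 <= a -> a <= b ->
  (forall x, a <= x <= b -> slope x < p) -> U b <= U a + p * (b - a).
Proof.
move=> a0 ab Hp; rewrite -subr_ge0.
pose g x := U a + p * (x - a) - U x; rewrite -[leRHS]/(g b).
apply: (@ge0_propagation_lip _ a b (`|p| + L / (4 * r))) => //.
- by rewrite /g subrr mulr0 addr0 subrr.
- move=> x y ax xy yb.
  have -> : g y - g x = p * (y - x) + (U x - U y) by rewrite /g; ring.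
  rewrite (le_trans (ler_normD _ _))// mulrDl lerD//.
    by rewrite normrM (ger0_norm (x := y - x)) ?subr_ge0.
  rewrite distrC -[in leRHS](ger0_norm (x := y - x)) ?subr_ge0//.
  have x0 : 0 <= x by exact: le_trans ax.
  by apply: stationary_value_lip => //; exact: le_trans xy.
- move=> x /andP[ax xb] gx.
  have xp : slope x < p by apply: Hp; rewrite ax ltW.
  have x0 : 0 <= x by exact: le_trans ax.
  have bx : 0 < b - x by rewrite subr_gt0.
  have [y [/andP[xy yb] Uy]] := stationary_value_step_le r_gt0
    F_gt0 F_le1 F_nincr L_ge0 F_lip x0 xp bx.
  exists y; split; first by rewrite xy/=; lra.
  by move: gx; rewrite /g; lra.
Qed.

Lemma stationary_value_ge_slope (a b p : R) : 0 <= a -> a <= b ->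
  (forall x, a <= x <= b -> p < slope x) -> U a + p * (b - a) <= U b.
Proof.
move=> a0 ab Hp; rewrite -subr_ge0.
pose g x := U x - (U a + p * (x - a)); rewrite -[leRHS]/(g b).
apply: (@ge0_propagation_lip _ a b (L / (4 * r) + `|p|)) => //.
- by rewrite /g subrr mulr0 addr0 subrr.
- move=> x y ax xy yb.
  have -> : g y - g x = (U y - U x) - p * (y - x) by rewrite /g; ring.
  rewrite (le_trans (ler_normB _ _))// mulrDl lerD//; last first.
    by rewrite normrM (ger0_norm (x := y - x)) ?subr_ge0.
  rewrite -[in leRHS](ger0_norm (x := y - x)) ?subr_ge0//.
  have x0 : 0 <= x by exact: le_trans ax.
  by apply: stationary_value_lip => //; exact: le_trans xy.
- move=> x /andP[ax xb] gx.
  have xp : p < slope x by apply: Hp; rewrite ax ltW.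
  have x0 : 0 <= x by exact: le_trans ax.
  have bx : 0 < b - x by rewrite subr_gt0.
  have [y [/andP[xy yb] Uy]] := stationary_value_step_ge r_gt0
    F_gt0 F_le1 F_nincr x0 xp bx.
  exists y; split; first by rewrite xy/=; lra.
  by move: gx; rewrite /g; lra.
Qed.

Lemma cvg_stationary_slope (x : R) : 0 <= x ->
  slope y @[y --> within `[0, +oo[ (nbhs x)] --> slope x.
Proof.
move=> x0; rewrite /stationary_slope.
have cF := cvg_within_Rplus_lip F_lip x0.
have cU := cvg_within_Rplus_lip
  (stationary_value_lip r_gt0 F_gt0 F_le1 F_lip) x0.
apply: cvgB => //; apply: cvgM; first exact: cvg_cst.
apply: continuous_cvg; first exact: sqrt_continuous.
by apply: cvgM => //; apply: cvgM => //; exact: cvg_cst.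
Qed.

Lemma stationary_slope_near (x e : R) : 0 <= x -> 0 < e -> exists2 d, 0 < d &
  forall y, 0 <= y -> `|x - y| < d -> slope x - e < slope y < slope x + e.
Proof.
move=> x0 e0; have /cvgrPdist_lt/(_ e e0) := cvg_stationary_slope x0.
rewrite /within/= => /nbhs_ballP[d/= d0 H]; exists d => // y y0 xy.
have := H y; rewrite /ball/= in_itv/= andbT => /(_ xy y0).
by rewrite ltr_norml => /andP[]; lra.
Qed.

(** Near x the slope stays within e of its value at x, so the two affine bounds trap the difference
    quotient; for y to the left of x they are applied from y to x. *)
Lemma derivative_stationary_value : derivative_on_Rplus U slope.
Proof.
move=> x x0; apply/cvgrPdist_le => e e0.
have [d d0 Hd] := stationary_slope_near x0 e0.
apply/nbhs_ballP; exists d => //= y; rewrite /ball/= in_itv/= andbT => xy yx y0.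
set Q := (U y - U x) / (y - x).
have QE : Q * (y - x) = U y - U x by rewrite divfK// subr_eq0.
suff : slope x - e <= Q <= slope x + e by rewrite ler_norml; lra.
have [lyx|lxy|E] := ltgtP y x; last by rewrite E eqxx in yx.
- have near z : y <= z <= x -> slope x - e < slope z < slope x + e.
    move=> /andP[yz zx]; apply: Hd; first exact: le_trans yz.
    by move: xy; rewrite !ger0_norm ?subr_ge0 ?(ltW lyx)//; lra.
  have H1 := stationary_value_le_slope y0 (ltW lyx)
    (fun z zz => proj2 (andP (near z zz))).
  have H2 := stationary_value_ge_slope y0 (ltW lyx)
    (fun z zz => proj1 (andP (near z zz))).
  have xy0 : 0 < x - y by rewrite subr_gt0.
  by apply/andP; split; rewrite -(ler_pM2r xy0); lra.
- have near z : x <= z <= y -> slope x - e < slope z < slope x + e.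
    move=> /andP[xz zy]; apply: Hd; first exact: le_trans xz.
    by move: xy; rewrite !ler0_norm ?subr_le0 ?(ltW lxy)//; lra.
  have H1 := stationary_value_le_slope x0 (ltW lxy)
    (fun z zz => proj2 (andP (near z zz))).
  have H2 := stationary_value_ge_slope x0 (ltW lxy)
    (fun z zz => proj1 (andP (near z zz))).
  have xy0 : 0 < y - x by rewrite subr_gt0.
  by apply/andP; split; rewrite -(ler_pM2r xy0); lra.
Qed.

Lemma stationary_value_classical : F x @[x --> +oo] --> 0 ->
  classical_solution r F U.
Proof.
move=> F0; exists slope; split.
- exact: derivative_stationary_value.
- apply/subspace_continuousP => x; rewrite /= in_itv/= andbT.
  exact: cvg_stationary_slope.
- move=> x x0; have Fx := F_gt0 x0.
  have Ux := stationary_value_gt0 r_gt0 F_gt0 F_le1 x0.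
  rewrite /stationary_slope subrK max_l ?mulr_ge0 ?sqrtr_ge0//.
  rewrite exprMn sqr_sqrtr ?mulr_ge0 ?ltW//.
  by field; rewrite gt_eqF.
- apply: (@squeeze_cvgr _ _ _ _ (fun=> 0) (fun x => F x / (4 * r))).
  + near=> x; have x0 : 0 <= x by near: x; exact: nbhs_pinfty_ge.
    by rewrite ltW ?stationary_value_gt0//= stationary_value_le_quarter.
  + exact: cvg_cst.
  + by rewrite -[X in _ --> X](mul0r (4 * r)^-1); apply: cvgM => //; exact: cvg_cst.
Unshelve. all: by end_near. Qed.

End stationary_solution.

(** * Comparison of classical solutions *)

Section uniqueness.
Context (R : realType).
Implicit Types f g : R -> R.

Lemma derivative_on_Rplus_near f g (x e : R) : derivative_on_Rplus f g ->
  0 <= x -> 0 < e -> exists2 d, 0 < d & forall y, 0 <= y -> `|x - y| < d ->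
    `|f y - f x - g x * (y - x)| <= e * `|y - x|.
Proof.
move=> fg x0 e0; have /cvgrPdist_le/(_ e e0)/nbhs_ballP[d/= d0 H] := fg x x0.
exists d => // y y0 xy; have [->|yx] := eqVneq y x.
  by rewrite !subrr mulr0 subrr normr0 mulr0.
have := H y; rewrite /ball/= in_itv/= andbT => /(_ xy yx y0).
have yx0 : 0 < `|y - x| by rewrite normr_gt0 subr_eq0.
rewrite -(ler_pM2r yx0) -normrM mulrBl divfK ?subr_eq0//.
by rewrite distrC.
Qed.

Lemma derivative_on_RplusB f1 g1 f2 g2 : derivative_on_Rplus f1 g1 ->
  derivative_on_Rplus f2 g2 ->
  derivative_on_Rplus (fun x => f1 x - f2 x) (fun x => g1 x - g2 x).
Proof.
move=> D1 D2 x x0.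
rewrite (_ : (fun y => _) = (fun y => (f1 y - f1 x) / (y - x)) \-
                            (fun y => (f2 y - f2 x) / (y - x))); last first.
  by apply/funext => y /=; rewrite -mulrBl; congr (_ / _); ring.
by apply: cvgB; [exact: D1|exact: D2].
Qed.

Lemma classical_solution_le (r : R) F V1 V2 : 0 < r ->
  (forall x : R, 0 <= x -> 0 < F x) ->
  classical_solution r F V1 -> classical_solution r F V2 ->
  forall x : R, 0 <= x -> V1 x <= V2 x.
Proof.
move=> r0 F0 [d1 [D1 _ E1 l1]] [d2 [D2 _ E2 l2]] x x0.
rewrite leNgt; apply/negP => V21.
have V2ge0 y : 0 <= y -> 0 <= V2 y.
  move=> y0; rewrite -(pmulr_rge0 _ r0) E2// divr_ge0 ?sqr_ge0//.
  by rewrite mulr_ge0// ltW// F0.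
(* Where V1 exceeds V2 the larger square has an active positive part, so the derivatives are ordered
   like the solutions. *)
have slopes y : 0 <= y -> V2 y < V1 y -> d2 y < d1 y.
  move=> y0; rewrite -(ltr_pM2l r0) E1// E2// ltr_pM2r; last first.
    by rewrite invr_gt0 mulr_gt0 ?F0.
  rewrite ltr_pXn2r// ?nnegrE ?le_max ?lexx ?orbT//.
  by rewrite lt_max !gt_max ltxx andbF orbF => /andP[]; lra.
pose D y := V1 y - V2 y.
have DD := derivative_on_RplusB D1 D2.
have Dmono b : x <= b -> D x <= D b.
  move=> xb; rewrite -subr_ge0; apply: (@ge0_propagation _ x b (fun y => D y - D x)) => //.
  - by rewrite subrr.
  - move=> y /andP[xy yb] Dy.
    have y0 : 0 <= y by rewrite (le_trans x0)// ltW.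
    have [d d0 Hd] := derivative_on_Rplus_near DD y0 ltr01.
    pose c := `|d1 y - d2 y| + 1; have c0 : 0 < c by rewrite ltr_wpDl.
    exists (Num.min d ((D x - D y) / c)).
      by rewrite lt_min d0 divr_gt0//; lra.
    move=> z xz /andP[+ zy]; rewrite ltrBlDr -ltrBlDl lt_min => /andP[H1 H2].
    have yz : `|y - z| = y - z by rewrite ger0_norm// subr_ge0 ltW.
    have := Hd z (le_trans x0 xz); rewrite (distrC z y) yz => /(_ H1).
    rewrite ltr_pdivlMr// in H2.
    rewrite ler_norml => /andP[_]; rewrite -/(D z) -/(D y).
    have : (d1 y - d2 y) * (z - y) <= `|d1 y - d2 y| * (y - z).
      rewrite (le_trans (ler_norm _))// normrM (distrC z y) yz//.
    move: H2; rewrite /c; lra.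
  - move=> y /andP[xy yb]; rewrite subr_ge0 => Dxy.
    have y0 : 0 <= y by exact: le_trans xy.
    have dy : 0 < d1 y - d2 y.
      by rewrite subr_gt0 slopes// -subr_gt0 (lt_le_trans _ Dxy)// subr_gt0.
    (* The derivative of the difference serves as its own tolerance: the error is at most the linear
       gain, hence D (y + h) >= D y. *)
    have [d d0 Hd] := derivative_on_Rplus_near DD y0 dy.
    pose h := Num.min (d / 2) (b - y).
    have h0 : 0 < h by rewrite lt_min divr_gt0// subr_gt0.
    have hd : h < d by rewrite /h gt_min ltr_pdivrMr// ltr_pMr// ltr1n.
    have hb : h <= b - y by rewrite /h ge_min lexx orbT.
    exists (y + h); split; first by rewrite ltrDl h0/=; lra.
    have := Hd (y + h) (addr_ge0 y0 (ltW h0)).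
    have -> : y - (y + h) = - h by ring.
    have -> : y + h - y = h by ring.
    rewrite normrN (gtr0_norm h0) => /(_ hd).
    by rewrite ler_norml -/(D (y + h)) -/(D y) => /andP[]; lra.
have Dl : D y @[y --> +oo] --> 0.
  by rewrite -[X in _ --> X](subr0 (0 : R)); exact: cvgB.
have : D x <= 0.
  apply: (cvgr_to_ge Dl).
  by near=> b; apply: Dmono; near: b; exact: (nbhs_pinfty_ge (num_real x)).
by rewrite subr_le0 leNgt V21.
Unshelve. all: by end_near. Qed.

End uniqueness.

(** * Verification for measurable controls *)

Lemma integrableZl_EFin d (T : measurableType d) (R : realType)
    (mu : {measure set T -> \bar R}) (D : set T) (f : T -> R) (k : R) :
  measurable D -> mu.-integrable D (EFin \o f) ->
  mu.-integrable D (EFin \o (fun u => k * f u)).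
Proof.
move=> mD intf; have := integrableZl mD k intf.
by rewrite (_ : (fun x => _) = EFin \o (fun u => k * f u)).
Qed.

(** * Integrals of bounded functions over intervals *)

Section bounded_integrals.
Context (R : realType).
Local Notation mu := (@lebesgue_measure R).
Implicit Types f : R -> R.

Lemma bounded_integrable_itv f (M a b : R) : measurable_fun setT f ->
  (forall u, `|f u| <= M) -> mu.-integrable `[a, b] (EFin \o f).
Proof.
move=> mf fM; apply: measurable_bounded_integrable => //.
- rewrite /= lebesgue_measure_itv/=; case: ifP => _; rewrite ?ltry// -EFinB ltry.
- exact: measurable_funTS.
- exists M; split; first exact: num_real.
  by move=> y My x _ /=; rewrite (le_trans (fM x))// ltW.
Qed.

Lemma Rintegral_itv_split f (M a b c : R) : measurable_fun setT f ->
  (forall u, `|f u| <= M) -> a <= b -> b <= c ->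
  \int[mu]_(u in `[a, c]) f u =
  \int[mu]_(u in `[a, b]) f u + \int[mu]_(u in `[b, c]) f u.
Proof.
move=> mf fM ab bc; apply/eqP; rewrite addrC -subr_eq; apply/eqP.
rewrite Rintegral_itvB ?bnd_simp//; last exact: bounded_integrable_itv fM.
rewrite Rintegral_itv_obnd_cbnd//.
apply: integrableS (bounded_integrable_itv b c mf fM) => //.
by apply: subset_itvr; rewrite bnd_simp.
Qed.

Lemma Rintegral_itv_cst (c a b : R) : a <= b ->
  \int[mu]_(u in `[a, b]) c = c * (b - a).
Proof.
move=> ab; rewrite Rintegral_cst// /= lebesgue_measure_itv/= lte_fin.
have [//|ba] := ltP a b.
by rewrite (_ : a = b) ?subrr ?mulr0//; apply/le_anti; rewrite ab ba.
Qed.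

Lemma Rintegral_itv_le f (M C a b : R) : measurable_fun setT f ->
  (forall u, `|f u| <= M) -> a <= b -> (forall u, a <= u <= b -> f u <= C) ->
  \int[mu]_(u in `[a, b]) f u <= C * (b - a).
Proof.
move=> mf fM ab fC; rewrite -Rintegral_itv_cst//; apply: le_Rintegral => //.
- exact: bounded_integrable_itv fM.
- by apply: (@bounded_integrable_itv _ `|C|) => // u.
Qed.

Lemma Rintegral_itv_ge f (M C a b : R) : measurable_fun setT f ->
  (forall u, `|f u| <= M) -> a <= b -> (forall u, a <= u <= b -> C <= f u) ->
  C * (b - a) <= \int[mu]_(u in `[a, b]) f u.
Proof.
move=> mf fM ab fC; rewrite -Rintegral_itv_cst//; apply: le_Rintegral => //.
- by apply: (@bounded_integrable_itv _ `|C|) => // u.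
- exact: bounded_integrable_itv fM.
Qed.

(** No order between a, s and s' is assumed, integrals over empty intervals being 0; state and
    payoff are thus continuous on the whole line. *)
Lemma Rintegral_itv_lip f (M a s s' : R) : measurable_fun setT f ->
  (forall u, `|f u| <= M) ->
  `|\int[mu]_(u in `[a, s]) f u - \int[mu]_(u in `[a, s']) f u| <= M * `|s - s'|.
Proof.
move=> mf fM.
have M0 : 0 <= M by exact: le_trans (fM 0).
wlog ss' : s s' / s' <= s.
  move=> H; have [|/ltW ss'] := leP s' s; first exact: H.
  by rewrite distrC (distrC s); exact: H.
rewrite (ger0_norm (x := s - s')) ?subr_ge0//.
have [as'|s'a] := leP a s'.
  rewrite (Rintegral_itv_split mf fM as' ss') addrAC subrr add0r ler_norml.
  rewrite -mulNr; apply/andP; split.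
    by apply: (Rintegral_itv_ge mf fM) => // u _; have := fM u; rewrite ler_norml => /andP[].
  by apply: (Rintegral_itv_le mf fM) => // u _; have := fM u; rewrite ler_norml => /andP[].
have -> : \int[mu]_(u in `[a, s']) f u = 0.
  by rewrite set_itv_ge ?Rintegral_set0// -leNgt bnd_simp.
rewrite subr0; have [as_|sa] := leP a s; last first.
  rewrite set_itv_ge ?Rintegral_set0 ?normr0// ?mulr_ge0 ?subr_ge0//.
  by rewrite -leNgt bnd_simp.
apply: (@le_trans _ _ (M * (s - a))); last by rewrite ler_wpM2l//; lra.
rewrite ler_norml -mulNr; apply/andP; split.
  by apply: (Rintegral_itv_ge mf fM) => // u _; have := fM u; rewrite ler_norml => /andP[].
by apply: (Rintegral_itv_le mf fM) => // u _; have := fM u; rewrite ler_norml => /andP[].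
Qed.

Lemma lipschitz_continuous (g : R -> R) (M : R) :
  (forall x y, `|g x - g y| <= M * `|x - y|) -> continuous g.
Proof.
move=> lg x; apply/cvgrPdist_le => e e0.
have M1 : 0 < `|M| + 1 by rewrite ltr_wpDl.
apply/nbhs_ballP; exists (e / (`|M| + 1)) => /=; first exact: divr_gt0.
move=> y; rewrite /ball/= ltr_pdivlMr// => xy; apply: (le_trans (lg _ _)).
have : M * `|x - y| <= `|M| * `|x - y| by rewrite ler_wpM2r ?ler_norm.
have := normr_ge0 (x - y).
lra.
Qed.

(** Monotone convergence along integer endpoints; [g] is f cut off below t, so that the integrals
    may start at 0. *)
Lemma ge0_integral_itvy_le f (t : R) (C : \bar R) : 0 <= t ->
  measurable_fun setT f -> (forall u, 0 <= f u) ->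
  (forall b, t <= b -> (\int[mu]_(u in `[t, b]) (f u)%:E <= C)%E) ->
  (0 <= C)%E -> (\int[mu]_(u in `[t, +oo[) (f u)%:E <= C)%E.
Proof.
move=> t0 mf f0 fC C0.
pose g u := if t <= u then f u else 0.
have g0 u : 0 <= g u by rewrite /g; case: ifP.
have mg : measurable_fun setT g.
  by apply: measurable_fun_ifT => //; exact: measurable_fun_ler.
have gE (D : set R) : (\int[mu]_(u in D) (g u)%:E =
    \int[mu]_(u in D `&` `[t, +oo[) (f u)%:E)%E.
  rewrite integral_mkcondr; apply: eq_integral => u _; rewrite /g patchE.
  have -> : (u \in `[t, +oo[%classic) = (t <= u).
    by apply/idP/idP; rewrite inE/= in_itv/= andbT.
  by case: ifP.
have -> : (\int[mu]_(u in `[t, +oo[) (f u)%:E = \int[mu]_(u in `[0%R, +oo[) (g u)%:E)%E.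
  rewrite gE; congr (integral _ _ _); apply/seteqP; split=> u /=; rewrite !in_itv/= !andbT.
    by move=> tu; rewrite tu (le_trans t0).
  by case.
rewrite ge0_integral_ereal_sup//; apply: ge_ereal_sup => _ [n _ <-].
rewrite gE; have [tn|nt] := leP t n.+1%:R.
  rewrite (_ : _ `&` _ = `[t, n.+1%:R]%classic); first exact: fC.
  apply/seteqP; split=> u /=; rewrite !in_itv/= andbT.
    by move=> [/andP[_ ->] ->].
  by move=> /andP[tu ->]; rewrite tu (le_trans t0).
rewrite (_ : _ `&` _ = set0) ?integral_set0//.
apply/seteqP; split=> u //=; rewrite !in_itv/= andbT => -[/andP[_ un] tu].
by have := le_trans tu un; rewrite leNgt nt.
Qed.



End bounded_integrals.

Lemma ge0_propagation_continuous (R : realType) (a b : R) (g : R -> R) :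
  continuous g -> a <= b -> 0 <= g a ->
  (forall x, a <= x < b -> 0 <= g x -> exists y, x < y <= b /\ 0 <= g y) ->
  0 <= g b.
Proof.
move=> cg ab ga; apply: ge0_propagation => // x _ gx.
have /cvgrPdist_lt/(_ (- g x)) := cg x; rewrite oppr_gt0 => /(_ gx).
move=> /nbhs_ballP[d/= d0 H]; exists d => // y _ /andP[yd yx].
have := H y; rewrite /ball/= ger0_norm ?subr_ge0 ?(ltW yx)// => /(_ _).
rewrite ltr_norml ltrBlDr -ltrBlDl yd => /(_ isT)/andP[+ _]; lra.
Qed.

(** * The verification inequality along one measurable control *)

Section verification.
Context (R : realType).
Local Notation mu := (@lebesgue_measure R).
Variable r : R.
Hypothesis r_gt0 : 0 < r.
Variables (F : R -> R) (L : R).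
Hypothesis F_gt0 : forall x : R, 0 <= x -> 0 < F x.
Hypothesis F_le1 : forall x : R, 0 <= x -> F x <= 1.
Hypothesis F_nincr : forall x y : R, 0 <= x -> x <= y -> F y <= F x.
Hypothesis L_ge0 : 0 <= L.
Hypothesis F_lip : forall x y : R, 0 <= x -> 0 <= y -> `|F x - F y| <= L * `|x - y|.

Variables (al : R -> R) (t x : R).
Hypothesis mal : measurable_fun setT al.
Hypothesis al01 : forall u, 0 <= al u <= 1.
Hypotheses (t0 : 0 <= t) (x0 : 0 <= x).

Local Notation U := (stationary_value r F).
Let X s := x + \int[mu]_(u in `[t, s]) al u.

Let al_bnd u : `|al u| <= 1.
Proof. by have /andP[a0 a1] := al01 u; rewrite ger0_norm. Qed.

Let X_ge s : x <= X s.
Proof. by rewrite lerDl Rintegral_ge0// => u _; have /andP[] := al01 u. Qed.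

Let X_ge0 s : 0 <= X s. Proof. exact: le_trans (X_ge s). Qed.

Let X_continuous : continuous X.
Proof.
apply: (@lipschitz_continuous _ _ 1) => s s'; rewrite /X.
rewrite opprD addrACA subrr add0r; exact: Rintegral_itv_lip al_bnd.
Qed.

Let X_split s s' : t <= s -> s <= s' ->
  X s' = X s + \int[mu]_(u in `[s, s']) al u.
Proof.
by move=> ts ss'; rewrite /X (Rintegral_itv_split mal al_bnd ts ss') addrA.
Qed.

Let continuous_comp_X (f : R -> R) (M : R) :
  (forall x y : R, 0 <= x -> 0 <= y -> `|f x - f y| <= M * `|x - y|) ->
  continuous (fun s => f (X s)).
Proof.
move=> lf.
have -> : (fun s => f (X s)) = (fun y => f (Num.max y 0)) \o X.
  by apply/funext => s /=; rewrite max_l.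
move=> s; apply: continuous_comp; first exact: X_continuous.
apply: (@lipschitz_continuous _ _ `|M|) => y z.
apply: (le_trans (lf _ _ _ _)); rewrite ?le_max ?lexx ?orbT//.
apply: (@le_trans _ _ (`|M| * `|Num.max y 0 - Num.max z 0|)).
  by rewrite ler_wpM2r ?ler_norm.
apply: ler_wpM2l => //.
have yz1 : y - z <= `|y - z| by exact: ler_norm.
have yz2 : z - y <= `|y - z| by rewrite distrC; exact: ler_norm.
rewrite ler_norml; have [y0|y0] := leP y 0; have [z0|z0] := leP z 0;
  apply/andP; split; lra.
Qed.

(** Time is truncated at 0 in the exponential to keep the integrand bounded by 1 on the whole line;
    nothing changes for u >= t. *)
Let f u := F (X u) * expR (- (r * Num.max u 0)) * (al u * (1 - al u)).

Let f_ge0 u : 0 <= f u.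
Proof.
have /andP[a0 a1] := al01 u; have /andP[b0 _] := onem_bound a0 a1.
by apply: mulr_ge0 => //; rewrite mulr_ge0// ?expR_ge0// ltW// F_gt0.
Qed.

Let f_bnd u : `|f u| <= 1.
Proof.
have /andP[a0 a1] := al01 u; have /andP[b0 b1] := onem_bound a0 a1.
rewrite ger0_norm// /f -[leRHS]mulr1; apply: ler_pM => //.
- by rewrite mulr_ge0 ?expR_ge0// ltW// F_gt0.
- rewrite -[leRHS]mulr1; apply: ler_pM; rewrite ?expR_ge0 ?F_le1//.
    by rewrite ltW// F_gt0.
  by rewrite expRN_le1// mulr_ge0 ?(ltW r_gt0)// le_max lexx orbT.
- by rewrite (le_trans b1)// invf_le1// ler1n.
Qed.

Let mf : measurable_fun setT f.
Proof.
apply: measurable_funM.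
  apply: measurable_funM.
    by apply: continuous_measurable_fun; exact: continuous_comp_X F_lip.
  apply: measurableT_comp => //; apply: measurable_funN; apply: measurable_funM => //.
  exact: measurable_maxr.
by apply: measurable_funM => //; exact: measurable_funB.
Qed.

Let phi s := U (X s) * expR (- (r * s)) + \int[mu]_(u in `[t, s]) f u.

Let phi_continuous : continuous phi.
Proof.
move=> s; apply: cvgD; last first.
  by apply: (@lipschitz_continuous _ _ 1) => y z; exact: Rintegral_itv_lip f_bnd.
apply: cvgM.
  exact: continuous_comp_X (stationary_value_lip r_gt0 F_gt0 F_le1 F_lip) s.
apply: continuous_comp; last exact: continuous_expR.
by apply: cvgN; apply: cvgM; [exact: cvg_cst|exact: cvg_id].
Qed.

(** The difference of the two sides is [F y * (s - a) ^+ 2], with s the maximizer. *)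
Lemma hamiltonian_le (y a : R) : 0 <= y ->
  a * stationary_slope r F y + F y * (a * (1 - a)) <= r * U y.
Proof.
move=> y0; have [s [_ -> ->]] := hamiltonian_maximizer r_gt0 F_gt0 F_le1 F_nincr y0.
have := mulr_ge0 (ltW (F_gt0 y0)) (sqr_ge0 (s - a)).
lra.
Qed.

(* e^{-rs} U(X_s) + int_t^s f has nonpositive upper right Dini derivative. *)
Let phi_step s e : t <= s -> 0 < e -> exists2 d, 0 < d &
  forall h, 0 < h < d -> phi (s + h) <= phi s + e * h.
Proof.
move=> ts e0; set y := X s; have y0 : 0 <= y by exact: X_ge0.
set p := stationary_slope r F y; set E := expR (- (r * s)).
have E0 : 0 < E by exact: expR_gt0.
have e1 : 0 < e / (2 * E) by rewrite divr_gt0// mulr_gt0.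
have DU := derivative_stationary_value r_gt0 F_gt0 F_le1 F_nincr L_ge0 F_lip.
have [d d0 Hd] := derivative_on_Rplus_near DU y0 e1.
(* The terms in h ^ 2 have total coefficient at most M / 2, so h M < e lets them use half of e h;
   the other half is for the differentiation error of U. *)
pose M := 2 * E * (r ^+ 2 * U y + r * `|p| + 1).
have Uy : 0 < U y by exact: stationary_value_gt0.
have M0 : 0 < M.
  rewrite !mulr_gt0// ltr_wpDl// addr_ge0// mulr_ge0 ?sqr_ge0 ?(ltW Uy)//.
  exact: ltW.
exists (Num.min d (e / M)); first by rewrite lt_min d0 divr_gt0.
move=> h /andP[h0]; rewrite lt_min ltr_pdivlMr// => /andP[hd hM].
have ssh : s <= s + h by rewrite lerDl ltW.
have sh0 : s + h - s = h by ring.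
(* The control is only measurable and X need not be differentiable at s, so the Hamiltonian
   inequality is integrated over the step. *)
pose del := \int[mu]_(u in `[s, s + h]) al u.
pose J := \int[mu]_(u in `[s, s + h]) (al u * (1 - al u)).
have XE : X (s + h) = y + del by exact: X_split.
have del0 : 0 <= del by apply: Rintegral_ge0 => u _; have /andP[] := al01 u.
have del1 : del <= h.
  rewrite -[leRHS]mul1r -sh0; apply: (Rintegral_itv_le mal al_bnd) => // u _.
  by have /andP[] := al01 u.
have mJ : measurable_fun setT (fun u => al u * (1 - al u)).
  by apply: measurable_funM => //; exact: measurable_funB.
have J_bnd u : `|al u * (1 - al u)| <= 1.
  have /andP[a0 a1] := al01 u; have /andP[b0 b1] := onem_bound a0 a1.
  by rewrite ger0_norm// (le_trans b1)// invf_le1// ler1n.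
have J0 : 0 <= J.
  apply: Rintegral_ge0 => u _.
  by have /andP[a0 a1] := al01 u; have /andP[] := onem_bound a0 a1.
have int_al := bounded_integrable_itv s (s + h) mal al_bnd.
have int_J := bounded_integrable_itv s (s + h) mJ J_bnd.
have HJ : p * del + F y * J <= r * U y * h.
  rewrite -RintegralZl// -RintegralZl// -RintegralD//; last 2 first.
  - exact: integrableZl_EFin.
  - exact: integrableZl_EFin.
  have bnd u : `|p * al u + F y * (al u * (1 - al u))| <= `|p| + `|F y|.
    rewrite (le_trans (ler_normD _ _))// !normrM lerD//.
      by rewrite ler_piMr.
    by rewrite ler_piMr// -normrM.
  rewrite -[X in _ * X]sh0; apply: Rintegral_itv_le bnd _ _ => //.
    by apply: measurable_funD; exact: measurable_funM.
  by move=> u _; rewrite [p * _]mulrC; exact: hamiltonian_le.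
have Hf : \int[mu]_(u in `[s, s + h]) f u <= E * F y * J.
  rewrite /J -RintegralZl//; apply: le_Rintegral => //.
  - exact: bounded_integrable_itv f_bnd.
  - exact: integrableZl_EFin.
  move=> u /=; rewrite in_itv/= => /andP[su _]; rewrite /f.
  have /andP[a0 a1] := al01 u; have /andP[b0 _] := onem_bound a0 a1.
  apply: ler_wpM2r => //; rewrite [E * _]mulrC.
  apply: ler_pM; rewrite ?expR_ge0//.
  - by rewrite ltW// F_gt0.
  - apply: F_nincr => //; rewrite /y (X_split ts su) lerDl Rintegral_ge0// => v _.
    by have /andP[] := al01 v.
  - by rewrite ler_expR lerN2 ler_pM2l// le_max su.
have HU : U (y + del) <= U y + p * del + e / (2 * E) * h.
  have := Hd (y + del) (addr_ge0 y0 del0).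
  have -> : y + del - y = del by ring.
  have -> : y - (y + del) = - del by ring.
  rewrite normrN (ger0_norm del0) => /(_ (le_lt_trans del1 hd)).
  rewrite ler_norml => /andP[_].
  have : e / (2 * E) * del <= e / (2 * E) * h by rewrite ler_pM2l.
  rewrite -/p; lra.
have phiE : phi (s + h) = U (y + del) * expR (- (r * (s + h))) +
    (\int[mu]_(u in `[t, s]) f u + \int[mu]_(u in `[s, s + h]) f u).
  by rewrite /phi XE (Rintegral_itv_split mf f_bnd ts ssh).
have -> : phi s = U y * E + \int[mu]_(u in `[t, s]) f u by [].
rewrite phiE.
have -> : expR (- (r * (s + h))) = E * expR (- (r * h)).
  by rewrite -expRD; congr expR; ring.
set q := expR (- (r * h)).
have rh0 : 0 < r * h by rewrite mulr_gt0.
have q0 : 0 < q by exact: expR_gt0.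
have q1 : q <= 1 by rewrite expRN_le1// ltW.
have q2 : 1 - r * h <= q by have := expR_ge1Dx (- (r * h)); rewrite -/q; lra.
have q3 : q <= 1 - r * h + (r * h) ^+ 2.
  have := expRN_1D (r * h); rewrite -/q => H.
  have : q * (1 + r * h) <= (1 - r * h + (r * h) ^+ 2) * (1 + r * h).
    have : 0 <= (r * h) ^+ 3 by rewrite exprn_ge0// ltW.
    by move: H; lra.
  by rewrite ler_pM2r//; lra.
set W := U (y + del) in HU *; set K1 := \int[mu]_(u in `[t, s]) f u.
set K2 := \int[mu]_(u in _) _ in Hf *; clearbody K1 K2.
have H1 : E * (W * q) <= E * (U y + p * del + e / (2 * E) * h) * q.
  by rewrite mulrA ler_pM2r// ler_pM2l.
have H2 : U y * q <= U y * (1 - r * h + (r * h) ^+ 2) by rewrite ler_pM2l.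
have H3 : p * del * q <= p * del + `|p| * h * (r * h).
  have H31 : (p * del) * (q - 1) <= `|p * del| * (1 - q).
    have := ler_norm (- (p * del)); rewrite normrN => Hn.
    have : (- (p * del)) * (1 - q) <= `|p * del| * (1 - q).
      by apply: ler_wpM2r => //; lra.
    by lra.
  have H32 : `|p * del| * (1 - q) <= (`|p| * h) * (r * h).
    apply: ler_pM => //; [lra| |lra].
    by rewrite normrM ler_wpM2l// ger0_norm.
  by lra.
have H4 : E * (e / (2 * E) * h) * q <= e * h / 2.
  have -> : E * (e / (2 * E) * h) = e * h / 2 by field; rewrite gt_eqF.
  by rewrite ler_piMr// divr_ge0// mulr_ge0// ltW.
have H5 : h * (h * M) <= h * e by rewrite ler_pM2l// ltW.
have H6 : E * (U y * q + p * del * q) <= E * (U y * (1 - r * h + (r * h) ^+ 2) + p * del + `|p| * h * (r * h)).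
  by rewrite ler_pM2l//; lra.
have H7 : E * (p * del + F y * J) <= E * (r * U y * h) by rewrite ler_pM2l.
have H8 : 0 <= E * (h * h) by rewrite mulr_ge0 ?mulr_ge0// ltW.
move: H1 H4 H5 H6 H7 Hf H8; rewrite /M; lra.
Qed.

Let phi_le b : t <= b -> phi b <= expR (- (r * t)) * U x.
Proof.
move=> tb; apply/ler_addgt0Pr => e e0.
(* A slack per unit of time whose total stays below e; the summand 1 covers b = t. *)
have e1 : 0 < e / (b - t + 1) by rewrite divr_gt0//; lra.
set e' := e / (b - t + 1) in e1.
have phit : phi t = expR (- (r * t)) * U x.
  rewrite /phi /X set_itv1 !Rintegral_set1 !addr0; exact: mulrC.
suff : 0 <= phi t + e' * (b - t) - phi b.
  have : e' * (b - t) <= e.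
    have -> : e = e' * (b - t + 1) by rewrite /e' divfK// gt_eqF//; lra.
    by rewrite ler_pM2l//; lra.
  by rewrite phit; lra.
apply: (@ge0_propagation_continuous _ t b (fun s => phi t + e' * (s - t) - phi s)) => //.
- move=> s; apply: cvgB; last exact: phi_continuous.
  apply: cvgD; first exact: cvg_cst.
  by apply: cvgM; [exact: cvg_cst|apply: cvgB; [exact: cvg_id|exact: cvg_cst]].
- by rewrite subrr mulr0 addr0 subrr.
- move=> s /andP[ts sb] gs; have [d d0 Hd] := phi_step ts e1.
  pose h := Num.min (d / 2) (b - s).
  have h0 : 0 < h by rewrite lt_min divr_gt0// subr_gt0.
  have hd : h < d by rewrite /h gt_min ltr_pdivrMr// ltr_pMr// ltr1n.
  have hb : h <= b - s by rewrite /h ge_min lexx orbT.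
  exists (s + h); split; first by rewrite ltrDl h0/=; lra.
  by have := Hd h; rewrite h0 hd => /(_ isT); lra.
Qed.

(** The value of U at the horizon b is nonnegative and is dropped, which leaves a bound on the
    payoff up to b that does not depend on b. *)
Lemma verification_upper :
  (\int[mu]_(s in `[t, +oo[)
    (F (x + \int[mu]_(u in `[t, s]) al u) * expR (- (r * s)) *
     (al s * (1 - al s)))%:E <= (expR (- (r * t)) * U x)%:E)%E.
Proof.
have U0 : 0 <= U x by rewrite ltW// stationary_value_gt0.
rewrite (_ : (\int[mu]_(s in _) _)%E = (\int[mu]_(s in `[t, +oo[) (f s)%:E)%E); last first.
  apply: eq_integral => s; rewrite inE/= in_itv/= andbT => ts.
  by rewrite /f max_l// (le_trans t0).
apply: ge0_integral_itvy_le => //; last first.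
  by rewrite lee_fin mulr_ge0// expR_ge0.
move=> b tb.
have intf : (\int[mu]_(u in `[t, b]) (f u)%:E)%E \is a fin_num.
  by apply: integrable_fin_num => //; exact: (bounded_integrable_itv _ _ mf f_bnd).
rewrite -[leLHS]fineK// lee_fin; apply: le_trans (phi_le tb).
rewrite /phi lerDr mulr_ge0 ?expR_ge0//.
by rewrite ltW// stationary_value_gt0.
Qed.

Lemma measurable_controlled_payoff : measurable_fun `[t, +oo[
  (fun s => F (x + \int[mu]_(u in `[t, s]) al u) * expR (- (r * s)) *
            (al s * (1 - al s))).
Proof.
apply: (eq_measurable_fun f); last exact: measurable_funTS.
by move=> s; rewrite inE/= in_itv/= andbT => ts; rewrite /f max_l// (le_trans t0).
Qed.

End verification.

(** * Stepwise controls as functions of time *)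

Section step_control.
Context (R : realType).
Local Notation mu := (@lebesgue_measure R).
Implicit Types (l : seq (rat * rat)) (F : R -> R).

(** Rate 0 after the last step stops the running payoff, in agreement with the empty case of
    [lower_payoff]. *)
Fixpoint step_control l (s : R) : R :=
  if l is c :: l' then
    if s < ratr c.2 then ratr c.1 else step_control l' (s - ratr c.2)
  else 0.

Lemma step_control01 l (s : R) : control_list l -> 0 <= step_control l s <= 1.
Proof.
elim: l s => [|c l IH] s; first by rewrite lexx ler01.
by move=> /(control_list_cons R)[a0 a1 h0 vl] /=; case: ifP => _; [rewrite a0|exact: IH].
Qed.

Lemma measurable_step_control l : measurable_fun setT (step_control l).
Proof.
elim: l => [|c l IH] /=; first exact: measurable_cst.
apply: measurable_fun_ifT => //; first exact: measurable_fun_ltr.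
by apply: (measurableT_comp IH); exact: measurable_funB.
Qed.

Lemma measurable_step_control_shift l (t : R) :
  measurable_fun setT (fun s : R => step_control l (s - t)).
Proof.
by apply: (measurableT_comp (measurable_step_control l)); exact: measurable_funB.
Qed.

Definition step_state l (t x s : R) :=
  x + \int[mu]_(u in `[t, s]) step_control l (u - t).

Lemma step_state_ge l (t x s : R) : control_list l -> x <= step_state l t x s.
Proof.
by move=> vl; rewrite lerDl Rintegral_ge0// => u _; have /andP[] := step_control01 (u - t) vl.
Qed.

Lemma step_control_norm l (s : R) : control_list l -> `|step_control l s| <= 1.
Proof. by move=> vl; have /andP[a0 a1] := step_control01 s vl; rewrite ger0_norm. Qed.

Lemma step_state_continuous l (t x : R) : control_list l ->
  continuous (step_state l t x).
Proof.
move=> vl; apply: (@lipschitz_continuous _ _ 1) => s s'; rewrite /step_state.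
rewrite opprD addrACA subrr add0r.
apply: Rintegral_itv_lip; first exact: measurable_step_control_shift.
by move=> u; exact: step_control_norm.
Qed.

Lemma step_state_cons c l (t x s : R) : control_list (c :: l) -> t + ratr c.2 <= s ->
  step_state (c :: l) t x s =
  step_state l (t + ratr c.2) (x + ratr c.1 * ratr c.2) s.
Proof.
move=> vcl; have [a0 a1 h0 vl] := control_list_cons R vcl => ths.
set a := ratr c.1 in a0 a1 *; set h := ratr c.2 in h0 ths *.
have tth : t <= t + h by rewrite lerDl.
have mc := measurable_step_control_shift (c :: l) t.
have bc u : `|step_control (c :: l) (u - t)| <= 1 by exact: step_control_norm.
rewrite /step_state (Rintegral_itv_split mc bc tth ths) addrA; congr (_ + _ + _).
  (* At the right endpoint the next step has already begun, so the closed interval is traded for the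
     half-open one. *)
  rewrite -Rintegral_itv_bndo_bndc; last first.
    by apply: integrableS (bounded_integrable_itv t (t + h) mc bc) => //; apply: subset_itvl; rewrite bnd_simp.
  rewrite (_ : a * h = \int[mu]_(u in `[t, t + h]) a); last first.
    by rewrite Rintegral_itv_cst// addrAC subrr add0r.
  rewrite -Rintegral_itv_bndo_bndc; last first.
    apply: integrableS (@bounded_integrable_itv _ (fun=> a) `|a| t (t + h) _ _) => //.
    by apply: subset_itvl; rewrite bnd_simp.
  apply: eq_Rintegral => u; rewrite inE/= in_itv/= => /andP[_ uh].
  by rewrite ifT//; rewrite ltrBlDl.
apply: eq_Rintegral => u; rewrite inE/= in_itv/= => /andP[hu _].
rewrite ifF; first by congr step_control; rewrite /h; ring.
by apply/negbTE; rewrite -leNgt lerBrDl.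
Qed.

Variable r : R.
Hypothesis r_gt0 : 0 < r.

Definition step_integrand F l (t x s : R) :=
  F (step_state l t x s) * expR (- (r * s)) *
  (step_control l (s - t) * (1 - step_control l (s - t))).

Variable F : R -> R.
Hypothesis F01 : forall x : R, 0 <= x -> 0 <= F x <= 1.
Hypothesis F_nincr : forall x y : R, 0 <= x -> x <= y -> F y <= F x.

Lemma step_integrand_ge0 l (t x s : R) : 0 <= x -> control_list l ->
  0 <= step_integrand F l t x s.
Proof.
move=> x0 vl; have /andP[a0 a1] := step_control01 (s - t) vl.
have /andP[b0 _] := onem_bound a0 a1.
rewrite /step_integrand mulr_ge0// mulr_ge0 ?expR_ge0//.
by have /andP[] := F01 (le_trans x0 (step_state_ge t x s vl)).
Qed.

Lemma measurable_step_integrand l (t x : R) : 0 <= x -> control_list l ->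
  measurable_fun setT (step_integrand F l t x).
Proof.
move=> x0 vl; apply: measurable_funM; last first.
  by apply: measurable_funM; [|apply: measurable_funB => //];
    exact: measurable_step_control_shift.
apply: measurable_funM; last first.
  by apply: measurableT_comp => //; apply: measurable_funN; exact: measurable_funM.
have -> : (fun s => F (step_state l t x s)) =
    (fun y => F (Num.max y 0)) \o step_state l t x.
  apply/funext => s /=; rewrite max_l//.
  exact: le_trans (step_state_ge t x s vl).
apply: measurableT_comp.
  apply: nonincreasing_measurable => // y z yz.
  by apply: F_nincr; [rewrite le_max lexx orbT|rewrite ge_max !le_max yz lexx orbT].
by apply: continuous_measurable_fun; exact: step_state_continuous.
Qed.

(** Along a step both the discount factor and F of the state decrease, so their values at its end
    bound the integrand from below. *)
Lemma lower_payoff_le_integral l (t x : R) : 0 <= x -> control_list l ->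
  ((expR (- (r * t)) * lower_payoff r F x l)%:E <=
   \int[mu]_(s in `[t, +oo[) (step_integrand F l t x s)%:E)%E.
Proof.
elim: l t x => [|c l IH] t x x0 vcl.
  rewrite mulr0 integral_ge0// => s _; rewrite lee_fin; exact: step_integrand_ge0.
have [a0 a1 h0 vl] := control_list_cons R vcl.
have mI := measurable_step_integrand t x0 vcl.
have I0 s := step_integrand_ge0 t s x0 vcl.
rewrite (_ : `[t, +oo[%classic = `[t, t + ratr c.2[ `|` `[t + ratr c.2, +oo[)%classic; last first.
  by rewrite -itv_bndbnd_setU// bnd_simp lerDl.
rewrite ge0_integral_setU//=; last 3 first.
- exact/measurable_EFinP/measurable_funTS.
- by move=> s _; rewrite lee_fin.
- apply/disj_set2P; rewrite -subset0 => s /=; rewrite !in_itv/= andbT => -[/andP[_ sh]].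
  by rewrite leNgt sh.
rewrite mulrDr mulrDr EFinD; apply: leeD; last first.
  rewrite mulrA -expRD (_ : _ + _ = - (r * (t + ratr c.2))); last by ring.
  have xa0 : 0 <= x + ratr c.1 * ratr c.2 by rewrite addr_ge0// mulr_ge0.
  rewrite (le_trans (IH _ _ xa0 vl))// le_eqVlt; apply/orP; left; apply/eqP.
  apply: eq_integral => s; rewrite inE/= in_itv/= andbT => hs.
  rewrite /step_integrand step_state_cons//=.
  rewrite ifF; last by apply/negbTE; rewrite -leNgt lerBrDl.
  by rewrite (_ : s - t - ratr c.2 = s - (t + ratr c.2)); last by ring.
rewrite /= mulrA -expRD (_ : _ + _ = - (r * (t + ratr c.2))); last by ring.
set a := ratr c.1 in a0 a1 *; set h := ratr c.2 in h0 *.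
set C := F (x + a * h) * expR (- (r * (t + h))) * (a * (1 - a)).
have -> : expR (- (r * (t + h))) * (h * F (x + a * h) * (a * (1 - a))) = C * h.
  by rewrite /C; ring.
have xa0 : 0 <= x + a * h by rewrite addr_ge0// mulr_ge0.
have /andP[b0 _] := onem_bound a0 a1.
have /andP[Fx0 _] := F01 xa0.
have C0 : 0 <= C by apply: mulr_ge0 => //; apply: mulr_ge0 => //; exact: expR_ge0.
have -> : ((C * h)%:E = \int[mu]_(s in `[t, (t + h)%R[) C%:E)%E.
  rewrite integral_cst//= lebesgue_measure_itv/= lte_fin.
  have [_|ht] := ltP t (t + h); first by rewrite -EFinB -EFinM addrAC subrr add0r.
  have h00 : h = 0 by apply/le_anti; rewrite h0 andbT; move: ht; rewrite gerDl.
  by rewrite h00 mulr0 mule0.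
apply: ge0_le_integral => //.
- exact/measurable_EFinP/measurable_funTS.
move=> s /=; rewrite in_itv/= => /andP[ts sh]; rewrite lee_fin.
rewrite /step_integrand /= ifT ?ltrBlDl// -/a.
apply: ler_wpM2r => //; apply: ler_pM; rewrite ?expR_ge0//; last first.
  by rewrite ler_expR lerN2 ler_pM2l// ltW.
apply: F_nincr; first exact: le_trans (step_state_ge t x s vcl).
have ms := measurable_step_control_shift (c :: l) t.
have bs u : `|step_control (c :: l) (u - t)| <= 1 by exact: step_control_norm.
rewrite lerD2l; apply: (@le_trans _ _ (a * (s - t))).
  apply: (Rintegral_itv_le ms bs) => // u /andP[_ us].
  by rewrite /= ifT//; rewrite ltrBlDl (le_lt_trans us).
by rewrite ler_wpM2l// lerBlDl ltW.
Qed.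

End step_control.

(** * Conditional expectations and measurability *)

Section sub_sigma_algebra.
Context d (T : measurableType d) (R : realType).
Variables (P : probability T R) (G : set (set T)).
Hypothesis sG : sigma_algebra setT G.
Hypothesis GT : G `<=` d.-measurable.
Local Notation TG := (g_sigma_algebraType G).

Lemma sub_sigma_measurableE (A : set T) : (measurable (A : set TG)) = G A.
Proof. by rewrite -[in RHS](measurable_g_measurableTypeE sG). Qed.

Lemma measurable_sub_sigma_id : measurable_fun setT (id : T -> TG).
Proof.
by move=> _ A; rewrite sub_sigma_measurableE setTI => GA; exact: GT.
Qed.

Lemma sub_sigma_measurable_fun d' (T' : measurableType d') (f : T -> T') :
  measurable_fun setT (f : TG -> T') -> measurable_fun setT f.
Proof. by move=> mf; exact: (measurableT_comp mf measurable_sub_sigma_id). Qed.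

(** A Radon-Nikodym density is measurable for the sigma-algebra of the type that carries the
    measures; P is therefore moved to [TG], as is the integral of Z below. *)
Definition restricted_probability : set TG -> \bar R := fun A => P A.

Let m0 : restricted_probability set0 = 0%E. Proof. exact: measure0. Qed.

Let m_ge0 A : (0 <= restricted_probability A)%E. Proof. exact: measure_ge0. Qed.

Let m_additive : semi_sigma_additive restricted_probability.
Proof.
move=> F mF tF mUF; apply: measure_semi_sigma_additive => //.
  by move=> n; apply: GT; rewrite -sub_sigma_measurableE.
by apply: GT; rewrite -sub_sigma_measurableE.
Qed.

HB.instance Definition _ := isMeasure.Build _ _ _ restricted_probability
  m0 m_ge0 m_additive.

Let m1 : restricted_probability setT = 1%E. Proof. exact: probability_setT. Qed.

HB.instance Definition _ := Measure_isProbability.Build _ _ _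
  restricted_probability m1.

Lemma ge0_integral_restricted (f : T -> \bar R) (A : set T) : G A ->
  measurable_fun setT (f : TG -> \bar R) -> (forall w, 0 <= f w)%E ->
  (\int[restricted_probability]_(w in (A : set TG)) f w = \int[P]_(w in A) f w)%E.
Proof.
move=> GA mf f0.
have mA : measurable (A : set TG) by rewrite sub_sigma_measurableE.
have := @ge0_integral_pushforward _ _ T TG R id measurable_sub_sigma_id P A f mA.
by apply => //; exact: measurable_funTS.
Qed.

Variable Z : T -> R.
Hypothesis intZ : P.-integrable setT (EFin \o Z).

Definition restricted_charge : set TG -> \bar R :=
  fun A => (\int[P]_(w in A) (Z w)%:E)%E.

Let c0 : restricted_charge set0 = 0%E. Proof. exact: integral_set0. Qed.

Let c_fin A : measurable A -> restricted_charge A \is a fin_num.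
Proof.
rewrite sub_sigma_measurableE => GA; apply: integrable_fin_num.
  exact: GT.
by apply: integrableS intZ => //; exact: GT.
Qed.

Let c_additive : semi_sigma_additive restricted_charge.
Proof.
move=> F mF tF mUF.
apply: (@charge_semi_sigma_additive _ _ _ (induced_charge intZ)) => //.
  by move=> n; apply: GT; rewrite -sub_sigma_measurableE.
by apply: GT; rewrite -sub_sigma_measurableE.
Qed.

HB.instance Definition _ := isCharge.Build _ _ _ restricted_charge
  c0 c_fin c_additive.

Lemma restricted_charge_dominated : restricted_charge `<< restricted_probability.
Proof.
apply/null_content_dominatesP => A; rewrite sub_sigma_measurableE => GA PA0.
apply: null_set_integral => //; first exact: GT.
by apply: measurable_funTS; exact: measurable_int intZ.
Qed.

(** The version is the density of A |-> E[Z; A] with respect to the restricted probability. *)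
Lemma cond_expectation_exists : exists Y, cond_expectation P G Z Y.
Proof.
pose f := Radon_Nikodym restricted_charge restricted_probability.
have ff w : f w \is a fin_num.
  by apply: Radon_Nikodym_fin_num; exact: restricted_charge_dominated.
have intf : restricted_probability.-integrable setT f.
  by apply: Radon_Nikodym_integrable; exact: restricted_charge_dominated.
have fE (A : set TG) : measurable A -> restricted_charge A =
    (\int[restricted_probability]_(w in A) f w)%E.
  by apply: Radon_Nikodym_integral; exact: restricted_charge_dominated.
have mf : measurable_fun setT (f : TG -> \bar R) by exact: measurable_int intf.
have GTT : G setT by rewrite -sub_sigma_measurableE.
have intPf : P.-integrable setT (f : T -> \bar R).
  apply/integrableP; split; first exact: (sub_sigma_measurable_fun mf).
  have /integrableP[_] := intf.
  by rewrite ge0_integral_restricted//; exact: measurableT_comp.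
exists (fun w => fine (f w)).
have -> : cond_expectation P G Z = fun Y => [/\ P.-integrable setT (EFin \o Z),
      P.-integrable setT (EFin \o Y),
      measurable_fun setT (Y : g_sigma_algebraType G -> R) &
      forall A, G A ->
        (\int[P]_(w in A) (Y w)%:E = \int[P]_(w in A) (Z w)%:E)%E] by [].
have fineE : EFin \o (fun w => fine (f w)) = f.
  by apply/funext => w /=; rewrite fineK.
split => //.
- by rewrite fineE.
- exact: measurableT_comp.
move=> A GA.
have mA : measurable (A : set TG) by rewrite sub_sigma_measurableE.
rewrite -/(restricted_charge A) fE//.
have -> : (\int[P]_(w in A) (fine (f w))%:E = \int[P]_(w in A) f w)%E.
  by apply: eq_integral => w _; rewrite fineK.
(* The change of sigma-algebra is stated for nonnegative integrands, hence the split into positive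
   and negative parts. *)
rewrite [LHS]integralE [RHS]integralE.
congr (_ - _)%E; rewrite ge0_integral_restricted//.
  exact: measurable_funepos.
exact: measurable_funeneg.
Qed.

End sub_sigma_algebra.

Section conditional_comparison.
Context d (T : measurableType d) (R : realType).
Variables (P : probability T R) (G : set (set T)).
Hypothesis sG : sigma_algebra setT G.
Hypothesis GT : G `<=` d.-measurable.
Local Notation TG := (g_sigma_algebraType G).

(** The inequality is tested on the event Y < X, which lies in G because both variables are
    G-measurable. *)
Lemma ae_le_of_integral (X Y : T -> R) :
  P.-integrable setT (EFin \o X) -> P.-integrable setT (EFin \o Y) ->
  measurable_fun setT (X : TG -> R) -> measurable_fun setT (Y : TG -> R) ->
  (forall A, G A -> (\int[P]_(w in A) (X w)%:E <= \int[P]_(w in A) (Y w)%:E)%E) ->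
  \forall w \ae P, X w <= Y w.
Proof.
move=> iX iY mX mY XY.
pose A := [set w | Y w < X w].
have GA : G A.
  rewrite -(sub_sigma_measurableE sG).
  have := measurable_fun_ltr mY mX measurableT (Y := [set true]).
  by rewrite setTI; apply.
have mA : measurable A by exact: GT.
have iXA := integrableS measurableT mA (@subsetT _ _) iX.
have iYA := integrableS measurableT mA (@subsetT _ _) iY.
have D0 : (\int[P]_(w in A) `|(X w - Y w)%:E| = 0)%E.
  apply/eqP; rewrite eq_le integral_ge0 ?andbT//.
  have -> : (\int[P]_(w in A) `|(X w - Y w)%:E| =
     \int[P]_(w in A) ((X w)%:E - (Y w)%:E))%E.
    apply: eq_integral => w; rewrite inE => Aw.
    by rewrite gee0_abs// lee_fin subr_ge0 ltW.
  rewrite integralB_EFin// leeBlDr ?add0e; last first.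
    exact: integrable_fin_num.
  exact: XY.
have mD : measurable_fun A (fun w => (X w - Y w)%:E).
  apply/measurable_EFinP/measurable_funTS/measurable_funB;
    exact: (sub_sigma_measurable_fun sG GT).
have /(ae_eq_integral_abs P mA mD) := D0.
apply: filterS => w Hw; rewrite leNgt; apply/negP => XYw.
have := Hw XYw => -[] /eqP; rewrite subr_eq0 => /eqP E.
by rewrite E ltxx in XYw.
Qed.

End conditional_comparison.

(** * Almost sure statements, countable suprema and right-continuous fields *)

Section measure_tools.
Context d (T : measurableType d) (R : realType).

(* Holds without measurability, the integral of a nonnegative function being a
   supremum over the simple functions below it. *)
Lemma ge0_le_integral_any (mu : {measure set T -> \bar R}) (D : set T)
    (f g : T -> \bar R) :
  (forall x, D x -> 0 <= f x)%E -> (forall x, D x -> f x <= g x)%E ->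
  (\int[mu]_(x in D) f x <= \int[mu]_(x in D) g x)%E.
Proof.
move=> f0 fg; have g0 x : D x -> (0 <= g x)%E.
  by move=> Dx; rewrite (le_trans (f0 _ Dx))// fg.
rewrite !ge0_integralE//; apply: le_ereal_sup => _ [h hf <-]; exists h => // x.
rewrite (le_trans (hf x))// !patchE; case: ifP => //; rewrite inE => Dx.
exact: fg.
Qed.

Lemma ae_forall_count (mu : {measure set T -> \bar R}) (I : countType)
    (Q : I -> T -> Prop) :
  (forall i, \forall w \ae mu, Q i w) -> \forall w \ae mu, forall i, Q i w.
Proof.
move=> HQ.
have : \forall w \ae mu, forall n : nat, if unpickle n is Some i then Q i w else True.
  by apply: ae_foralln => n; case: unpickle => [i|]; [exact: HQ|exact: aeW].
by apply: filterS => w Hw i; have := Hw (pickle i); rewrite pickleK.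
Qed.

Lemma measurable_sup_count (I : countType) (i0 : I) (A : pred I)
    (f : I -> T -> R) (M : R) :
  A i0 -> (forall i, measurable_fun setT (f i)) ->
  (forall i w, A i -> f i w <= M) ->
  measurable_fun setT (fun w => sup [set f i w | i in A]).
Proof.
move=> Ai0 mf fM.
(* Codes of no index, or of an index outside A, are sent to i0, so that the supremum becomes one
   over a sequence. *)
pose e n : I := if unpickle n is Some i then if A i then i else i0 else i0.
have Ae n : A (e n).
  by rewrite /e; case: unpickle => [i|//]; case: ifPn.
have -> : (fun w => sup [set f i w | i in A]) = fun w => sups (fun n => f (e n) w) 0.
  apply/funext => w; rewrite /sups /=; congr sup; apply/seteqP; split=> [_ [i Ai <-]|_ [n _ <-]].
    by exists (pickle i) => //=; rewrite /e pickleK ifT.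
  by exists (e n) => //; exact: Ae.
apply: measurable_fun_sups => // w _; exists M => _ [n _ <-]; exact: fM.
Qed.

Lemma ae_eq0_of_integral (mu : {measure set T -> \bar R}) (Z : T -> R) :
  measurable_fun setT Z -> (forall w, 0 <= Z w) ->
  (forall e, 0 < e -> (\int[mu]_w (Z w)%:E <= e%:E)%E) ->
  \forall w \ae mu, Z w = 0.
Proof.
move=> mZ Z0 Ze.
have I0 : (\int[mu]_w `|(Z w)%:E| = 0)%E.
  have -> : (\int[mu]_w `|(Z w)%:E| = \int[mu]_w (Z w)%:E)%E.
    by apply: eq_integral => w _; rewrite gee0_abs ?lee_fin.
  apply/eqP; rewrite eq_le integral_ge0 ?andbT; last by move=> w _; rewrite lee_fin.
  by apply/lee_addgt0Pr => e e0; rewrite add0e; exact: Ze.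
have mE : measurable_fun setT (EFin \o Z) by exact/measurable_EFinP.
have /(ae_eq_integral_abs mu measurableT mE) := I0.
by apply: filterS => w /(_ Logic.I) [].
Qed.

(* The values X p are approximated from the right by multiples of 1/(n+1). *)
Lemma measurable_right_continuous_comp (H : T -> R -> R) (X : T -> R) :
  (forall x, measurable_fun setT (H ^~ x)) ->
  (forall p (x : R), H p y @[y --> x^'+] --> H p x) ->
  measurable_fun setT X -> (forall p, 0 <= X p) ->
  measurable_fun setT (fun p => H p (X p)).
Proof.
move=> mH rcH mX X0.
pose k n p := Num.truncn (n.+1%:R * X p).
(* The successor places the approximation strictly above X p, as the limit from the right
   requires. *)
pose D n p : R := (k n p).+1%:R / n.+1%:R.
have X0' n p : 0 <= n.+1%:R * X p by rewrite mulr_ge0.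
have DX n p : X p < D n p.
  rewrite /D ltr_pdivlMr// mulrC.
  by have /andP[] := truncn_itv (X0' n p).
have DX' n p : D n p <= X p + n.+1%:R^-1.
  rewrite /D ler_pdivrMr// mulrDl mulVf// -natr1 lerD2r mulrC.
  by have /andP[] := truncn_itv (X0' n p).
apply: (@measurable_fun_cvg _ _ _ _ (fun n p => H p (D n p))); last first.
  move=> p _; apply: (proj1 (cvg_at_rightP _ _ _) (rcH p (X p))); split.
    by move=> n; exact: DX.
  apply: (@squeeze_cvgr _ _ _ _ (fun=> X p) (fun n => X p + n.+1%:R^-1)).
  - by apply: nearW => n; rewrite ltW//=; exact: DX'.
  - exact: cvg_cst.
  - rewrite -[X in _ --> X]addr0; apply: cvgD; first exact: cvg_cst.
    exact: cvg_harmonic.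
move=> n.
pose E i := [set p | k n p = i].
have mE i : measurable (E i).
  have -> : E i = [set p | i%:R <= n.+1%:R * X p] `&`
                  [set p | n.+1%:R * X p < i.+1%:R].
    apply/seteqP; split=> p /=.
      by move=> <-; have /andP[] := truncn_itv (X0' n p).
    by move=> [H1 H2]; apply: truncn_def; rewrite H1 H2.
  apply: measurableI.
    have := @measurable_fun_ler _ T R setT (cst i%:R) (fun p => n.+1%:R * X p).
    move=> /(_ (measurable_cst _) (measurable_funM (measurable_cst _) mX) measurableT [set true]).
    by rewrite setTI; apply.
  have := @measurable_fun_ltr _ T R setT (fun p => n.+1%:R * X p) (cst i.+1%:R).
  move=> /(_ (measurable_funM (measurable_cst _) mX) (measurable_cst _) measurableT [set true]).
  by rewrite setTI; apply.
have -> : [set: T] = \bigcup_i E i.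
  by apply/seteqP; split=> // p _; exists (k n p).
apply/measurable_fun_bigcup => // i.
apply: (eq_measurable_fun (H ^~ (i.+1%:R / n.+1%:R))).
  by move=> p; rewrite inE => Ep; rewrite /D Ep.
exact: measurable_funTS.
Qed.

End measure_tools.

Lemma bounded_integrable_probability d (T : measurableType d) (R : realType)
    (P : probability T R) (Z : T -> R) (C : R) :
  measurable_fun setT Z -> (forall w, `|Z w| <= C) ->
  P.-integrable setT (EFin \o Z).
Proof.
move=> mZ ZC; apply: measurable_bounded_integrable => //.
  by rewrite (le_lt_trans (probability_le1 P measurableT))// ltry.
by exists C; split; [exact: num_real|move=> y Cy w _ /=; rewrite (le_trans (ZC w))// ltW].
Qed.

(** * The survival field and its limit *)

(** The half-line is covered by the intervals from 0 to n, on each of which the process is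
    measurable for [Fil n], a part of the full sigma-algebra. *)
Lemma progressively_measurable_total (R : realType) d (T : measurableType d)
    (Fil : R -> set (set T)) (a : R -> T -> R) : filtration Fil ->
  progressively_measurable Fil a ->
  measurable_fun setT (fun p : R * T => a (Num.max p.1 0) p.2).
Proof.
move=> [sF FT _] pa.
have ma : measurable_fun (`[0, +oo[ `*` setT : set (R * T)) (fun p => a p.1 p.2).
  have -> : `[0, +oo[%classic `*` setT = \bigcup_n (`[0, n%:R] `*` setT) :> set (R * T).
    apply/seteqP; split=> [[s w] [/=]|[s w] [n _] [/=]]; rewrite !in_itv/=.
      rewrite andbT => s0 _; exists (Num.truncn s).+1 => //; split=> //=.
      by rewrite in_itv/= s0 ltW//; have /andP[] := truncn_itv s0.
    by move=> /andP[-> _].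
  apply/measurable_fun_bigcup => n; first exact: measurableX.
  have n0 : (0 : R) <= n%:R by [].
  pose g (p : R * T) : R * g_sigma_algebraType (Fil n%:R) := (p.1, p.2).
  have mg : measurable_fun setT g.
    apply/measurable_fun_pair => //.
    exact: (measurableT_comp (measurable_sub_sigma_id (sF _ n0) (FT _ n0)) measurable_snd).
  have mD : measurable (`[0, n%:R] `*` setT : set (R * g_sigma_algebraType (Fil n%:R))).
    exact: measurableX.
  have gD : g @` (`[0, n%:R] `*` setT) `<=` `[0, n%:R] `*` setT.
    by move=> _ [p [p1 _] <-].
  exact: (measurable_comp mD gD (pa _ n0) (measurable_funTS mg)).
pose g (p : R * T) : R * T := (Num.max p.1 0, p.2).
have mg : measurable_fun setT g.
  by apply/measurable_fun_pair => //; exact: measurable_maxr.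
have mD : measurable (`[0, +oo[ `*` setT : set (R * T)) by exact: measurableX.
have gD : g @` setT `<=` `[0, +oo[ `*` setT.
  by move=> _ [p _ <-]; split=> //=; rewrite in_itv/= le_max lexx orbT.
exact: (measurable_comp mD gD ma mg).
Qed.

Section survival_field.
Context (R : realType) (d : measure_display) (Omega : measurableType d).
Variables (P : probability Omega R) (Fil : R -> set (set Omega)).
Hypothesis Fil_filtration : filtration Fil.
Variable X : {RV P >-> R}.
Variable Fhat : R -> R -> Omega -> R.
Hypothesis Fhat_field : cond_survival_field P Fil X Fhat.
Local Notation TG t := (g_sigma_algebraType (Fil t)).
Local Notation mu := (@lebesgue_measure R).

Let sF t : 0 <= t -> sigma_algebra setT (Fil t).
Proof. by case: Fil_filtration => H _ _; exact: H. Qed.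

Let FT t : 0 <= t -> Fil t `<=` d.-measurable.
Proof. by case: Fil_filtration => _ H _; exact: H. Qed.

Let FF s t : 0 <= s -> s <= t -> Fil s `<=` Fil t.
Proof. by case: Fil_filtration => _ _; exact. Qed.

(* Total in time and space, so that measurability needs no domain. *)
Definition total_field (s x : R) (w : Omega) := Fhat (Num.max s 0) (Num.max x 0) w.
Local Notation Fh := total_field.

Lemma total_fieldE (s x : R) w : 0 <= s -> 0 <= x -> Fh s x w = Fhat s x w.
Proof. by move=> s0 x0; rewrite /total_field !max_l. Qed.

Lemma total_field01 (s x : R) w : 0 <= Fh s x w <= 1.
Proof.
by case: Fhat_field => _ _ H _; apply: H; rewrite le_max lexx orbT.
Qed.

Lemma total_field_right_continuous (s x : R) w : Fh s y w @[y --> x^'+] --> Fh s x w.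
Proof.
rewrite /total_field; have [x0|x0] := leP 0 x.
  case: Fhat_field => _ _ _ H.
  rewrite ?(max_l x0).
  apply: (@cvg_trans _ (Fhat (Num.max s 0) y w @[y --> x^'+])); last first.
    by apply: H => //; rewrite le_max lexx orbT.
  apply: near_eq_cvg; near=> y; have y0 : 0 <= y; last by rewrite (max_l y0).
  by apply: (le_trans x0); apply: ltW; near: y; exact: nbhs_right_gt.
rewrite ?(max_r (ltW x0)).
apply: (@cvg_trans _ (Fhat (Num.max s 0) 0 w @[y --> x^'+])); last exact: cvg_cst.
apply: near_eq_cvg; near=> y; have y0 : y <= 0; last by rewrite (max_r y0).
by apply: ltW; near: y; exact: nbhs_right_lt.
Unshelve. all: by end_near. Qed.

Lemma measurable_total_field (x : R) :
  measurable_fun setT (fun p : R * Omega => Fh p.1 x p.2).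
Proof.
case: Fhat_field => _ H _ _; have m0 : 0 <= Num.max x 0 by rewrite le_max lexx orbT.
exact: (progressively_measurable_total Fil_filtration (H _ m0)).
Qed.

Lemma total_field_cond (t x : R) : 0 <= t -> 0 <= x ->
  cond_expectation P (Fil t) (\1_[set w | x < X w]) (Fh t x).
Proof.
move=> t0 x0; have -> : Fh t x = Fhat t x by apply/funext => w; rewrite total_fieldE.
by case: Fhat_field => H _ _ _; exact: H.
Qed.

Lemma measurable_total_field_at (t x : R) : 0 <= t ->
  measurable_fun setT (Fh t x : TG t -> R).
Proof.
move=> t0; have m0 : 0 <= Num.max x 0 by rewrite le_max lexx orbT.
have [_ _ + _] := total_field_cond t0 m0.
have -> // : Fh t (Num.max x 0) = Fh t x.
by apply/funext => w; rewrite /total_field (max_l m0).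
Qed.

(** Both sides equal P(A, X > x), since A also belongs to [Fil s]. *)
Lemma total_field_tower (s t x : R) (A : set Omega) : 0 <= t -> t <= s -> 0 <= x ->
  Fil t A -> (\int[P]_(w in A) (Fh s x w)%:E = \int[P]_(w in A) (Fh t x w)%:E)%E.
Proof.
move=> t0 ts x0 FA.
have [_ _ _ ->] := total_field_cond (le_trans t0 ts) x0; last exact: FF FA.
by have [_ _ _ ->] := total_field_cond t0 x0.
Qed.

(** For each pair of points monotonicity holds off a null set; these are united over rational pairs,
    and right continuity extends the result to real points. *)
Lemma total_field_nincr_ae (t : R) : 0 <= t ->
  \forall w \ae P, forall x y : R, 0 <= x -> x <= y -> Fh t y w <= Fh t x w.
Proof.
move=> t0.
have Hq : \forall w \ae P, forall q : rat * rat,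
    (0 <= q.1)%R -> (q.1 <= q.2)%R -> Fh t (ratr q.2) w <= Fh t (ratr q.1) w.
  apply: ae_forall_count => -[q1 q2] /=.
  have [q10|] := leP 0 q1; last by move=> _; apply: aeW.
  have [q12|] := leP q1 q2; last by move=> _; apply: aeW.
  have r1 : 0 <= ratr q1 :> R by rewrite ler0q.
  have r12 : ratr q1 <= ratr q2 :> R by rewrite ler_rat.
  have [_ i1 m1 E1] := total_field_cond t0 r1.
  have [_ i2 m2 E2] := total_field_cond t0 (le_trans r1 r12).
  have : \forall w \ae P, Fh t (ratr q2) w <= Fh t (ratr q1) w.
    apply: (ae_le_of_integral (sF t0) (FT t0)) => // A FA.
    rewrite E1// E2//; apply: ge0_le_integral_any => w _; rewrite !indicE lee_fin//.
    rewrite ler_nat; case: (boolP (w \in [set w | ratr q2 < X w])) => //.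
    by rewrite inE/= => H; rewrite mem_set//=; exact: le_lt_trans r12 H.
  by apply: filterS => w H _ _.
apply: filterS Hq => w Hq x y x0; rewrite le_eqVlt => /predU1P[->//|xy].
apply/ler_addgt0Pr => e e0.
have cx : Fh t z w @[z --> x^'+] --> Fh t x w by exact: total_field_right_continuous.
have cy : Fh t z w @[z --> y^'+] --> Fh t y w by exact: total_field_right_continuous.
have e20 : 0 < e / 2 by rewrite divr_gt0.
have [q [xq qy Hx]] : exists q : rat, [/\ x < ratr q, ratr q < y & Fh t (ratr q) w <= Fh t x w + e / 2].
  have /cvgrPdist_le/(_ _ e20) := cx.
  move=> /nbhs_ballP[dl/= dl0 Hd].
  have [q] : exists q, ratr q \in `]x, (Num.min y (x + dl))[.
    by apply: rat_in_itvoo; rewrite lt_min xy ltrDl.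
  rewrite in_itv/= lt_min => /and3P[xq qy qd]; exists q; split=> //.
  have := Hd (ratr q); rewrite /ball/= ltr0_norm ?subr_lt0// opprB => /(_ _ xq).
  by rewrite ltrBlDl => /(_ qd); rewrite ler_norml => /andP[]; lra.
have [q' [yq' Hy]] : exists q' : rat, y < ratr q' /\ Fh t y w <= Fh t (ratr q') w + e / 2.
  have /cvgrPdist_le/(_ _ e20) := cy.
  move=> /nbhs_ballP[dl/= dl0 Hd].
  have [q'] : exists q, ratr q \in `]y, (y + dl)[ by apply: rat_in_itvoo; rewrite ltrDl.
  rewrite in_itv/= => /andP[yq qd]; exists q'; split=> //.
  have := Hd (ratr q'); rewrite /ball/= ltr0_norm ?subr_lt0// opprB => /(_ _ yq).
  by rewrite ltrBlDl => /(_ qd); rewrite ler_norml => /andP[]; lra.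

have : Fh t (ratr q') w <= Fh t (ratr q) w.
  apply: (Hq (q, q')) => /=; first by rewrite -(ler0q R) ltW// (le_lt_trans x0).
  by rewrite -(ler_rat R) ltW// (lt_trans qy).
lra.
Qed.

End survival_field.

(** * Tonelli on a product of subsets, and discounted time integrals *)

Section tonelli_on.
Local Open Scope ereal_scope.
Context d1 d2 (T1 : measurableType d1) (T2 : measurableType d2) (R : realType).
Variables (m1 : {sigma_finite_measure set T1 -> \bar R})
          (m2 : {sigma_finite_measure set T2 -> \bar R}).
Variables (D : set T1) (A : set T2) (f : T1 * T2 -> \bar R).
Hypotheses (mD : measurable D) (mA : measurable A).
Hypotheses (mf : measurable_fun setT f) (f0 : forall p, 0 <= f p).

Let g := f \_ (D `*` A).

Let mg : measurable_fun setT g.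
Proof.
have mDA : measurable (D `*` A) by exact: measurableX.
exact: ((measurable_restrictT f mDA).1 (measurable_funTS mf)).
Qed.

Let g0 p : 0 <= g p. Proof. by rewrite /g patchE; case: ifP. Qed.

Let gE x y : g (x, y) = if (x \in D) && (y \in A) then f (x, y) else 0.
Proof. by rewrite /g patchE in_setX. Qed.

Lemma tonelli_on : \int[m1]_(x in D) \int[m2]_(y in A) f (x, y) =
  \int[m2]_(y in A) \int[m1]_(x in D) f (x, y).
Proof.
transitivity (\int[m1]_x \int[m2]_y g (x, y)).
  rewrite integral_mkcond; apply: eq_integral => x _; rewrite patchE.
  case: ifPn => xD.
    rewrite integral_mkcond; apply: eq_integral => y _.
    by rewrite patchE gE xD.
  by rewrite integral0_eq// => y _; rewrite gE (negbTE xD).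
rewrite fubini_tonelli//.
rewrite [RHS]integral_mkcond; apply: eq_integral => y _; rewrite patchE.
case: ifPn => yA.
  rewrite [RHS]integral_mkcond; apply: eq_integral => x _.
  by rewrite patchE gE yA andbT.
by rewrite integral0_eq// => x _; rewrite gE (negbTE yA) andbF.
Qed.

End tonelli_on.

Lemma measurable_integral_on d1 d2 (T1 : measurableType d1) (T2 : measurableType d2)
   (R : realType) (m1 : {sigma_finite_measure set T1 -> \bar R})
   (D : set T1) (f : T1 * T2 -> \bar R) : measurable D ->
  measurable_fun setT f -> (forall p, 0 <= f p)%E ->
  measurable_fun setT (fun y => \int[m1]_(x in D) f (x, y))%E.
Proof.
move=> mD mf f0; pose g := f \_ (D `*` setT).
have mg : measurable_fun setT g.
  have mDA : measurable (D `*` setT : set (T1 * T2)) by exact: measurableX.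
  exact: ((measurable_restrictT f mDA).1 (measurable_funTS mf)).
have g0 p : (0 <= g p)%E by rewrite /g patchE; case: ifP.
have := measurable_fun_fubini_tonelli_G (m1 := m1) g mg g0.
congr measurable_fun; apply/funext => y; rewrite /fubini_G [RHS]integral_mkcond.
by apply: eq_integral => x _; rewrite /g !patchE in_setX in_setT andbT.
Qed.

Section exponential.
Context (R : realType).
Local Notation mu := (@lebesgue_measure R).

Lemma integral_expRN (r a : R) : 0 < r ->
  (\int[mu]_(s in `[a, +oo[) (expR (- (r * s)))%:E = (expR (- (r * a)) / r)%:E)%E.
Proof.
move=> r0.
have cE : continuous (fun z : R => expR (- r * z)).
  move=> z; apply: continuous_comp; last exact: continuous_expR.
  by apply: cvgM; [exact: cvg_cst|exact: cvg_id].
under eq_integral do rewrite -mulNr.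
rewrite (@ge0_continuous_FTC2y _ _ (fun x => - (r^-1 * expR (- r * x))) _ 0)//.
- by rewrite add0e -EFinN opprK mulNr mulrC.
- exact: continuous_subspaceT.
- rewrite -oppr0; apply: cvgN; rewrite -(mulr0 r^-1); apply: cvgM; first exact: cvg_cst.
  rewrite (_ : (fun x => expR (- r * x)) =
               (fun z => expR (- z)) \o (fun z => r * z)); last first.
    by apply: eq_fun => x; rewrite mulNr.
  apply: (@cvg_comp _ _ _ _ _ _ (pinfty_nbhs R)); last exact: cvgr_expR.
  exact: gt0_cvgMry.
- apply: cvgN; apply: cvgM; first exact: cvg_cst.
  by apply/cvg_at_right_filter; exact: cE.
- move=> z _; rewrite derive1N// derive1Ml// derive1_comp// derive1E.
  have /funeqP -> := @derive_expR R.
  by rewrite derive1Ml// derive1_id mulr1; field; rewrite gt_eqF.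
Qed.

End exponential.

Section time_integrals.
Local Open Scope ereal_scope.
Context (R : realType) d (T : measurableType d) (P : probability T R).
Local Notation mu := (@lebesgue_measure R).
Variables (t : R) (f : R * T -> \bar R).
Hypotheses (mf : measurable_fun setT f) (f0 : forall p, 0 <= f p).

Lemma tonelli_time (A : set T) : measurable A ->
  \int[mu]_(s in `[t, +oo[) \int[P]_(w in A) f (s, w) =
  \int[P]_(w in A) \int[mu]_(s in `[t, +oo[) f (s, w).
Proof.
move=> mA; apply: (@tonelli_on _ _ (measurableTypeR R) T R mu P) => //.
Qed.

Lemma measurable_time_integral :
  measurable_fun setT (fun w => \int[mu]_(s in `[t, +oo[) f (s, w)).
Proof.
apply: (@measurable_integral_on _ _ (measurableTypeR R) T R mu) => //.
Qed.

End time_integrals.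

(** * Conditional rewards of deterministic controls *)

Section step_reward.
Context (R : realType) (d : measure_display) (Omega : measurableType d).
Variables (P : probability Omega R) (Fil : R -> set (set Omega)).
Hypothesis Fil_filtration : filtration Fil.
Variable X : {RV P >-> R}.
Variable Fhat : R -> R -> Omega -> R.
Hypothesis Fhat_field : cond_survival_field P Fil X Fhat.
Variable r : R.
Hypothesis r_gt0 : 0 < r.
Local Notation TG t := (g_sigma_algebraType (Fil t)).
Local Notation mu := (@lebesgue_measure R).
Local Notation Fh := (total_field Fhat).

Let sF t : 0 <= t -> sigma_algebra setT (Fil t).
Proof. by case: Fil_filtration => H _ _; exact: H. Qed.

Let FT t : 0 <= t -> Fil t `<=` d.-measurable.
Proof. by case: Fil_filtration => _ H _; exact: H. Qed.

Let Fh01 (s x : R) w : 0 <= Fh s x w <= 1.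
Proof. exact: total_field01 Fhat_field s x w. Qed.

Variables (t x : R) (l : seq (rat * rat)).
Hypotheses (t0 : 0 <= t) (x0 : 0 <= x) (vl : control_list l).

(** The second factor is arbitrary because the lemma is applied both over the full sigma-algebra and
    over [Fil t]. *)
Lemma measurable_step_field d' (T' : measurableType d') (phi : R * T' -> R -> R) :
  (forall y, measurable_fun setT (phi ^~ y)) ->
  (forall p (y : R), phi p z @[z --> y^'+] --> phi p y) ->
  measurable_fun setT (fun p => step_integrand r (phi p) l t x p.1).
Proof.
move=> mphi rphi.
have mc : measurable_fun setT (fun p : R * T' => step_control l (p.1 - t)).
  exact: (measurableT_comp (measurable_step_control_shift l t) measurable_fst).
apply: measurable_funM; last by apply: measurable_funM => //; exact: measurable_funB.
apply: measurable_funM; last first.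
  by apply: measurableT_comp => //; apply: measurable_funN; exact: measurable_funM.
apply: (measurable_right_continuous_comp mphi rphi).
  apply: (measurableT_comp _ measurable_fst).
  by apply: continuous_measurable_fun; exact: step_state_continuous.
by move=> p; rewrite (le_trans x0)// step_state_ge.
Qed.

Lemma step_integrand_le (F : R -> R) (s : R) :
  (forall y : R, 0 <= y -> 0 <= F y <= 1) ->
  step_integrand r F l t x s <= expR (- (r * s)).
Proof.
move=> F01; have /andP[a0 a1] := step_control01 (s - t) vl.
have /andP[b0 b1] := onem_bound a0 a1.
have /andP[f0 f1] := F01 _ (le_trans x0 (step_state_ge t x s vl)).
rewrite /step_integrand -[leRHS]mulr1; apply: ler_pM => //.
- by rewrite mulr_ge0// expR_ge0.
- by rewrite ler_piMl// expR_ge0.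
- by rewrite (le_trans b1)// invf_le1// ler1n.
Qed.

Lemma step_integral_le (F : R -> R) :
  (forall y : R, 0 <= y -> 0 <= F y <= 1) ->
  (\int[mu]_(s in `[t, +oo[) (step_integrand r F l t x s)%:E <=
    (expR (- (r * t)) / r)%:E)%E.
Proof.
move=> F01; rewrite -integral_expRN//; apply: ge0_le_integral_any => s _.
  by rewrite lee_fin step_integrand_ge0.
by rewrite lee_fin step_integrand_le.
Qed.

(** [I1] runs along the moving field, [I2] along the field frozen at t; only the time integral of
    [I2] is [Fil t]-measurable. *)
Let I1 p := step_integrand r (fun y => Fh p.1 y p.2) l t x p.1.
Let I2 p := step_integrand r (fun y => Fh t y p.2) l t x p.1.

Let mI1 : measurable_fun setT I1.
Proof.
pose phi (p : R * Omega) y := Fh p.1 y p.2.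
have H1 y : measurable_fun setT (phi ^~ y).
  exact: (measurable_total_field Fil_filtration Fhat_field).
have H2 p (y : R) : phi p z @[z --> y^'+] --> phi p y.
  exact: (total_field_right_continuous Fhat_field).
exact: (measurable_step_field H1 H2).
Qed.

Let mI2G : measurable_fun setT (I2 : R * TG t -> R).
Proof.
pose phi (p : R * TG t) y := Fh t y p.2.
have H1 y : measurable_fun setT (phi ^~ y).
  have mF := measurable_total_field_at Fhat_field y t0.
  exact: (measurableT_comp mF measurable_snd).
have H2 p (y : R) : phi p z @[z --> y^'+] --> phi p y.
  exact: (total_field_right_continuous Fhat_field).
exact: (measurable_step_field H1 H2).
Qed.

Let mI2 : measurable_fun setT I2.
Proof.
pose phi (p : R * Omega) y := Fh t y p.2.
have H1 y : measurable_fun setT (phi ^~ y).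
  have mF := measurable_total_field_at Fhat_field y t0.
  exact: (measurableT_comp (sub_sigma_measurable_fun (sF t0) (FT t0) mF) measurable_snd).
have H2 p (y : R) : phi p z @[z --> y^'+] --> phi p y.
  exact: (total_field_right_continuous Fhat_field).
exact: (measurable_step_field H1 H2).
Qed.

Let I1_ge0 p : 0 <= I1 p. Proof. by apply: step_integrand_ge0. Qed.
Let I2_ge0 p : 0 <= I2 p. Proof. by apply: step_integrand_ge0. Qed.

Let J1 w := (\int[mu]_(s in `[t, +oo[) (I1 (s, w))%:E)%E.
Let J2 w := (\int[mu]_(s in `[t, +oo[) (I2 (s, w))%:E)%E.

Let J1_bnd w : (0 <= J1 w <= (expR (- (r * t)) / r)%:E)%E.
Proof.
rewrite integral_ge0/=; last by move=> s _; rewrite lee_fin.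
rewrite -integral_expRN//; apply: ge0_le_integral_any => s _; rewrite lee_fin//.
exact: step_integrand_le.
Qed.

Let J2_bnd w : (0 <= J2 w <= (expR (- (r * t)) / r)%:E)%E.
Proof.
rewrite integral_ge0/=; last by move=> s _; rewrite lee_fin.
by apply: (@step_integral_le (Fh t ^~ w)) => y _; exact: Fh01.
Qed.

Let fin_bnd (y : \bar R) (C : R) : (0 <= y <= C%:E)%E -> y \is a fin_num.
Proof.
by move=> /andP[y0 yC]; rewrite ge0_fin_numE// (le_lt_trans yC)// ltry.
Qed.

Definition step_value w := \int[mu]_(s in `[t, +oo[) I2 (s, w).

Definition step_process : R -> Omega -> R := fun s _ => step_control l (s - t).

Lemma admissible_step_process : admissible Fil step_process.
Proof.
split=> [s s0|s w s0]; last exact: step_control01.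
by apply: measurable_funTS; exact: (measurableT_comp (measurable_step_control_shift l t) measurable_fst).
Qed.

Let rewardE w : reward r Fhat step_process t x w = fine (J1 w).
Proof.
rewrite /reward /Rintegral; congr fine; apply: eq_integral => s.
rewrite inE/= in_itv/= andbT => ts; congr (_%:E).
rewrite /I1 /step_integrand /= total_fieldE//.
  exact: le_trans ts.
by rewrite (le_trans x0)// step_state_ge.
Qed.

(* The control being deterministic, so is the state, and the tower property lets
   Fhat be frozen at time t inside the time integral. *)
Lemma step_value_cond_expectation :
  cond_expectation P (Fil t) (reward r Fhat step_process t x) step_value.
Proof.
have -> : reward r Fhat step_process t x = fine \o J1 by apply/funext => w; exact: rewardE.
have mJ1 : measurable_fun setT J1.
  apply: (@measurable_time_integral _ _ _ t (fun p => (I1 p)%:E)).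
    exact/measurable_EFinP.
  by move=> p; rewrite lee_fin.
have mJ2G : measurable_fun setT (J2 : TG t -> \bar R).
  apply: (@measurable_time_integral _ _ (TG t) t (fun p => (I2 p)%:E)).
    exact/measurable_EFinP.
  by move=> p; rewrite lee_fin.
have mJ2 := sub_sigma_measurable_fun (sF t0) (FT t0) mJ2G.
have bnd (J : Omega -> \bar R) : measurable_fun setT J ->
    (forall w, 0 <= J w <= (expR (- (r * t)) / r)%:E)%E ->
    P.-integrable setT (EFin \o (fine \o J)).
  move=> mJ Jb; apply: (@bounded_integrable_probability _ _ _ P _ (expR (- (r * t)) / r)).
    exact: measurableT_comp.
  move=> w /=; have Jf := fin_bnd (Jb w); have /andP[J0 JC] := Jb w.
  by rewrite ger0_norm ?fine_ge0// -lee_fin fineK.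
split.
- exact: bnd J1_bnd.
- exact: bnd J2_bnd.
- exact: (measurableT_comp (fine_measurable measurableT) mJ2G).
move=> A FA; have mA : measurable A := FT t0 FA.
have -> : (\int[P]_(w in A) (step_value w)%:E = \int[P]_(w in A) J2 w)%E.
  by apply: eq_integral => w _; rewrite fineK// (fin_bnd (J2_bnd w)).
have -> : (\int[P]_(w in A) ((fine \o J1) w)%:E = \int[P]_(w in A) J1 w)%E.
  by apply: eq_integral => w _; rewrite /= fineK// (fin_bnd (J1_bnd w)).
have mE1 : measurable_fun setT (fun p => (I1 p)%:E) by exact/measurable_EFinP.
have mE2 : measurable_fun setT (fun p => (I2 p)%:E) by exact/measurable_EFinP.
have E1 p : (0 <= (I1 p)%:E)%E by rewrite lee_fin.
have E2 p : (0 <= (I2 p)%:E)%E by rewrite lee_fin.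
(* With the expectation inside, it suffices to compare at each time s, where the integrand is a
   deterministic factor times the field at a deterministic point. *)
rewrite -(tonelli_time P t mE1 E1 mA) -(tonelli_time P t mE2 E2 mA).
apply: eq_integral => s; rewrite inE/= in_itv/= andbT => ts.
have s0 : 0 <= s by exact: le_trans ts.
have xs : 0 <= step_state l t x s by rewrite (le_trans x0)// step_state_ge.
pose g := expR (- (r * s)) * (step_control l (s - t) * (1 - step_control l (s - t))).
have g0 : 0 <= g.
  have /andP[a0 a1] := step_control01 (s - t) vl.
  by have /andP[b0 _] := onem_bound a0 a1; rewrite mulr_ge0// expR_ge0.
have factor u : 0 <= u -> (\int[P]_(w in A) (step_integrand r (fun y => Fh u y w) l t x s)%:E =
    g%:E * \int[P]_(w in A) (Fh u (step_state l t x s) w)%:E)%E.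
  move=> u0; rewrite -ge0_integralZl_EFin//.
  - by apply: eq_integral => w _; rewrite -EFinM /step_integrand /g; congr (_%:E); ring.
  - by move=> w _; rewrite lee_fin; have /andP[] := Fh01 u (step_state l t x s) w.
  - apply/measurable_EFinP/measurable_funTS.
    exact: (sub_sigma_measurable_fun (sF u0) (FT u0) (measurable_total_field_at Fhat_field _ u0)).
rewrite /I1 /I2 /= factor// factor//; congr (_ * _)%E.
by rewrite (total_field_tower Fil_filtration Fhat_field t0 ts xs FA).
Qed.

Lemma lower_payoff_le_step_value w :
  (forall y z : R, 0 <= y -> y <= z -> Fh t z w <= Fh t y w) ->
  expR (- (r * t)) * lower_payoff r (Fh t ^~ w) x l <= step_value w.
Proof.
move=> nincr; rewrite -lee_fin /step_value /Rintegral fineK; last exact: (fin_bnd (J2_bnd w)).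
by apply: lower_payoff_le_integral => // y _; exact: Fh01.
Qed.

End step_reward.

(** * Lower bound for the value *)

Section value_lower_bound.
Context (R : realType) (d : measure_display) (Omega : measurableType d).
Variables (P : probability Omega R) (Fil : R -> set (set Omega)).
Hypothesis Fil_filtration : filtration Fil.
Variable X : {RV P >-> R}.
Variable Fhat : R -> R -> Omega -> R.
Hypothesis Fhat_field : cond_survival_field P Fil X Fhat.
Variable r : R.
Hypothesis r_gt0 : 0 < r.
Local Notation Fh := (total_field Fhat).

Lemma value_lower_bound (t x : R) (V : Omega -> R) : 0 <= t -> 0 <= x ->
  value P r Fil Fhat t x V ->
  \forall w \ae P, stationary_value r (Fh t ^~ w) x <= expR (r * t) * V w.
Proof.
move=> t0 x0 [_ Vub _].
have Hl : \forall w \ae P, forall l : seq (rat * rat), control_list l ->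
    step_value Fhat r t x l w <= V w.
  apply: ae_forall_count => l.
  have [vl|] := boolP (control_list l); last by move=> _; apply: aeW.
  have : \forall w \ae P, step_value Fhat r t x l w <= V w.
    apply: Vub; exists (step_process t l); first exact: admissible_step_process.
    exact: (step_value_cond_expectation Fil_filtration Fhat_field).
  by apply: filterS => w H _.
have Hm := total_field_nincr_ae Fil_filtration Fhat_field t0.
apply: filterS2 Hl Hm => w Hl Hm.
apply: stationary_value_le => l vl.
rewrite -(ler_pM2l (expR_gt0 (- (r * t)))) mulrA -expRD addNr expR0 mul1r.
apply: le_trans (Hl l vl).
exact: (lower_payoff_le_step_value Fhat_field r_gt0).
Qed.

End value_lower_bound.

(** The threshold is taken nonnegative because the fields are constrained only at nonnegative
    times. *)
Lemma ge0_cvge0P (R : realType) (f : R -> \bar R) : (forall t, 0 <= f t)%E ->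
  f t @[t --> +oo] --> 0%E <->
  forall e : R, 0 < e -> exists2 T : R, 0 <= T & forall t, T <= t -> (f t <= e%:E)%E.
Proof.
move=> f0; split.
  move=> /fine_cvgP[ffin /cvgrPdist_le f_cvg] e e0.
  have /(_ e e0) := f_cvg.
  move=> /(filterI ffin)[T [Treal HT]]; exists (Num.max T 0 + 1).
    by rewrite addr_ge0// le_max lexx orbT.
  move=> t Tt; have Tt' : T < t.
    by rewrite (lt_le_trans _ Tt)// (@le_lt_trans _ _ (Num.max T 0)) ?le_max ?lexx// ltrDl.
  have [ft] := HT t Tt'; rewrite /= sub0r normrN => H.
  rewrite -[leLHS]fineK// lee_fin (le_trans _ H)//; exact: ler_norm.
move=> H; apply/fine_cvgP; split.
  have [T _ HT] := H 1 ltr01; near=> t.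
  rewrite ge0_fin_numE// (@le_lt_trans _ _ 1%E) ?ltry//; apply: HT.
  by near: t; exact: (nbhs_pinfty_ge (num_real T)).
apply/cvgrPdist_le => e e0; have [T _ HT] := H e e0; near=> t.
have fte : (f t <= e%:E)%E.
  by apply: HT; near: t; exact: (nbhs_pinfty_ge (num_real T)).
rewrite /= sub0r normrN ger0_norm ?fine_ge0// -lee_fin fineK//.
by rewrite ge0_fin_numE// (le_lt_trans fte)// ltry.
Unshelve. all: by end_near. Qed.

(** * Almost sure properties of the limit field *)

Section limit_field.
Context (R : realType) (d : measure_display) (Omega : measurableType d).
Variables (P : probability Omega R) (Fil : R -> set (set Omega)).
Hypothesis Fil_filtration : filtration Fil.
Variable X : {RV P >-> R}.
Variable Fhat : R -> R -> Omega -> R.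
Hypothesis Fhat_field : cond_survival_field P Fil X Fhat.
Hypothesis X_ge0 : forall w, 0 <= X w.
Hypothesis X_finite_expectation : ('E_P[X] < +oo)%E.
Variables (Fbar : Omega -> R -> R) (L : R).
Hypothesis Fbar_measurable : measurable_fun
  (setT `*` `[0, +oo[ : set (g_sigma_algebraType (filtration_infty Fil) * R))
  (fun p => Fbar p.1 p.2).
Hypothesis Fbar_gt0 : forall w (x : R), 0 <= x -> 0 < Fbar w x.
Hypothesis L_ge0 : 0 <= L.
Hypothesis Fbar_lipschitz : \forall w \ae P, forall x y : R, 0 <= x -> 0 <= y ->
  `|Fbar w x - Fbar w y| <= L * `|x - y|.

Let gap t := (\int[P]_w ereal_sup
   [set `|Fhat t x w - Fbar w x|%:E | x in `[0%R, +oo[%classic])%E.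
Hypothesis gap_cvg : gap t @[t --> +oo] --> 0%E.

Local Notation mu := (@lebesgue_measure R).
Local Notation Fh := (total_field Fhat).

Let gap_small (e : R) : 0 < e -> exists2 T : R, 0 <= T & forall t, T <= t -> (gap t <= e%:E)%E.
Proof.
have gap_ge0 t : (0 <= gap t)%E.
  apply: integral_ge0 => w _.
  apply: (@le_trans _ _ `|Fhat t 0 w - Fbar w 0|%:E); first by rewrite lee_fin.
  by apply: ereal_sup_ubound; exists 0 => //=; rewrite in_itv/= lexx.
exact: (ge0_cvge0P gap_ge0).1.
Qed.

Lemma measurable_limit_field (x : R) : 0 <= x -> measurable_fun setT (Fbar ^~ x).
Proof.
move=> x0.
have sub : filtration_infty Fil `<=` d.-measurable.
  rewrite /filtration_infty; apply: smallest_sub; first exact: sigma_algebra_measurable.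
  move=> A [t]; rewrite /= in_itv/= andbT => t0.
  by case: Fil_filtration => _ H _; exact: H.
have sI : sigma_algebra setT (filtration_infty Fil).
  exact: smallest_sigma_algebra.
pose g (w : Omega) : g_sigma_algebraType (filtration_infty Fil) * R := (w, x).
have mg : measurable_fun setT g.
  apply/measurable_fun_pair => //; exact: measurable_sub_sigma_id.
have mD : measurable (setT `*` `[0, +oo[ : set (g_sigma_algebraType (filtration_infty Fil) * R)).
  exact: measurableX.
have gD : g @` setT `<=` setT `*` `[0, +oo[.
  by move=> _ [w _ <-]; split=> //=; rewrite in_itv/= x0.
exact: (measurable_comp mD gD Fbar_measurable mg).
Qed.

Let measurable_Fh (t x : R) : 0 <= t -> measurable_fun setT (Fh t x).
Proof.
move=> t0; case: Fil_filtration => sF FT _.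
exact: (sub_sigma_measurable_fun (sF t t0) (FT t t0) (measurable_total_field_at Fhat_field x t0)).
Qed.

Let dist_le_gap (t x : R) : 0 <= t -> 0 <= x ->
  (\int[P]_w `|Fh t x w - Fbar w x|%:E <= gap t)%E.
Proof.
move=> t0 x0; apply: ge0_le_integral_any => w _; first by rewrite lee_fin.
by apply: ereal_sup_ubound; exists x; rewrite /= ?in_itv/= ?x0// total_fieldE.
Qed.

Let measurable_dist (t x : R) : 0 <= t -> 0 <= x ->
  measurable_fun setT (fun w => `|Fh t x w - Fbar w x|%:E).
Proof.
move=> t0 x0; apply/measurable_EFinP; apply: measurableT_comp => //.
by apply: measurable_funB; [exact: measurable_Fh|exact: measurable_limit_field].
Qed.

(** The excess of Fbar over 1 is at most its distance to Fhat T, whose mean is arbitrarily small for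
    a suitable T. *)
Let Fbar_le1_ae : \forall w \ae P, forall q : rat, (0 <= q)%R -> Fbar w (ratr q) <= 1.
Proof.
apply: ae_forall_count => q.
have [q0|] := leP 0 q; last by move=> _; apply: aeW.
have {}q0 : 0 <= ratr q :> R by rewrite ler0q.
have : \forall w \ae P, Num.max (Fbar w (ratr q) - 1) 0 = 0.
  apply: ae_eq0_of_integral.
  - by apply: measurable_maxr => //; apply: measurable_funB => //; exact: measurable_limit_field.
  - by move=> w; rewrite le_max lexx orbT.
  move=> e e0; have [T T0 HT] := gap_small e0.
  apply: (le_trans _ (HT T (lexx _))); apply: le_trans (dist_le_gap T0 q0).
  apply: ge0_le_integral_any => w _; rewrite lee_fin; first by rewrite le_max lexx orbT.
  have /andP[_ f1] := total_field01 Fhat_field T (ratr q) w.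
  rewrite ge_max normr_ge0 andbT distrC; apply: le_trans (ler_norm _); lra.
apply: filterS => w /eqP H _; move: H; rewrite eq_maxr subr_le0 => //.
Qed.

Let Fbar_nincr_ae : \forall w \ae P, forall q : rat * rat, (0 <= q.1)%R -> (q.1 <= q.2)%R ->
  Fbar w (ratr q.2) <= Fbar w (ratr q.1).
Proof.
apply: ae_forall_count => -[q1 q2] /=.
have [q10|] := leP 0 q1; last by move=> _; apply: aeW.
have [q12|] := leP q1 q2; last by move=> _; apply: aeW.
have r1 : 0 <= ratr q1 :> R by rewrite ler0q.
have r12 : ratr q1 <= ratr q2 :> R by rewrite ler_rat.
have r2 : 0 <= ratr q2 :> R by exact: le_trans r12.
have : \forall w \ae P, Num.max (Fbar w (ratr q2) - Fbar w (ratr q1)) 0 = 0.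
  have mM : measurable_fun setT (fun w => Num.max (Fbar w (ratr q2) - Fbar w (ratr q1)) 0).
    by apply: measurable_maxr => //; apply: measurable_funB; exact: measurable_limit_field.
  apply: ae_eq0_of_integral => //.
    by move=> w; rewrite le_max lexx orbT.
  move=> e e0; have e20 : 0 < e / 2 by rewrite divr_gt0.
  have [T T0 HT] := gap_small e20.
  have G1 := le_trans (dist_le_gap T0 r1) (HT T (lexx _)).
  have G2 := le_trans (dist_le_gap T0 r2) (HT T (lexx _)).
  have -> : e%:E = ((e / 2)%:E + (e / 2)%:E)%E by rewrite -EFinD; congr EFin; field.
  apply: (le_trans _ (leeD G2 G1)).
  have M1 := measurable_dist T0 r1; have M2 := measurable_dist T0 r2.
  rewrite -ge0_integralD//.
  (* The field at time T is known to be monotone only almost surely. *)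
  apply: ae_ge0_le_integral => //.
  - by move=> w _; rewrite lee_fin le_max lexx orbT.
  - exact/measurable_EFinP.
  - by move=> w _; rewrite -EFinD lee_fin addr_ge0.
  - exact: emeasurable_funD.
  have := total_field_nincr_ae Fil_filtration Fhat_field T0.
  apply: filterS => w /(_ _ _ r1 r12) H _; rewrite -EFinD lee_fin ge_max addr_ge0// andbT.
  have := ler_norm (- (Fh T (ratr q2) w - Fbar w (ratr q2))); rewrite normrN.
  have := ler_norm (Fh T (ratr q1) w - Fbar w (ratr q1)).
  lra.
apply: filterS => w /eqP H _ _; move: H; rewrite eq_maxr subr_le0 => //.
Qed.

(** Markov's inequality; the finite expectation of X enters here. *)
Let tail_le (c : R) : 0 < c ->
  (\int[P]_w (\1_[set w | c < X w] w)%:E <= (fine 'E_P[X]%E / c)%:E)%E.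
Proof.
move=> c0.
have mA : measurable [set w | c < X w].
  have := @measurable_fun_ltr _ Omega R setT (cst c) X (measurable_cst _) (measurable_funP X) measurableT [set true].
  by rewrite setTI; apply.
have EX0 : (0 <= 'E_P[X])%E by apply: expectation_ge0.
have EXf : 'E_P[X]%E \is a fin_num by rewrite ge0_fin_numE.
have EXE : ('E_P[X] = \int[P]_w (X w)%:E)%E by rewrite unlock.
rewrite mulrC EFinM lee_pdivlMl// fineK// EXE.
have m1 : measurable_fun setT (fun w => (\1_[set w | c < X w] w)%:E : \bar R).
  exact/measurable_EFinP.
rewrite -ge0_integralZl_EFin//; last exact: ltW.
apply: ge0_le_integral_any => w _; rewrite indicE -EFinM lee_fin.
  by rewrite mulr_ge0// ltW.
have [|] := boolP (w \in _); last by rewrite mulr0.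
by rewrite inE/= mulr1 => /ltW.
Qed.

(** An infimum is bounded by any single term, so its mean can be estimated at one well chosen time
    and integer; monotonicity later turns it into the limit at infinity. *)
Let Fbar_inf0_ae : \forall w \ae P, infs (fun k => Num.min (Fbar w k.+1%:R) 1) 0 = 0.
Proof.
have mh k : measurable_fun setT (fun w => Num.min (Fbar w k.+1%:R) 1).
  by apply: measurable_minr => //; exact: measurable_limit_field.
have h0 k w : 0 <= Num.min (Fbar w k.+1%:R) 1.
  by rewrite le_min ler01 andbT ltW// Fbar_gt0.
have lb w : has_lbound (range (fun k => Num.min (Fbar w k.+1%:R) 1)).
  by exists 0 => _ [k _ <-].
have lb0 w : has_lbound (sdrop (fun k => Num.min (Fbar w k.+1%:R) 1) 0).
  by exists 0 => _ [k _ <-].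
apply: ae_eq0_of_integral.
- by apply: measurable_fun_infs => // w _; exact: lb.
- move=> w; apply: lb_le_inf; first by exists (Num.min (Fbar w 1) 1), 0%N.
  by move=> _ [k _ <-].
move=> e e0; have e20 : 0 < e / 2 by rewrite divr_gt0.
have [T T0 HT] := gap_small e20.
pose m := fine 'E_P[X]%E.
have m0 : 0 <= m by rewrite fine_ge0// expectation_ge0.
(* Chosen so that the Markov bound m / (k + 1) is at most e / 2. *)
pose k := Num.truncn (m / (e / 2)).
have k0 : 0 <= k.+1%:R :> R by [].
have mk : m / k.+1%:R <= e / 2.
  rewrite ler_pdivrMr// mulrC -ler_pdivrMr// ltW//.
  have /truncn_itv/andP[_ //] : 0 <= m / (e / 2) by rewrite divr_ge0// ltW.
apply: (@le_trans _ _ (\int[P]_w ((Fh T k.+1%:R w)%:E + `|Fh T k.+1%:R w - Fbar w k.+1%:R|%:E))%E).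
  apply: ge0_le_integral_any => w _.
    rewrite lee_fin; apply: lb_le_inf; first by exists (Num.min (Fbar w 1) 1), 0%N.
    by move=> _ [j _ <-].
  rewrite -EFinD lee_fin; apply: (@le_trans _ _ (Num.min (Fbar w k.+1%:R) 1)).
    by apply: ge_inf => //; exists k.
  apply: (@le_trans _ _ (Fbar w k.+1%:R)); first by rewrite ge_min lexx.
  by have := ler_norm (- (Fh T k.+1%:R w - Fbar w k.+1%:R)); rewrite normrN; lra.
have M1 := measurable_dist T0 k0.
have M2 : measurable_fun setT (fun w => (Fh T k.+1%:R w)%:E).
  by apply/measurable_EFinP; exact: measurable_Fh.
rewrite ge0_integralD//; last first.
  by move=> w _; rewrite lee_fin; have /andP[] := total_field01 Fhat_field T k.+1%:R w.
have -> : e%:E = ((e / 2)%:E + (e / 2)%:E)%E by rewrite -EFinD; congr EFin; field.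
apply: leeD; last exact: le_trans (dist_le_gap T0 k0) (HT T (lexx _)).
have [_ _ _ ->] := total_field_cond Fhat_field T0 k0.
  by apply: (le_trans (tail_le _)) => //; rewrite lee_fin.
by case: Fil_filtration => sF _ _; rewrite -(sub_sigma_measurableE (sF T T0)).
Qed.

(** Together with positivity, these are the properties that the deterministic problem and its
    solution at infinity ask of a field. *)
Definition limit_survival w : Prop :=
  [/\ forall x : R, 0 <= x -> Fbar w x <= 1,
      forall x y : R, 0 <= x -> x <= y -> Fbar w y <= Fbar w x,
      forall x y : R, 0 <= x -> 0 <= y -> `|Fbar w x - Fbar w y| <= L * `|x - y| &
      Fbar w x @[x --> +oo] --> 0].

Let rat_right (x e : R) : 0 < e -> exists q : rat, x < ratr q < x + e.
Proof.
move=> e0; have [q] : exists q, ratr q \in `]x, (x + e)[ by apply: rat_in_itvoo; rewrite ltrDl.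
by rewrite in_itv/= => H; exists q.
Qed.

Lemma limit_survival_ae : \forall w \ae P, limit_survival w.
Proof.
apply: filterS2 (filterI Fbar_le1_ae Fbar_nincr_ae) (filterI Fbar_inf0_ae Fbar_lipschitz).
move=> w [Hle1 Hnincr] [Hinf Hlip].
(* The Lipschitz bound carries the statements at rational points over to all points. *)
have approx (x e : R) : 0 <= x -> 0 < e -> exists q : rat, [/\ x < ratr q, ratr q < x + e,
    (0 <= q)%R & `|Fbar w x - Fbar w (ratr q)| <= e].
  move=> x0 e0; have L1 : 0 < L + 1 by rewrite ltr_wpDl.
  have d0 : 0 < Num.min e (e / (L + 1)) by rewrite lt_min e0 divr_gt0.
  have [q /andP[xq qx]] := rat_right x d0.
  have q0 : 0 <= ratr q :> R by rewrite (le_trans x0)// ltW.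
  exists q; split=> //.
  - by rewrite (lt_le_trans qx)// lerD2l ge_min lexx.
  - by rewrite -(ler0q R).
  apply: (le_trans (Hlip _ _ x0 q0)); rewrite distrC ger0_norm ?subr_ge0 ?ltW//.
  have : ratr q - x < e / (L + 1).
    by rewrite ltrBlDl (lt_le_trans qx)// lerD2l ge_min lexx orbT.
  rewrite ltr_pdivlMr//; have : 0 <= ratr q - x by rewrite subr_ge0 ltW.
  lra.
have H1 x : 0 <= x -> Fbar w x <= 1.
  move=> x0; apply/ler_addgt0Pr => e e0; have [q [_ _ q0]] := approx x e x0 e0.
  have := Hle1 q q0; have := ler_norm (Fbar w x - Fbar w (ratr q)); lra.
have H2 x y : 0 <= x -> x <= y -> Fbar w y <= Fbar w x.
  move=> x0; rewrite le_eqVlt => /predU1P[->//|xy].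
  apply/ler_addgt0Pr => e e0; have e20 : 0 < e / 2 by rewrite divr_gt0.
  have dxy : 0 < Num.min (e / 2) (y - x) by rewrite lt_min e20 subr_gt0.
  have [q [_ qy q0 Hq]] := approx x _ x0 dxy.
  have [q' [yq' _ q'0 Hq']] := approx y _ (le_trans x0 (ltW xy)) e20.
  have qq' : (q <= q')%R.
    rewrite -(ler_rat R) (le_trans _ (ltW yq'))// (le_trans (ltW qy))//.
    have : Num.min (e / 2) (y - x) <= y - x by rewrite ge_min lexx orbT.
    lra.
  have := Hnincr (q, q') q0 qq'; rewrite /=.
  have : Num.min (e / 2) (y - x) <= e / 2 by rewrite ge_min lexx.
  move: Hq Hq'; rewrite !ler_norml => /andP[? ?] /andP[? ?]; lra.
split=> //.
apply/cvgrPdist_le => e e0.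
(* A threshold below 1 ensures that the small term of the sequence is Fbar itself and not the cap
   1. *)
have [k Hk] : exists k, Fbar w k.+1%:R <= Num.min e 2^-1.
  have m0 : 0 < Num.min e 2^-1 by rewrite lt_min e0 invr_gt0 ltr0n.
  have hI : has_inf (sdrop (fun k => Num.min (Fbar w k.+1%:R) 1) 0).
    split; first by exists (Num.min (Fbar w 1) 1), 0%N.
    by exists 0 => _ [k _ <-]; rewrite le_min ler01 andbT ltW// Fbar_gt0.
  have [_ [k _ <-]] := inf_adherent m0 hI.
  rewrite -[inf _]/(infs (fun k => Num.min (Fbar w k.+1%:R) 1) 0) Hinf add0r.
  rewrite gt_min => /orP[/ltW H|]; first by exists k.
  by rewrite lt_min => /andP[_]; lra.
near=> y.
have ky : k.+1%:R <= y by near: y; exact: (nbhs_pinfty_ge (num_real _)).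
have y0 : 0 <= y by exact: le_trans ky.
rewrite sub0r normrN gtr0_norm ?Fbar_gt0//.
apply: (le_trans (H2 _ _ _ ky)) => //; apply: (le_trans Hk).
by rewrite ge_min lexx.
Unshelve. all: by end_near. Qed.

End limit_field.

(** * Asymptotics of the value *)

(** Each payoff involves the field at finitely many fixed points, and the supremum is over a
    countable type. *)
Lemma measurable_stationary_value (R : realType) d (T : measurableType d) (r x : R)
    (phi : T -> R -> R) : 0 < r -> 0 <= x ->
  (forall y, measurable_fun setT (phi ^~ y)) ->
  (forall w (y : R), 0 <= y -> 0 <= phi w y <= 1) ->
  measurable_fun setT (fun w => stationary_value r (phi w) x).
Proof.
move=> r0 x0 mphi phi01.
apply: (@measurable_sup_count _ _ _ _ [::] control_list _ (1 / (4 * r))) => //.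
- move=> l; elim: l x {x0} => [|c l IH] x /=; first exact: measurable_cst.
  apply: measurable_funM => //; apply: measurable_funD => //.
  by apply: measurable_funM => //; exact: measurable_funM.
- move=> l w vl; apply: lower_payoff_le => // z z0.
  by apply: phi01; exact: addr_ge0.
Qed.

(** * Pathwise upper bound for the rewards *)

Section upper_bound.
Context (R : realType) (d : measure_display) (Omega : measurableType d).
Variables (P : probability Omega R) (Fil : R -> set (set Omega)).
Hypothesis Fil_filtration : filtration Fil.
Variable X : {RV P >-> R}.
Variable Fhat : R -> R -> Omega -> R.
Hypothesis Fhat_field : cond_survival_field P Fil X Fhat.
Variables (Fbar : Omega -> R -> R) (L : R).
Hypothesis Fbar_measurable : measurable_fun
  (setT `*` `[0, +oo[ : set (g_sigma_algebraType (filtration_infty Fil) * R))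
  (fun p => Fbar p.1 p.2).
Hypothesis Fbar_gt0 : forall w (x : R), 0 <= x -> 0 < Fbar w x.
Hypothesis L_ge0 : 0 <= L.
Variable r : R.
Hypothesis r_gt0 : 0 < r.

Local Notation mu := (@lebesgue_measure R).
Local Notation Fh := (total_field Fhat).

Let Fh01 (s x : R) w : 0 <= Fh s x w <= 1.
Proof. exact: total_field01 Fhat_field s x w. Qed.

(* Agrees almost surely with Fbar, but is bounded and defined everywhere. *)
Definition truncated_limit (w : Omega) (x : R) := Num.min (Fbar w (Num.max x 0)) 1.
Local Notation Fb := truncated_limit.

Lemma truncated_limit_gt0 w x : 0 < Fb w x.
Proof. by rewrite lt_min ltr01 andbT Fbar_gt0// le_max lexx orbT. Qed.

Lemma truncated_limit_le1 w x : Fb w x <= 1.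
Proof. by rewrite ge_min lexx orbT. Qed.

Let Fb01 w x : 0 <= Fb w x <= 1.
Proof. by rewrite ltW ?truncated_limit_gt0// truncated_limit_le1. Qed.

Lemma truncated_limitE w (x : R) : limit_survival Fbar L w -> 0 <= x ->
  Fb w x = Fbar w x.
Proof. by move=> [H _ _ _] x0; rewrite /Fb max_l// min_l// H. Qed.

Lemma truncated_limit_nincr w (x y : R) : limit_survival Fbar L w -> 0 <= x -> x <= y ->
  Fb w y <= Fb w x.
Proof.
move=> lw x0 xy; rewrite !truncated_limitE//; last exact: le_trans xy.
by case: lw => _ H _ _; exact: H.
Qed.

Lemma truncated_limit_lip w (x y : R) : limit_survival Fbar L w -> 0 <= x -> 0 <= y ->
  `|Fb w x - Fb w y| <= L * `|x - y|.
Proof.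
by move=> lw x0 y0; rewrite !truncated_limitE//; case: lw => _ _ H _; exact: H.
Qed.

Lemma measurable_truncated_limit (x : R) : measurable_fun setT (Fb ^~ x).
Proof.
apply: measurable_minr => //; apply: (measurable_limit_field Fil_filtration Fbar_measurable).
by rewrite le_max lexx orbT.
Qed.

(** Restricting the supremum to rational points makes it jointly measurable in time and outcome. *)
Definition field_distance (p : R * Omega) : R :=
  sup [set `|Fh p.1 (ratr q) p.2 - Fb p.2 (ratr q)| | q in (fun q : rat => 0 <= q)].
Local Notation Delta := field_distance.

Let dist_le1 (s x : R) w : `|Fh s x w - Fb w x| <= 1.
Proof.
have /andP[a0 a1] := Fh01 s x w; have /andP[b0 b1] := Fb01 w x.
by rewrite ler_norml; apply/andP; split; lra.
Qed.

Lemma field_distance_le1 p : Delta p <= 1.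
Proof.
apply: ge_sup; first by exists (`|Fh p.1 (ratr 0) p.2 - Fb p.2 (ratr 0)|), 0 => //=.
by move=> _ [q _ <-].
Qed.

Let Delta_ub p (q : rat) : (0 <= q)%R ->
  `|Fh p.1 (ratr q) p.2 - Fb p.2 (ratr q)| <= Delta p.
Proof.
move=> q0; apply: sup_ubound; last by exists q.
by exists 1 => _ [q' _ <-].
Qed.

Lemma field_distance_ge0 p : 0 <= Delta p.
Proof. exact: le_trans (Delta_ub p (lexx 0)). Qed.

Lemma measurable_field_distance : measurable_fun setT Delta.
Proof.
apply: (@measurable_sup_count _ _ _ _ 0 _ _ 1) => //.
move=> q; apply: measurableT_comp => //; apply: measurable_funB.
  exact: (measurable_total_field Fil_filtration Fhat_field).
exact: (measurableT_comp (measurable_truncated_limit _) measurable_snd).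
Qed.

(** A rational point just to the right of y serves both fields, one being right-continuous and the
    other Lipschitz. *)
Lemma le_field_distance (s y : R) w : limit_survival Fbar L w -> 0 <= y ->
  `|Fh s y w - Fb w y| <= Delta (s, w).
Proof.
move=> lw y0; apply/ler_addgt0Pr => e e0; have e20 : 0 < e / 2 by rewrite divr_gt0.
have c1 : Fh s z w @[z --> y^'+] --> Fh s y w by exact: (total_field_right_continuous Fhat_field).
have /cvgrPdist_le/(_ _ e20)/nbhs_ballP[dl/= dl0 Hd] := c1.
have L1 : 0 < L + 1 by rewrite ltr_wpDl.
have d0 : 0 < Num.min dl (e / 2 / (L + 1)) by rewrite lt_min dl0 divr_gt0.
have [q] : exists q, ratr q \in `]y, (y + Num.min dl (e / 2 / (L + 1)))[.
  by apply: rat_in_itvoo; rewrite ltrDl.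
rewrite in_itv/= -ltrBlDl lt_min => /and3P[yq qd qL].
have q0 : 0 <= ratr q :> R by rewrite (le_trans y0)// ltW.
have H1 : `|Fh s y w - Fh s (ratr q) w| <= e / 2.
  by apply: Hd => //; rewrite /ball/= distrC gtr0_norm ?subr_gt0.
have H2 : `|Fb w (ratr q) - Fb w y| <= e / 2.
  apply: (le_trans (truncated_limit_lip lw q0 y0)).
  rewrite gtr0_norm ?subr_gt0//; move: qL; rewrite ltr_pdivlMr//.
  have : 0 < ratr q - y by rewrite subr_gt0.
  lra.
have H3 : `|Fh s (ratr q) w - Fb w (ratr q)| <= Delta (s, w).
  by apply: (Delta_ub (s, w)); rewrite -(ler0q R).
have -> : Fh s y w - Fb w y = (Fh s y w - Fh s (ratr q) w)
  + (Fh s (ratr q) w - Fb w (ratr q)) + (Fb w (ratr q) - Fb w y) by ring.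
apply: (le_trans (ler_normD _ _)); have := ler_normD (Fh s y w - Fh s (ratr q) w)
  (Fh s (ratr q) w - Fb w (ratr q)).
lra.
Qed.

(** Capping Fbar at 1 only brings it closer to Fhat, which is at most 1. The comparison is made
    without measurability, which is not known for the supremum on the right. *)
Lemma integral_field_distance_le (s : R) : 0 <= s ->
  (\int[P]_w (Delta (s, w))%:E <= \int[P]_w ereal_sup
   [set `|Fhat s x w - Fbar w x|%:E | x in `[0%R, +oo[%classic])%E.
Proof.
move=> s0; apply: ge0_le_integral_any => w _; first by rewrite lee_fin field_distance_ge0.
set S := ereal_sup _.
have HS (q : rat) : (0 <= q)%R -> (`|Fh s (ratr q) w - Fb w (ratr q)|%:E <= S)%E.
  move=> q0; have r0 : 0 <= ratr q :> R by rewrite ler0q.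
  apply: (@le_trans _ _ `|Fhat s (ratr q) w - Fbar w (ratr q)|%:E); last first.
    by apply: ereal_sup_ubound; exists (ratr q) => //=; rewrite in_itv/= r0.
  rewrite lee_fin total_fieldE// /Fb max_l//.
  have /andP[_] := Fh01 s (ratr q) w; rewrite total_fieldE// => f1.
  have [//|b1] := leP (Fbar w (ratr q)) 1.
  rewrite !ler0_norm; lra.
case E : S => [c| |]; last 2 first.
- by rewrite leey.
- by have := HS 0 (lexx _); rewrite E.
rewrite lee_fin; apply: ge_sup.
  by exists (`|Fh s (ratr 0) w - Fb w (ratr 0)|), 0 => //=.
by move=> _ [q q0 <-]; rewrite -lee_fin -E; exact: HS.
Qed.

Definition tail_distance (t : R) (w : Omega) : \bar R :=
  (\int[mu]_(s in `[t, +oo[) (expR (- (r * s)) * Delta (s, w))%:E)%E.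

Lemma tail_distance_bounds (t : R) w :
  (0 <= tail_distance t w <= (expR (- (r * t)) / r)%:E)%E.
Proof.
have I0 s : 0 <= expR (- (r * s)) * Delta (s, w).
  by rewrite mulr_ge0 ?expR_ge0 ?field_distance_ge0.
rewrite integral_ge0/=; last by move=> s _; rewrite lee_fin.
rewrite -integral_expRN//; apply: ge0_le_integral_any => s _; rewrite lee_fin//.
by rewrite ler_piMr ?expR_ge0// field_distance_le1.
Qed.

Lemma tail_distance_fin (t : R) w : tail_distance t w \is a fin_num.
Proof.
have /andP[t0 tC] := tail_distance_bounds t w.
by rewrite ge0_fin_numE// (le_lt_trans tC)// ltry.
Qed.

Let measurable_tail_integrand :
  measurable_fun setT (fun p : R * Omega => (expR (- (r * p.1)) * Delta p)%:E).
Proof.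
apply/measurable_EFinP; apply: measurable_funM; last exact: measurable_field_distance.
by apply: measurableT_comp => //; apply: measurable_funN; exact: measurable_funM.
Qed.

Let tail_integrand_ge0 (p : R * Omega) : (0 <= (expR (- (r * p.1)) * Delta p)%:E)%E.
Proof. by rewrite lee_fin mulr_ge0 ?expR_ge0 ?field_distance_ge0. Qed.

Lemma measurable_tail_distance (t : R) : measurable_fun setT (tail_distance t).
Proof. exact: (measurable_time_integral t measurable_tail_integrand tail_integrand_ge0). Qed.

Lemma integral_tail_distance_le (t e : R) : 0 <= t -> 0 <= e ->
  (forall s, t <= s -> (\int[P]_w (Delta (s, w))%:E <= e%:E)%E) ->
  (\int[P]_w tail_distance t w <= (expR (- (r * t)) / r * e)%:E)%E.
Proof.
move=> t0 e0 He.
rewrite -(tonelli_time P t measurable_tail_integrand tail_integrand_ge0 measurableT).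
have me : measurable_fun `[t, +oo[ (fun s : R => (expR (- (r * s)))%:E).
  apply/measurable_EFinP; apply: measurable_funTS; apply: measurableT_comp => //.
  by apply: measurable_funN; exact: measurable_funM.
apply: (@le_trans _ _ (\int[mu]_(s in `[t, +oo[) (e%:E * (expR (- (r * s)))%:E))%E).
  apply: ge0_le_integral_any => s /=; rewrite in_itv/= andbT => ts.
    by apply: integral_ge0 => w _; exact: (tail_integrand_ge0 (s, w)).
  under eq_integral do rewrite EFinM.
  rewrite ge0_integralZl_EFin ?expR_ge0//; last 2 first.
  - by move=> w _; rewrite lee_fin field_distance_ge0.
  - apply/measurable_EFinP.
    exact: (measurableT_comp measurable_field_distance (pair1_measurable s)).
  by rewrite muleC; apply: lee_wpmul2r; [rewrite lee_fin expR_ge0|exact: He].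
rewrite ge0_integralZl_EFin//.
by rewrite integral_expRN// -EFinM mulrC.
Qed.

Definition limit_value w (x : R) := stationary_value r (Fb w) x.

Lemma limit_value_distance (t x : R) w : limit_survival Fbar L w -> 0 <= x ->
  `|stationary_value r (Fh t ^~ w) x - limit_value w x| <= Delta (t, w) / (4 * r).
Proof.
move=> lw x0; apply: stationary_value_stable => // z z0.
by apply: le_field_distance => //; exact: addr_ge0.
Qed.

(** For a fixed outcome verification bounds the payoff against Fbar of any measurable control, even
    one that anticipates Fbar; replacing Fhat by Fbar costs at most the discounted distance, as a (1
    - a) <= 1. *)
Lemma reward_upper_bound (t x : R) (a : R -> Omega -> R) w : 0 <= t -> 0 <= x ->
  admissible Fil a -> limit_survival Fbar L w ->
  reward r Fhat a t x w <=
    expR (- (r * t)) * limit_value w x + fine (tail_distance t w).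
Proof.
move=> t0 x0 [pa a01] lw.
pose al s := a (Num.max s 0) w.
have mal : measurable_fun setT al.
  have := progressively_measurable_total Fil_filtration pa.
  by move=> H; exact: (measurableT_comp H (pair2_measurable w)).
have al01 u : 0 <= al u <= 1 by apply: a01; rewrite le_max lexx orbT.
have stE s : t <= s -> controlled_state a t x s w = x + \int[mu]_(u in `[t, s]) al u.
  move=> ts; congr (_ + _); apply: eq_Rintegral => u; rewrite inE/= in_itv/= => /andP[tu _].
  by rewrite /al max_l// (le_trans t0).
have st0 s : 0 <= x + \int[mu]_(u in `[t, s]) al u.
  by rewrite addr_ge0// Rintegral_ge0// => u _; have /andP[] := al01 u.
have F0 y : 0 <= y -> 0 < Fb w y by move=> _; exact: truncated_limit_gt0.
have F1 y : 0 <= y -> Fb w y <= 1 by move=> _; exact: truncated_limit_le1.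
have Fn (y z : R) : 0 <= y -> y <= z -> Fb w z <= Fb w y by exact: truncated_limit_nincr.
have Fl (y z : R) : 0 <= y -> 0 <= z -> `|Fb w y - Fb w z| <= L * `|y - z|.
  exact: truncated_limit_lip.
pose g s := Fb w (x + \int[mu]_(u in `[t, s]) al u) * expR (- (r * s)) *
  (al s * (1 - al s)).
have Hv : (\int[mu]_(s in `[t, +oo[) (g s)%:E <=
    (expR (- (r * t)) * limit_value w x)%:E)%E.
  exact: (verification_upper r_gt0 F0 F1 Fn L_ge0 Fl mal al01 t0 x0).
have mv : measurable_fun `[t, +oo[ g.
  exact: (measurable_controlled_payoff r Fl mal al01 t0 x0).
have g0 s : 0 <= g s.
  have /andP[b0 _] : 0 <= al s * (1 - al s) <= 4^-1.
    by have /andP[? ?] := al01 s; exact: onem_bound.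
  by rewrite /g mulr_ge0// mulr_ge0 ?expR_ge0// ltW// truncated_limit_gt0.
have mt : measurable_fun `[t, +oo[ (fun s => (expR (- (r * s)) * Delta (s, w))%:E).
  apply: measurable_funTS.
  exact: (measurableT_comp measurable_tail_integrand (pair2_measurable w)).
have rew0 s : t <= s -> (0 <= Fhat s (controlled_state a t x s w) w * expR (- (r * s)) *
     (a s w * (1 - a s w)) <= g s + expR (- (r * s)) * Delta (s, w)).
  move=> ts; have s0 : 0 <= s by exact: le_trans ts.
  rewrite stE// -(total_fieldE Fhat w s0 (st0 s)).
  have alE : a s w = al s by rewrite /al max_l.
  rewrite alE; have /andP[a0 a1] := al01 s; have /andP[b0 b1] := onem_bound a0 a1.
  set y := x + _; have y0 : 0 <= y by exact: st0.
  have /andP[f0 f1] := Fh01 s y w.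
  have E0 : 0 <= expR (- (r * s)) by exact: expR_ge0.
  rewrite (mulr_ge0 (mulr_ge0 f0 E0) b0)/=; have := le_field_distance s lw y0.
  rewrite ler_norml => /andP[_ H].
  have D0 := field_distance_ge0 (s, w).
  rewrite /g -/y.
  have H1 : Fh s y w * expR (- (r * s)) * (al s * (1 - al s)) <=
    (Fb w y + Delta (s, w)) * expR (- (r * s)) * (al s * (1 - al s)).
    by apply: ler_wpM2r => //; apply: ler_wpM2r => //; lra.
  apply: (le_trans H1); rewrite !mulrDl lerD2l [Delta _ * _]mulrC.
  by rewrite ler_piMr ?mulr_ge0//; lra.
suff : ((reward r Fhat a t x w)%:E <=
    (expR (- (r * t)) * limit_value w x)%:E + tail_distance t w)%E.
  by rewrite -[X in (_ <= _ + X)%E](fineK (tail_distance_fin t w)) -EFinD lee_fin.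
have Hle : (\int[mu]_(s in `[t, +oo[) (Fhat s (controlled_state a t x s w) w * expR (- (r * s)) *
     (a s w * (1 - a s w)))%:E <= (expR (- (r * t)) * limit_value w x)%:E + tail_distance t w)%E.
  apply: (@le_trans _ _ (\int[mu]_(s in `[t, +oo[) ((g s)%:E + (expR (- (r * s)) * Delta (s, w))%:E))%E).
    apply: ge0_le_integral_any => s /=; rewrite in_itv/= andbT => /rew0/andP[? ?].
      by rewrite lee_fin.
    by rewrite -EFinD lee_fin.
  rewrite ge0_integralD//; last 3 first.
  - by move=> s _; rewrite lee_fin.
  - exact/measurable_EFinP.
  - by move=> s _; exact: (tail_integrand_ge0 (s, w)).
  exact: leeD.
rewrite /reward /Rintegral fineK//.
rewrite ge0_fin_numE; last first.
  by apply: integral_ge0 => s /=; rewrite in_itv/= andbT => /rew0/andP[? _]; rewrite lee_fin.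
by rewrite (le_lt_trans Hle)// -(fineK (tail_distance_fin t w)) -EFinD ltry.
Qed.

End upper_bound.

Lemma integrableD_EFin d (T : measurableType d) (R : realType)
    (mu : {measure set T -> \bar R}) (D : set T) (f g : T -> R) :
  measurable D -> mu.-integrable D (EFin \o f) -> mu.-integrable D (EFin \o g) ->
  mu.-integrable D (EFin \o (fun u => f u + g u)).
Proof.
move=> mD intf intg; have := integrableD mD intf intg.
by rewrite (_ : (_ \+ _)%E = EFin \o (fun u => f u + g u)).
Qed.

Lemma integralD_real d (T : measurableType d) (R : realType)
    (mu : {measure set T -> \bar R}) (D : set T) (f g : T -> R) :
  measurable D -> mu.-integrable D (EFin \o f) -> mu.-integrable D (EFin \o g) ->
  (\int[mu]_(u in D) (f u + g u)%:E =
   \int[mu]_(u in D) (f u)%:E + \int[mu]_(u in D) (g u)%:E)%E.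
Proof. by move=> mD intf intg; exact: (integralD mD intf intg). Qed.

(** * Two-sided estimate of the value in mean *)

Section value_asymptotics.
Context (R : realType) (d : measure_display) (Omega : measurableType d).
Variables (P : probability Omega R) (Fil : R -> set (set Omega)).
Hypothesis Fil_filtration : filtration Fil.
Variable X : {RV P >-> R}.
Variable Fhat : R -> R -> Omega -> R.
Hypothesis Fhat_field : cond_survival_field P Fil X Fhat.
Variables (Fbar : Omega -> R -> R) (L : R).
Hypothesis Fbar_measurable : measurable_fun
  (setT `*` `[0, +oo[ : set (g_sigma_algebraType (filtration_infty Fil) * R))
  (fun p => Fbar p.1 p.2).
Hypothesis Fbar_gt0 : forall w (x : R), 0 <= x -> 0 < Fbar w x.
Hypothesis L_ge0 : 0 <= L.
Hypothesis good_ae : \forall w \ae P, limit_survival Fbar L w.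
Variable r : R.
Hypothesis r_gt0 : 0 < r.
Variables (t x : R) (V : Omega -> R).
Hypotheses (t0 : 0 <= t) (x0 : 0 <= x).
Hypothesis V_value : value P r Fil Fhat t x V.

Local Notation Fh := (total_field Fhat).
Local Notation TG := (g_sigma_algebraType (Fil t)).
Local Notation Delta := (field_distance Fhat Fbar).
Local Notation B := (tail_distance Fhat Fbar r t).
Local Notation E := (expR (- (r * t))).

Let sF : sigma_algebra setT (Fil t).
Proof. by case: Fil_filtration => H _ _; exact: H. Qed.

Let FT : Fil t `<=` d.-measurable.
Proof. by case: Fil_filtration => _ H _; exact: H. Qed.

Let frozen w := stationary_value r (Fh t ^~ w) x.

Let Fh01 w (y : R) : 0 <= y -> 0 <= Fh t y w <= 1.
Proof. by move=> _; exact: (total_field01 Fhat_field). Qed.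

Let frozen_bounds w : 0 <= frozen w <= 1 / (4 * r).
Proof.
rewrite stationary_value_ge0//=; last by move=> y; exact: Fh01.
apply: stationary_value_le => l vl; apply: lower_payoff_le => // z z0.
by apply: Fh01; exact: addr_ge0.
Qed.

Let measurable_frozenG : measurable_fun setT (frozen : TG -> R).
Proof.
apply: (measurable_stationary_value (phi := fun (w : TG) y => Fh t y w)) => //.
by move=> y; exact: (measurable_total_field_at Fhat_field).
Qed.

Let measurable_frozen : measurable_fun setT frozen.
Proof. exact: (sub_sigma_measurable_fun sF FT measurable_frozenG). Qed.

Let integrable_frozen : P.-integrable setT (EFin \o frozen).
Proof.
apply: (@bounded_integrable_probability _ _ _ P frozen (1 / (4 * r))) => // w.
by have /andP[f0 f1] := frozen_bounds w; rewrite ger0_norm.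
Qed.

Let measurable_Delta : measurable_fun setT (fun w => Delta (t, w)).
Proof.
exact: (measurableT_comp (measurable_field_distance Fil_filtration Fhat_field Fbar_measurable Fbar_gt0)
  (pair1_measurable t)).
Qed.

Let Delta_bounds w : 0 <= Delta (t, w) <= 1.
Proof.
by rewrite (field_distance_ge0 Fhat_field Fbar_gt0)/= (field_distance_le1 Fhat_field Fbar_gt0).
Qed.

(* e^{rt} error bounds the effect on the payoff of freezing the field at t. *)
Let error w := fine (B w) + E * (Delta (t, w) / (4 * r)).

Let measurable_B : measurable_fun setT B.
Proof. exact: (measurable_tail_distance Fil_filtration Fhat_field Fbar_measurable Fbar_gt0). Qed.

Let B_bounds w : (0 <= B w <= (E / r)%:E)%E.
Proof. exact: (tail_distance_bounds Fhat_field Fbar_gt0 r_gt0). Qed.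

Let B_fin w : B w \is a fin_num.
Proof. exact: (tail_distance_fin Fhat_field Fbar_gt0 r_gt0). Qed.

Let measurable_error : measurable_fun setT error.
Proof.
apply: measurable_funD; first exact: (measurableT_comp (fine_measurable measurableT) measurable_B).
by apply: measurable_funM => //; exact: measurable_funM.
Qed.

Let error_ge0 w : 0 <= error w.
Proof.
have /andP[D0 _] := Delta_bounds w; have /andP[B0 _] := B_bounds w.
by rewrite addr_ge0 ?fine_ge0// mulr_ge0 ?expR_ge0// divr_ge0// mulr_ge0// ltW.
Qed.

Let integrable_error : P.-integrable setT (EFin \o error).
Proof.
apply: (@bounded_integrable_probability _ _ _ P error (E / r + E * (1 / (4 * r)))) => // w.
rewrite ger0_norm//; apply: lerD.
  by have /andP[_] := B_bounds w; rewrite -[X in (X <= _)%E](fineK (B_fin w)) lee_fin.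
rewrite ler_pM2l ?expR_gt0// ler_pM2r ?invr_gt0 ?mulr_gt0//.
by have /andP[] := Delta_bounds w.
Qed.

Lemma value_upper_bound : exists C : Omega -> R,
  [/\ cond_expectation P (Fil t) error C &
      \forall w \ae P, V w <= E * frozen w + C w].
Proof.
have [C HC] := cond_expectation_exists sF FT integrable_error.
have [_ iC mC EC] := HC; exists C; split=> //.
have mCT := sub_sigma_measurable_fun sF FT mC.
pose Z w := E * frozen w + C w.
have mZG : measurable_fun setT (Z : TG -> R).
  by apply: measurable_funD => //; exact: measurable_funM.
have mZ : measurable_fun setT Z by exact: (sub_sigma_measurable_fun sF FT mZG).
have iE : P.-integrable setT (EFin \o (fun w => E * frozen w)).
  exact: integrableZl_EFin.
have iZ : P.-integrable setT (EFin \o Z) by exact: integrableD_EFin.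
case: V_value => _ _ /(_ (EFin \o Z)) H.
have : \forall w \ae P, ((V w)%:E <= (EFin \o Z) w)%E; last first.
  by apply: filterS => w; rewrite lee_fin.
apply: H; first exact/measurable_EFinP.
move=> Y [a aA [irew iY mY EY]].
have : \forall w \ae P, Y w <= Z w; last by apply: filterS => w; rewrite /= lee_fin.
apply: (ae_le_of_integral sF FT iY iZ mY mZG) => A FA.
have mA : measurable A := FT FA.
have sub (f : Omega -> \bar R) : P.-integrable setT f -> P.-integrable A f.
  exact: integrableS.
rewrite EY//.
have -> : (\int[P]_(w in A) (Z w)%:E = \int[P]_(w in A) (E * frozen w + error w)%:E)%E.
  have iEA := sub _ iE.
  rewrite (integralD_real mA iEA (sub _ iC)) EC//.
  by rewrite (integralD_real mA iEA (sub _ integrable_error)).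
have iS : P.-integrable setT (EFin \o (fun w => E * frozen w + error w)).
  exact: integrableD_EFin.
have [pa a01] := aA.
apply: ae_ge0_le_integral => //.
- move=> w _; rewrite lee_fin; apply: Rintegral_ge0 => s /=.
  rewrite in_itv/= andbT => ts; have s0 : 0 <= s by exact: le_trans ts.
  have st0 : 0 <= controlled_state a t x s w.
    rewrite addr_ge0// Rintegral_ge0// => u /=; rewrite in_itv/= => /andP[tu _].
    by have /andP[] := a01 u w (le_trans t0 tu).
  rewrite -(total_fieldE Fhat w s0 st0).
  have /andP[f0 _] := total_field01 Fhat_field s (controlled_state a t x s w) w.
  have /andP[? ?] := a01 s w s0.
  have /andP[b0 _] : 0 <= a s w * (1 - a s w) <= 4^-1 by exact: onem_bound.
  by rewrite mulr_ge0// mulr_ge0// expR_ge0.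
- by apply: measurable_funTS; exact: (measurable_int _ irew).
- move=> w _; rewrite lee_fin addr_ge0//.
  by rewrite mulr_ge0 ?expR_ge0//; have /andP[] := frozen_bounds w.
- by apply: measurable_funTS; exact: (measurable_int _ iS).
apply: filterS good_ae => w gw _; rewrite lee_fin.
apply: (le_trans (reward_upper_bound Fil_filtration Fhat_field Fbar_measurable
  Fbar_gt0 L_ge0 r_gt0 t0 x0 aA gw)).
have := limit_value_distance Fhat_field Fbar_gt0 L_ge0 r_gt0 t gw x0.
rewrite ler_norml => /andP[H1 _].
have H2 : E * limit_value Fbar r w x <= E * (frozen w + Delta (t, w) / (4 * r)).
  by rewrite ler_pM2l ?expR_gt0//; move: H1; rewrite /frozen; lra.
by move: H2; rewrite /error; lra.
Qed.

Lemma measurable_limit_value : measurable_fun setT (fun w => limit_value Fbar r w x).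
Proof.
apply: measurable_stationary_value => //.
  by move=> y; exact: (measurable_truncated_limit Fil_filtration Fbar_measurable).
by move=> w y y0; rewrite ltW ?truncated_limit_gt0//= truncated_limit_le1.
Qed.

Lemma limit_value_bounds w : 0 <= limit_value Fbar r w x <= 1 / (4 * r).
Proof.
have Fb01 (y : R) : 0 <= y -> 0 <= truncated_limit Fbar w y <= 1.
  by move=> y0; rewrite ltW ?truncated_limit_gt0//= truncated_limit_le1.
rewrite stationary_value_ge0//=.
apply: stationary_value_le => l vl; apply: lower_payoff_le => // z z0.
by apply: Fb01; exact: addr_ge0.
Qed.

Lemma integrable_limit_value : P.-integrable setT (EFin \o (fun w => limit_value Fbar r w x)).
Proof.
apply: (@bounded_integrable_probability _ _ _ P _ (1 / (4 * r))).
  exact: measurable_limit_value.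
by move=> w; have /andP[f0 f1] := limit_value_bounds w; rewrite ger0_norm.
Qed.

Lemma value_L1_bound :
  P.-integrable setT (EFin \o (fun w => expR (r * t) * V w)) /\
  forall e : R, 0 <= e ->
    (forall s, t <= s -> (\int[P]_w (Delta (s, w))%:E <= e%:E)%E) ->
    (\int[P]_w `|expR (r * t) * V w - limit_value Fbar r w x|%:E <=
       (2 / r * e)%:E)%E.
Proof.
have [C [[_ iC _ EC] VC]] := value_upper_bound.
have Vlow := value_lower_bound Fil_filtration Fhat_field r_gt0 t0 x0 V_value.
have mV : measurable_fun setT V by case: V_value.
pose E' := expR (r * t).
have E'0 : 0 < E' by exact: expR_gt0.
have E'E : E' * E = 1 by rewrite -expRD addrN expR0.
have bounds : \forall w \ae P, frozen w <= E' * V w <= frozen w + E' * C w.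
  apply: filterS2 Vlow VC => w H1 H2; rewrite H1/=.
  have : E' * V w <= E' * (E * frozen w + C w) by rewrite ler_pM2l.
  by rewrite mulrDr mulrA E'E mul1r.
have mEV : measurable_fun setT (fun w => E' * V w) by exact: measurable_funM.
have iE'C : P.-integrable setT (EFin \o (fun w => E' * C w)) by exact: integrableZl_EFin.
have iG := integrableD_EFin measurableT integrable_frozen iE'C.
(* An essential supremum is only known to be measurable; integrability comes from the sandwich
   [bounds]. *)
have iV : P.-integrable setT (EFin \o (fun w => E' * V w)).
  apply/integrableP; split; first exact/measurable_EFinP.
  have /integrableP[mG] := iG; apply: le_lt_trans.
  apply: ae_ge0_le_integral => //.
  - by apply: measurableT_comp => //; exact/measurable_EFinP.
  - exact: measurableT_comp.
  apply: filterS bounds => w /andP[H1 H2] _; rewrite /= lee_fin.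
  have /andP[f0 _] := frozen_bounds w.
  by rewrite ger0_norm ?(le_trans f0)// (le_trans H2)// ler_norm.
split=> // e e0 He.
have iD : P.-integrable setT (EFin \o (fun w => Delta (t, w) / (4 * r))).
  apply: (@bounded_integrable_probability _ _ _ P _ (1 / (4 * r))).
    exact: measurable_funM.
  move=> w; have /andP[D0 D1] := Delta_bounds w.
  have r4 : 0 < 4 * r by rewrite mulr_gt0.
  by rewrite ger0_norm ?divr_ge0 ?(ltW r4)// ler_pM2r ?invr_gt0.
have iS := integrableD_EFin measurableT iE'C iD.
have iB : P.-integrable setT (EFin \o (fun w => fine (B w))).
  apply: (@bounded_integrable_probability _ _ _ P _ (E / r)).
    exact: (measurableT_comp (fine_measurable measurableT) measurable_B).
  move=> w; have /andP[B0 B1] := B_bounds w.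
  by rewrite ger0_norm ?fine_ge0// -lee_fin fineK.
apply: (@le_trans _ _ (\int[P]_w (E' * C w + Delta (t, w) / (4 * r))%:E)%E).
  have mS := measurable_int _ iS.
  apply: (@le_trans _ _ (\int[P]_w `|E' * C w + Delta (t, w) / (4 * r)|%:E)%E).
    apply: ae_ge0_le_integral => //.
    - apply/measurable_EFinP; apply: measurableT_comp => //.
      by apply: measurable_funB => //; exact: measurable_limit_value.
    - by apply/measurable_EFinP; apply: measurableT_comp => //; exact/measurable_EFinP.
    apply: filterS2 bounds good_ae => w /andP[H1 H2] gw _; rewrite lee_fin.
    rewrite (le_trans _ (ler_norm _))//.
    have := limit_value_distance Fhat_field Fbar_gt0 L_ge0 r_gt0 t gw x0.
    rewrite -/(frozen w) -/E' !ler_norml => /andP[H3 H4].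
    by apply/andP; split; lra.
  have HC : \forall w \ae P, 0 <= E' * C w.
    by apply: filterS bounds => w /andP[]; lra.
  rewrite le_eqVlt; apply/orP; left; apply/eqP.
  apply: ae_eq_integral => //.
    by apply/measurable_EFinP; apply: measurableT_comp => //; exact/measurable_EFinP.
  apply: filterS HC => w HC _; rewrite ger0_norm// addr_ge0//.
  by have /andP[D0 _] := Delta_bounds w; rewrite divr_ge0// mulr_ge0// ltW.
have GT : Fil t setT by rewrite -(sub_sigma_measurableE sF).
have iDelta : P.-integrable setT (EFin \o (fun w => Delta (t, w))).
  apply: (@bounded_integrable_probability _ _ _ P _ 1) => // w.
  by have /andP[D0 D1] := Delta_bounds w; rewrite ger0_norm.
have scale (f : Omega -> R) k : P.-integrable setT (EFin \o f) ->
    (\int[P]_w (k * f w)%:E = k%:E * \int[P]_w (f w)%:E)%E.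
  by move=> intf; under eq_integral do rewrite EFinM; rewrite integralZl.
have iDE : P.-integrable setT (EFin \o (fun w => E * (Delta (t, w) / (4 * r)))).
  exact: integrableZl_EFin.
rewrite (integralD_real measurableT iE'C iD) scale// EC//.
rewrite (integralD_real measurableT iB iDE) scale//.
have -> : (\int[P]_w (Delta (t, w) / (4 * r))%:E =
    (4 * r)^-1%:E * \int[P]_w (Delta (t, w))%:E)%E.
  by rewrite -scale//; apply: eq_integral => w _; rewrite mulrC.
have HD := He t (lexx t).
have HB : (\int[P]_w (fine (B w))%:E <= (E / r * e)%:E)%E.
  rewrite (_ : (\int[P]_w (fine (B w))%:E = \int[P]_w B w)%E); last first.
    by apply: eq_integral => w _; rewrite fineK.
  exact: (integral_tail_distance_le Fil_filtration Fhat_field Fbar_measurable Fbar_gt0 r_gt0 t0 e0 He).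
have fD := integrable_fin_num measurableT iDelta.
have fB := integrable_fin_num measurableT iB.
rewrite -(fineK fD) lee_fin in HD; rewrite -(fineK fB) lee_fin in HB.
rewrite -(fineK fD) -(fineK fB) -!(EFinM, EFinD) lee_fin.
move: HD HB; set p := fine _; set q := fine _ => HD HB.
rewrite mulrDr !mulrA E'E mul1r.
have H1 : E' * q <= e / r.
  have -> : e / r = E' * (E / r * e) by rewrite !mulrA E'E; field; rewrite gt_eqF.
  by rewrite ler_pM2l.
have H2 : (4 * r)^-1 * p <= (4 * r)^-1 * e by rewrite ler_pM2l// invr_gt0 mulr_gt0.
have -> : 2 / r * e = e / r + 4 * ((4 * r)^-1 * e) by field; rewrite gt_eqF.
have : 0 <= (4 * r)^-1 * e by rewrite mulr_ge0// invr_ge0 mulr_ge0// ltW.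
lra.
Qed.

End value_asymptotics.

Lemma classical_solution_ext (R : realType) (r : R) (F G V : R -> R) :
  (forall x : R, 0 <= x -> F x = G x) ->
  classical_solution r F V -> classical_solution r G V.
Proof.
move=> FG [dV [D c E l]]; exists dV; split=> // x x0.
by rewrite E// FG.
Qed.

Lemma unique_limit_value (R : realType) d (Omega : measurableType d)
    (Fbar : Omega -> R -> R) (L r : R) (w : Omega) : 0 < r -> 0 <= L ->
  (forall w (x : R), 0 <= x -> 0 < Fbar w x) -> limit_survival Fbar L w ->
  unique_classical_solution r (Fbar w) (limit_value Fbar r w).
Proof.
move=> r0 L0 Fbar_gt0 lw.
have FbE (x : R) : 0 <= x -> truncated_limit Fbar w x = Fbar w x.
  exact: (truncated_limitE lw).
have sol : classical_solution r (Fbar w) (limit_value Fbar r w).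
  apply: (classical_solution_ext FbE).
  apply: (@stationary_value_classical _ _ r0 _ L) => //.
  - by move=> x _; exact: truncated_limit_gt0.
  - by move=> x _; exact: truncated_limit_le1.
  - by move=> x y x0 xy; exact: (truncated_limit_nincr lw).
  - by move=> x y x0 y0; exact: (truncated_limit_lip lw).
  case: lw => _ _ _ lim0; apply: cvg_trans lim0; apply: near_eq_cvg; near=> x.
  by rewrite FbE//; near: x; exact: nbhs_pinfty_ge.
split=> // U solU x x0; apply/le_anti/andP; split.
  exact: (classical_solution_le r0 (Fbar_gt0 w) solU sol).
exact: (classical_solution_le r0 (Fbar_gt0 w) sol solU).
Unshelve. all: by end_near. Qed.

Theorem proposition4p5 (R : realType) (d : measure_display)
    (Omega : measurableType d) (P : probability Omega R)
    (r : R) (r_gt0 : 0 < r)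
    (Fil : R -> set (set Omega)) (W : R -> Omega -> R)
    (Fil_filtration : filtration Fil)
    (Fil_usual : usual_conditions P Fil)
    (W_wiener : wiener_process P W)
    (Fil_W : forall t : R, 0 <= t -> Fil t = augmented_filtration P W t)
    (Xbar : {RV P >-> R})
    (Xbar_ge0 : forall w, 0 <= Xbar w)
    (Xbar_atomless : forall x : R, distribution P Xbar [set x] = 0%E)
    (Xbar_unbounded : ~ bounded_set (support_law (distribution P Xbar)))
    (Fhat : R -> R -> Omega -> R)
    (Fhat_field : cond_survival_field P Fil Xbar Fhat)
    (Xbar_finite_expectation : ('E_P[Xbar] < +oo)%E)
    (Fhat_gt0 : forall t x : R, 0 <= t -> 0 <= x ->
       \forall w \ae P, 0 < Fhat t x w)
    (LFhat : R) (LFhat_ge0 : 0 <= LFhat)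
    (Fhat_lipschitz : forall t x y : R, 0 <= t -> 0 <= x -> 0 <= y ->
       (ess_sup P (fun w => `|Fhat t x w - Fhat t y w|%:E)
          <= (LFhat * `|x - y|)%:E)%E)
    (Fbar : Omega -> R -> R)
    (Fbar_measurable : measurable_fun
       (setT `*` `[0, +oo[ :
          set (g_sigma_algebraType (filtration_infty Fil) * R))
       (fun p => Fbar p.1 p.2))
    (Fbar_gt0 : forall w (x : R), 0 <= x -> 0 < Fbar w x)
    (LFbar : R) (LFbar_ge0 : 0 <= LFbar)
    (Fhat_cvg_Fbar :
       (\int[P]_w ereal_sup
          [set `|Fhat t x w - Fbar w x|%:E | x in `[0%R, +oo[%classic])%E
         @[t --> +oo] --> 0%E)
    (Fbar_lipschitz : \forall w \ae P, forall x y : R, 0 <= x -> 0 <= y ->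
       `|Fbar w x - Fbar w y| <= LFbar * `|x - y|)
    (Vtilde : R -> R -> Omega -> R)
    (Vtilde_value : forall t x : R, 0 <= t -> 0 <= x ->
       value P r Fil Fhat t x (Vtilde t x)) :
  exists Vhat : Omega -> R -> R,
    (\forall w \ae P, unique_classical_solution r (Fbar w) (Vhat w)) /\
    forall x : R, 0 <= x ->
      cvg_L1 P (fun t w => expR (r * t) * Vtilde t x w) (fun w => Vhat w x).
Proof.
have good_ae := limit_survival_ae Fil_filtration Fhat_field Xbar_ge0
  Xbar_finite_expectation Fbar_measurable Fbar_gt0 LFbar_ge0 Fbar_lipschitz
  Fhat_cvg_Fbar.
exists (limit_value Fbar r); split.
  by apply: filterS good_ae => w; exact: unique_limit_value.
move=> x x0.
have bound t (t0 : 0 <= t) := value_L1_bound Fil_filtration Fhat_field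
  Fbar_measurable Fbar_gt0 LFbar_ge0 good_ae r_gt0 t0 x0 (Vtilde_value t x t0 x0).
split.
- by move=> t t0; have [] := bound t t0.
- exact: (integrable_limit_value P Fil_filtration Fbar_measurable Fbar_gt0 r_gt0 x0).
apply/ge0_cvge0P => [t|e e0]; first by apply: integral_ge0 => w _; rewrite lee_fin.
(* The factor r / 2 cancels the constant of [value_L1_bound]. *)
have e1 : 0 < e * (r / 2) by rewrite mulr_gt0// divr_gt0.
have gap_ge0 t : (0 <= \int[P]_w ereal_sup
    [set `|Fhat t y w - Fbar w y|%:E | y in `[0%R, +oo[%classic])%E.
  apply: integral_ge0 => w _.
  apply: (@le_trans _ _ `|Fhat t 0 w - Fbar w 0|%:E); first by rewrite lee_fin.
  by apply: ereal_sup_ubound; exists 0 => //=; rewrite in_itv/= lexx.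
have [T T0 HT] := (ge0_cvge0P gap_ge0).1 Fhat_cvg_Fbar _ e1.
exists T => // t Tt; have t0 := le_trans T0 Tt.
have [_ /(_ _ (ltW e1))] := bound t t0.
have -> : 2 / r * (e * (r / 2)) = e by field; rewrite gt_eqF.
apply=> s ts.
apply: le_trans (HT s (le_trans Tt ts)).
exact: (integral_field_distance_le Fhat_field Fbar_gt0 (le_trans t0 ts)).
Qed.
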